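(* Let $\mathbb H=\{\tau\in\mathbb C:\operatorname{Im}\tau>0\}$. The function $$ \mathfrak u(\tau)=\frac{\vartheta_3(\tau)}{\vartheta_2(\tau)}\cdot {}_2F_1\!\left(\tfrac12,\tfrac14;\tfrac54\,\Big|\,\frac{\vartheta_3^4(\tau)}{\vartheta_2^4(\tau)}\right),\qquad \tau\in\mathbb H, $$ where the hypergeometric function is understood by analytic continuation, is a solution of the Schwarz equation $$ [\mathfrak u,\tau]=-2\,\wp(2\mathfrak u;4,0), $$ where $\wp(\,\cdot\,;g_2,g_3)$ is the Weierstrass function satisfying $\wp'^2=4\wp^3-g_2\wp-g_3$.
   Context: For a nonconstant analytic function $f(\tau)$ (with $f_\tau\neq0$) put $$ [f,\tau]:=\frac{f_{\tau\tau\tau}}{f_\tau^{3}}-\frac32\,\frac{f_{\tau\tau}^{2}}{f_\tau^{4}}, $$ where subscripts denote derivatives with respect to $\tau$. The theta-constants are $$ \vartheta_2(\tau)=e^{\frac14\pi i\tau}\sum_{k\in\mathbb Z}e^{(k^2+k)\pi i\tau},\qquad \vartheta_3(\tau)=\sum_{k\in\mathbb Z}e^{k^2\pi i\tau}. $$ ${}_2F_1(\alpha,\beta;\gamma|z)$ is the Gauss hypergeometric function, given by its power series for $|z|<1$ and continued analytically. The function $\vartheta_3^4/\vartheta_2^4$ takes none of the values $0,1,\infty$ on $\mathbb H$, and $\mathbb H$ is simply connected. Hence $\mathfrak u$ means any holomorphic function on $\mathbb H$ obtained as follows: start with the formula, using the power series, near a point where $|\vartheta_3^4/\vartheta_2^4|<1$,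 and continue analytically along paths in $\mathbb H$. *)

(* Defs.v *)
From Stdlib Require Import Reals ZArith.
From Coquelicot Require Import Coquelicot.

Open Scope C_scope.

(* Sum of a complex series, taken componentwise; it is the usual sum as soon as
   the series converges in C. *)
Definition CSeries (a : nat -> C) : C :=
  (Series (fun n => Re (a n)), Series (fun n => Im (a n))).

(* sum_{k in Z} a k, as the sum of the two halves k >= 0 and k <= -1. *)
Definition CSeriesZ (a : Z -> C) : C :=
  CSeries (fun n => a (Z.of_nat n)) + CSeries (fun n => a (- Z.of_nat n - 1)%Z).

Definition cexp (z : C) : C :=
  ((exp (Re z) * cos (Im z))%R, (exp (Re z) * sin (Im z))%R).

Definition upper_half_plane (tau : C) : Prop := (0 < Im tau)%R.

Definition theta2 (tau : C) : C :=
  cexp (1 / 4 * PI * Ci * tau) *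
  CSeriesZ (fun k => cexp (IZR (k * k + k) * PI * Ci * tau)).

Definition theta3 (tau : C) : C :=
  CSeriesZ (fun k => cexp (IZR (k * k) * PI * Ci * tau)).

Fixpoint pochhammer (a : C) (n : nat) : C :=
  match n with
  | O => 1
  | S m => pochhammer a m * (a + INR m)
  end.

(* The power series of 2F1(a, b; c | z); meaningful for |z| < 1 only. *)
Definition hyp2F1_series (a b c z : C) : C :=
  CSeries (fun n =>
    pochhammer a n * pochhammer b n / (pochhammer c n * INR (fact n)) * z ^ n).

Definition holomorphic_on (D : C -> Prop) (f : C -> C) : Prop :=
  forall z : C, D z -> ex_derive (K := C_AbsRing) (V := C_NormedModule) f z.

(* The formula for u, read with the power series of 2F1. *)
Definition u_formula (tau : C) : C :=
  theta3 tau / theta2 tau *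
  hyp2F1_series (1 / 2) (1 / 4) (5 / 4) (theta3 tau ^ 4 / theta2 tau ^ 4).

(* u is a holomorphic function on the upper half-plane obtained by analytic
   continuation of the germ of u_formula at some point where the power series
   converges. *)
Definition is_continuation_of_u_formula (u : C -> C) : Prop :=
  holomorphic_on upper_half_plane u /\
  exists tau0 : C,
    upper_half_plane tau0 /\
    (Cmod (theta3 tau0 ^ 4 / theta2 tau0 ^ 4) < 1)%R /\
    locally tau0 (fun tau : C => u tau = u_formula tau).

(* [f, tau] = f'''/f'^3 - (3/2) f''^2/f'^4; meaningful where f' <> 0. *)
Definition schwarz (f : C -> C) (tau : C) : C :=
  let f1 := C_derive f in
  let f2 := C_derive f1 in
  let f3 := C_derive f2 in
  f3 tau / f1 tau ^ 3 - 3 / 2 * (f2 tau ^ 2 / f1 tau ^ 4).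

Definition lattice_point (w1 w2 : C) (m n : Z) : C := IZR m * w1 + IZR n * w2.

Definition in_lattice (w1 w2 z : C) : Prop :=
  exists m n : Z, z = lattice_point w1 w2 m n.

(* The Weierstrass function of the lattice Z w1 + Z w2.  The lattice sum is
   absolutely convergent when w1, w2 are linearly independent over R and z is
   not a lattice point, so iterating the summation is harmless. *)
Definition weierstrass_p (w1 w2 z : C) : C :=
  1 / z ^ 2 +
  CSeriesZ (fun m => CSeriesZ (fun n =>
    if ((m =? 0) && (n =? 0))%Z%bool then 0
    else 1 / (z - lattice_point w1 w2 m n) ^ 2 - 1 / lattice_point w1 w2 m n ^ 2)).

(* (w1, w2) is a basis of the lattice whose Weierstrass function is
   wp( . ; g2, g3), i.e. satisfies wp'^2 = 4 wp^3 - g2 wp - g3.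
   Im (w2 conj(w1)) <> 0 says that w1, w2 are linearly independent over R. *)
Definition weierstrass_periods (g2 g3 w1 w2 : C) : Prop :=
  Im (w2 * Cconj w1) <> 0%R /\
  forall z : C, ~ in_lattice w1 w2 z ->
    C_derive (weierstrass_p w1 w2) z ^ 2 =
      4 * weierstrass_p w1 w2 z ^ 3 - g2 * weierstrass_p w1 w2 z - g3.

(* Main.v *)
Require Import Defs.
From Stdlib Require Import Reals ZArith Lra Lia Classical ClassicalEpsilon.
From Coquelicot Require Import Coquelicot.

(* Write s = theta3/theta2. Since d/dz [z^(1/4) 2F1(1/2,1/4;5/4|z)] = z^(-3/4) (1-z)^(-1/2) / 4, the function u is the
   lemniscatic integral of dt / sqrt(1 - t^4) from 0 to s. Hence wp(2u) = (1+s^4)^2 / (4 s^2 (1-s^4)) near s = 0: the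
   reciprocals of both sides solve the same equation y'^2 = 16 (y - y^3) / (1-s^4) with the same leading term 4 s^2,
   which forces equality. The identity theorem continues this along paths; u never reaches a half-lattice point, because
   wp(2u) would blow up while the theta quotient stays finite.

   The derivative formula for theta3/theta2 and Jacobi's quartic identity give u'^2 = (pi/4 theta2 theta3 theta4^2)^2,
   so u' is a constant multiple of theta2 theta3 theta4^2, and the Schwarz equation becomes an identity between the
   logarithmic derivatives of the theta constants. These identities come from Landen's relations between the values at
   tau and 2 tau: the defect of each identity is reproduced by tau -> 2 tau up to a factor, and it tends to 0 at
   i infinity, so it vanishes. Landen's relations also propagate the nonvanishing of the theta constants from
   neighbourhoods of i infinity to the whole half-plane.

   The identity theorem needs Goursat's theorem, since u is only assumed complex differentiable: Goursat provides a
   primitive, which is twice differentiable, and for twice differentiable functions the maximum principle follows from a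
   second-order expansion. *)

Open Scope C_scope.

(** * Complex derivatives *)

(** The quotient s never takes the value 0 on the upper half-plane, and |s| is large near i
    infinity, so wp(2u) cannot be read off at a point of the half-plane. It is determined in the
    s-plane, at the pole of wp over s = 0, carried along a radius to the value of s at the base
    point, and only then pulled back to tau. Nothing is known of the lattice except wp'^2 = 4 wp^3 -
    4 wp. At the pole the equation for y = 1/wp degenerates: y' vanishes with y and Lipschitz
    uniqueness breaks down. The common leading term singles out one solution, and a contraction
    adapted to the singular point s = 0 takes the place of Picard's theorem. Among the modular
    transformations, tau -> 2 tau is the one that acts on theta products by a mere rearrangement of
    double sums; all constants are then read off at i infinity. The comparison of (1 - s^4)^(-1/2)
    with theta2^2 / theta4^2 leaves a sign open, so only the square of the constant in u' is
    determined. That suffices, since the Schwarz expression is even in this constant. *)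

Definition cderiv (f : C -> C) (z l : C) : Prop :=
  forall eps : R, (0 < eps)%R -> exists delta : R, (0 < delta)%R /\
    forall w : C, (Cmod (w - z) < delta)%R ->
      (Cmod (f w - f z - l * (w - z)) <= eps * Cmod (w - z))%R.

Definition ccont (f : C -> C) (z : C) : Prop :=
  forall eps : R, (0 < eps)%R -> exists delta : R, (0 < delta)%R /\
    forall w : C, (Cmod (w - z) < delta)%R -> (Cmod (f w - f z) < eps)%R.

Lemma locally_Cmod (z : C) (P : C -> Prop) :
  locally (T := C_UniformSpace) z P <->
  exists delta : R, (0 < delta)%R /\ forall w : C, (Cmod (w - z) < delta)%R -> P w.
Proof.
  split.
  - intros H. apply locally_C in H. destruct H as [d Hd].
    exists d; split; [apply cond_pos|]. intros w Hw. apply Hd. exact Hw.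
  - intros [d [Hd H]]. apply locally_C. exists (mkposreal d Hd). intros w Hw. apply H. exact Hw.
Qed.

Lemma cderiv_is_derive (f : C -> C) (z l : C) :
  cderiv f z l <-> is_derive (K := C_AbsRing) (V := C_NormedModule) f z l.
Proof.
  split.
  - intros H. split.
    + apply (is_linear_scal_l (K := C_AbsRing) (V := C_NormedModule) l).
    + intros x Hx. apply (is_filter_lim_locally_unique (K := C_AbsRing) (V := AbsRing_NormedModule C_AbsRing)) in Hx.
      rewrite <- Hx. intros eps. destruct (H eps (cond_pos eps)) as [d [Hd Hw]].
      exists (mkposreal d Hd). intros w Hb.
      generalize (Hw w Hb). intros Hc.
      change (Cmod (f w - f z - (w - z) * l) <= eps * Cmod (w - z))%R.
      rewrite (Cmult_comm (w - z) l). exact Hc.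
  - intros [_ H]. intros eps He.
    destruct (H z (fun P HP => HP) (mkposreal eps He)) as [d Hd].
    exists d. split; [apply cond_pos|]. intros w Hw.
    generalize (Hd w Hw). intros Hc.
    change (Cmod (f w - f z - (w - z) * l) <= eps * Cmod (w - z))%R in Hc.
    rewrite (Cmult_comm l (w - z)). exact Hc.
Qed.

(** The library's product and chain rules are used over the ring viewed as a module over itself,
    while the theorem is stated over [C_NormedModule]; the [Cmod] form of [cderiv] translates into
    both. *)
Lemma cderiv_is_derive_abs (f : C -> C) (z l : C) :
  cderiv f z l <-> is_derive (K := C_AbsRing) (V := AbsRing_NormedModule C_AbsRing) f z l.
Proof.
  split.
  - intros H. split.
    + apply (is_linear_scal_l (K := C_AbsRing) (V := AbsRing_NormedModule C_AbsRing) l).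
    + intros x Hx. apply (is_filter_lim_locally_unique (K := C_AbsRing) (V := AbsRing_NormedModule C_AbsRing)) in Hx.
      rewrite <- Hx. intros eps. destruct (H eps (cond_pos eps)) as [d [Hd Hw]].
      exists (mkposreal d Hd). intros w Hb.
      generalize (Hw w Hb). rewrite (Cmult_comm l (w - z)). intros Hc. exact Hc.
  - intros [_ H]. intros eps He.
    destruct (H z (fun P HP => HP) (mkposreal eps He)) as [d Hd].
    exists d. split; [apply cond_pos|]. intros w Hw.
    rewrite (Cmult_comm l (w - z)). exact (Hd w Hw).
Qed.

Lemma cderiv_C_derive (f : C -> C) (z l : C) : cderiv f z l -> C_derive f z = l.
Proof. intros H. apply is_C_derive_unique. apply cderiv_is_derive. exact H. Qed.

Lemma cderiv_unique (f : C -> C) (z l1 l2 : C) : cderiv f z l1 -> cderiv f z l2 -> l1 = l2.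
Proof. intros H1 H2. rewrite <- (cderiv_C_derive _ _ _ H1). apply cderiv_C_derive, H2. Qed.

Lemma cderiv_ext_loc (f g : C -> C) (z l : C) :
  (exists delta : R, (0 < delta)%R /\ forall w : C, (Cmod (w - z) < delta)%R -> f w = g w) ->
  cderiv f z l -> cderiv g z l.
Proof.
  intros [d [Hd E]] H eps He. destruct (H eps He) as [d' [Hd' H']].
  exists (Rmin d d'). split; [apply Rmin_glb_lt; assumption|].
  intros w Hw. rewrite <- (E w), <- (E z).
  - apply H'. eapply Rlt_le_trans; [exact Hw|apply Rmin_r].
  - replace (z - z) with (RtoC 0) by ring. rewrite Cmod_0. exact Hd.
  - eapply Rlt_le_trans; [exact Hw|apply Rmin_l].
Qed.

Lemma cderiv_ext (f g : C -> C) (z l : C) :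
  (forall w, f w = g w) -> cderiv f z l -> cderiv g z l.
Proof.
  intros E. apply cderiv_ext_loc. exists 1%R. split; [lra|]. intros; apply E.
Qed.

Lemma cderiv_eq (f : C -> C) (z l l' : C) : cderiv f z l -> l = l' -> cderiv f z l'.
Proof. intros H <-. exact H. Qed.

Lemma cderiv_ccont (f : C -> C) (z l : C) : cderiv f z l -> ccont f z.
Proof.
  intros H eps He. destruct (H 1%R Rlt_0_1) as [d [Hd Hw]].
  assert (Hl : (0 <= Cmod l)%R) by apply Cmod_ge_0.
  exists (Rmin d (eps / (2 + Cmod l))). split.
  - apply Rmin_glb_lt; [exact Hd|]. apply Rdiv_lt_0_compat; lra.
  - intros w Hb.
    assert (H1 : (Cmod (w - z) < d)%R) by (eapply Rlt_le_trans; [exact Hb|apply Rmin_l]).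
    assert (H2 : (Cmod (w - z) < eps / (2 + Cmod l))%R) by (eapply Rlt_le_trans; [exact Hb|apply Rmin_r]).
    specialize (Hw w H1).
    replace (f w - f z) with ((f w - f z - l * (w - z)) + l * (w - z)) by ring.
    eapply Rle_lt_trans; [apply Cmod_triangle|]. rewrite Cmod_mult.
    apply (Rmult_lt_compat_r (2 + Cmod l)) in H2; [|lra].
    replace (eps / (2 + Cmod l) * (2 + Cmod l))%R with eps in H2 by (field; lra).
    assert (H0 : (0 <= Cmod (w - z))%R) by apply Cmod_ge_0. nra.
Qed.

Lemma cderiv_const (c z : C) : cderiv (fun _ => c) z 0.
Proof.
  intros eps He. exists 1%R. split; [lra|]. intros w _.
  replace (c - c - 0 * (w - z)) with (RtoC 0) by ring. rewrite Cmod_0.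
  apply Rmult_le_pos; [lra|apply Cmod_ge_0].
Qed.

Lemma cderiv_id (z : C) : cderiv (fun w => w) z 1.
Proof.
  intros eps He. exists 1%R. split; [lra|]. intros w _.
  replace (w - z - 1 * (w - z)) with (RtoC 0) by ring. rewrite Cmod_0.
  apply Rmult_le_pos; [lra|apply Cmod_ge_0].
Qed.

Lemma cderiv_plus (f g : C -> C) (z a b : C) :
  cderiv f z a -> cderiv g z b -> cderiv (fun w => f w + g w) z (a + b).
Proof.
  intros Hf Hg. apply cderiv_is_derive_abs in Hf. apply cderiv_is_derive_abs in Hg. apply cderiv_is_derive_abs.
  exact (is_derive_plus _ _ _ _ _ Hf Hg).
Qed.

Lemma cderiv_mult (f g : C -> C) (z a b : C) :
  cderiv f z a -> cderiv g z b -> cderiv (fun w => f w * g w) z (a * g z + f z * b).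
Proof.
  intros Hf Hg. apply cderiv_is_derive_abs in Hf. apply cderiv_is_derive_abs in Hg. apply cderiv_is_derive_abs.
  exact (is_derive_mult _ _ _ _ _ Hf Hg Cmult_comm).
Qed.

Lemma cderiv_comp (f g : C -> C) (z a b : C) :
  cderiv f (g z) a -> cderiv g z b -> cderiv (fun w => f (g w)) z (a * b).
Proof.
  intros Hf Hg. apply cderiv_is_derive_abs in Hf. apply cderiv_is_derive_abs in Hg. apply cderiv_is_derive_abs.
  rewrite Cmult_comm. exact (is_derive_comp _ _ _ _ _ Hf Hg).
Qed.

Lemma cderiv_scal (c : C) (f : C -> C) (z a : C) :
  cderiv f z a -> cderiv (fun w => c * f w) z (c * a).
Proof.
  intros Hf. eapply cderiv_eq; [apply (cderiv_mult (fun _ => c) f); [apply cderiv_const|exact Hf]|]. cbv beta. ring.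
Qed.

Lemma cderiv_opp (f : C -> C) (z a : C) : cderiv f z a -> cderiv (fun w => - f w) z (- a).
Proof.
  intros H. apply cderiv_ext with (fun w => (- (1)) * f w); [intros; ring|].
  eapply cderiv_eq; [apply cderiv_scal, H|ring].
Qed.

Lemma cderiv_minus (f g : C -> C) (z a b : C) :
  cderiv f z a -> cderiv g z b -> cderiv (fun w => f w - g w) z (a - b).
Proof. intros Hf Hg. apply cderiv_plus; [exact Hf|apply cderiv_opp, Hg]. Qed.

Lemma cderiv_inv_id (z : C) : z <> 0 -> cderiv (fun w => / w) z (- / z ^ 2).
Proof.
  intros Hz eps He. assert (Hm : (0 < Cmod z)%R) by (apply Cmod_gt_0, Hz).
  assert (Hm3 : (0 < Cmod z * Cmod z * Cmod z)%R) by (repeat apply Rmult_lt_0_compat; lra).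
  exists (Rmin (Cmod z / 2) (eps * (Cmod z * Cmod z * Cmod z) / 2)). split.
  { apply Rmin_glb_lt; [lra|]. apply Rdiv_lt_0_compat; [|lra]. apply Rmult_lt_0_compat; lra. }
  intros w Hw.
  assert (H1 : (Cmod (w - z) < Cmod z / 2)%R) by (eapply Rlt_le_trans; [exact Hw|apply Rmin_l]).
  assert (H2 : (Cmod (w - z) < eps * (Cmod z * Cmod z * Cmod z) / 2)%R) by (eapply Rlt_le_trans; [exact Hw|apply Rmin_r]).
  assert (H3 : (Cmod z / 2 < Cmod w)%R).
  { assert (Cmod z <= Cmod w + Cmod (z - w))%R.
    { replace z with (w + (z - w)) at 1 by ring. apply Cmod_triangle. }
    replace (z - w) with (- (w - z)) in H by ring. rewrite Cmod_opp in H. lra. }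
  assert (Hw0 : w <> 0). { apply Cmod_gt_0. lra. }
  replace (/ w - / z - - / z ^ 2 * (w - z)) with ((w - z) * ((w - z) / (w * z ^ 2)))
    by (field; split; assumption).
  rewrite Cmod_mult, Rmult_comm. apply Rmult_le_compat_r; [apply Cmod_ge_0|].
  rewrite Cmod_div, Cmod_mult, Cmod_pow.
  2: { apply Cmult_neq_0; [exact Hw0|]. apply Cpow_nz, Hz. }
  apply Rle_div_l.
  { apply Rmult_gt_0_compat; [lra|]. apply pow_lt. lra. }
  simpl. assert ((eps * (Cmod z / 2 * (Cmod z * Cmod z))) <= (eps * (Cmod w * (Cmod z * (Cmod z * 1)))))%R.
  { apply Rmult_le_compat_l; [lra|]. rewrite Rmult_1_r. apply Rmult_le_compat_r; [nra|lra]. }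
  nra.
Qed.

Lemma cderiv_inv (f : C -> C) (z a : C) : cderiv f z a -> f z <> 0 ->
  cderiv (fun w => / f w) z (- a / f z ^ 2).
Proof.
  intros H Hz. eapply cderiv_eq; [apply (cderiv_comp (fun w => / w)); [apply cderiv_inv_id, Hz|exact H]|].
  field. exact Hz.
Qed.

Lemma cderiv_div (f g : C -> C) (z a b : C) : cderiv f z a -> cderiv g z b -> g z <> 0 ->
  cderiv (fun w => f w / g w) z ((a * g z - f z * b) / g z ^ 2).
Proof.
  intros Hf Hg Hz. eapply cderiv_eq; [apply (cderiv_mult f (fun w => / g w)); [exact Hf|apply cderiv_inv; [exact Hg|exact Hz]]|].
  field. exact Hz.
Qed.

Lemma cderiv_pow (f : C -> C) (z a : C) (n : nat) : cderiv f z a ->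
  cderiv (fun w => f w ^ n) z (INR n * f z ^ (pred n) * a).
Proof.
  intros H. induction n as [|n IH].
  - simpl. eapply cderiv_eq; [apply cderiv_const|]. ring.
  - eapply cderiv_eq; [apply (cderiv_mult f (fun w => f w ^ n)); [exact H|exact IH]|].
    rewrite (S_INR n), RtoC_plus. destruct n as [|n].
    + simpl. ring.
    + change (pred (S (S n))) with (S n). change (pred (S n)) with n. rewrite !Cpow_S. ring.
Qed.

Lemma Cmod_minus_sym (a b : C) : Cmod (a - b) = Cmod (b - a).
Proof. replace (a - b) with (- (b - a)) by ring. apply Cmod_opp. Qed.

Lemma Cmod_triangle_rev (a b : C) : (Cmod a - Cmod b <= Cmod (a - b))%R.
Proof.
  assert (H : (Cmod a <= Cmod (a - b) + Cmod b)%R).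
  { replace a with (a - b + b) at 1 by ring. apply Cmod_triangle. }
  lra.
Qed.

Lemma Cmod_triangle_dist (a b c : C) : (Cmod (a - c) <= Cmod (a - b) + Cmod (b - c))%R.
Proof. replace (a - c) with ((a - b) + (b - c)) by ring. apply Cmod_triangle. Qed.

Lemma Re_le_Cmod (z : C) : (Re z <= Cmod z)%R.
Proof. eapply Rle_trans; [apply Rle_abs|apply re_le_Cmod]. Qed.

Lemma Im_le_Cmod (z : C) : (Rabs (Im z) <= Cmod z)%R.
Proof. eapply Rle_trans; [|apply Rmax_Cmod]. apply Rmax_r. Qed.

Lemma Cmod_le_ReIm (z : C) : (Cmod z <= Rabs (Re z) + Rabs (Im z))%R.
Proof.
  destruct z as [x y]. replace ((x, y) : C) with (RtoC x + Ci * RtoC y).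
  2: { unfold Ci, RtoC, Cplus, Cmult; simpl; f_equal; ring. }
  eapply Rle_trans; [apply Cmod_triangle|]. rewrite Cmod_mult, Cmod_Ci, !Cmod_R, Rmult_1_l.
  apply Req_le. f_equal; f_equal; simpl; ring.
Qed.

Lemma C_Re_Im (z : C) : z = Re z + Ci * Im z.
Proof. destruct z as [x y]. unfold Ci, RtoC, Cplus, Cmult; simpl; f_equal; ring. Qed.

Lemma Cmod_sqr (z : C) : (Cmod z * Cmod z = Re z * Re z + Im z * Im z)%R.
Proof. generalize (Cmod2_alt z). simpl. rewrite !Rmult_1_r. auto. Qed.

Lemma is_derive_Re_line (f : C -> C) (p v l c : C) (t : R) :
  cderiv f (p + t * v)%C l ->
  is_derive (fun s : R => Re (c * f (p + s * v)%C)) t (Re (c * (l * v))).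
Proof.
  intros H. apply is_derive_Reals. intros eps He.
  set (K := (Cmod c * Cmod v + 1)%R).
  assert (HK : (0 < K)%R). { unfold K. assert (0 <= Cmod c * Cmod v)%R by (apply Rmult_le_pos; apply Cmod_ge_0). lra. }
  destruct (H (eps / (2 * K))%R) as [d [Hd Hw]]. { apply Rdiv_lt_0_compat; lra. }
  assert (Hv : (0 < Cmod v + 1)%R). { generalize (Cmod_ge_0 v). lra. }
  assert (Hdv : (0 < d / (Cmod v + 1))%R) by (apply Rdiv_lt_0_compat; lra).
  exists (mkposreal _ Hdv). intros h Hh0 Hh. simpl in Hh.
  specialize (Hw (p + (t + h)%R * v)).
  replace (p + (t + h)%R * v - (p + t * v)) with (h * v) in Hw by (rewrite RtoC_plus; ring).
  rewrite Cmod_mult, Cmod_R in Hw.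
  assert (Hb : (Rabs h * Cmod v < d)%R).
  { apply (Rmult_lt_compat_r (Cmod v + 1)) in Hh; [|lra].
    replace (d / (Cmod v + 1) * (Cmod v + 1))%R with d in Hh by (field; lra).
    generalize (Rabs_pos h) (Cmod_ge_0 v). nra. }
  specialize (Hw Hb).
  replace ((Re (c * f (p + (t + h)%R * v)%C) - Re (c * f (p + t * v)%C)) / h - Re (c * (l * v)))%R
    with (Re (c * (f (p + (t + h)%R * v)%C - f (p + t * v)%C - l * (h * v))) / h)%R.
  2: { unfold Rdiv. apply Rmult_eq_reg_r with h; [|exact Hh0].
       rewrite !Rmult_minus_distr_r, !Rmult_assoc, (Rinv_l _ Hh0), !Rmult_1_r.
       replace (c * (f (p + (t + h)%R * v)%C - f (p + t * v)%C - l * (h * v)))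
         with (c * f (p + (t + h)%R * v)%C + - (c * f (p + t * v)%C) + - (h * (c * (l * v)))) by ring.
       rewrite !re_plus, !re_opp, re_scal_l. ring. }
  unfold Rdiv. rewrite Rabs_mult, Rabs_inv.
  assert (Ha : (0 < Rabs h)%R) by (apply Rabs_pos_lt, Hh0).
  apply Rmult_lt_reg_r with (Rabs h); [exact Ha|].
  rewrite Rmult_assoc, Rinv_l, Rmult_1_r by lra.
  eapply Rle_lt_trans; [apply re_le_Cmod|]. rewrite Cmod_mult.
  eapply Rle_lt_trans; [apply Rmult_le_compat_l; [apply Cmod_ge_0|exact Hw]|].
  replace (Cmod c * (eps / (2 * K) * (Rabs h * Cmod v)))%R with (eps * Rabs h * ((Cmod c * Cmod v) / (2 * K)))%R by (field; lra).
  assert ((Cmod c * Cmod v) / (2 * K) < 1)%R.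
  { apply Rlt_div_l; [lra|]. unfold K. assert (0 <= Cmod c * Cmod v)%R by (apply Rmult_le_pos; apply Cmod_ge_0). lra. }
  assert (0 < eps * Rabs h)%R by (apply Rmult_lt_0_compat; lra). nra.
Qed.

(** A mean value equality fails for complex values. The real theorem is applied to Re (conj w * f)
    along the segment, with w = f b - f a: its increment is |w|^2 and its derivative is at most |w|
    M |b - a|. *)
Lemma mean_value_ineq (f f' : C -> C) (a b : C) (M : R) :
  (forall t : R, (0 <= t <= 1)%R -> cderiv f (a + t * (b - a)) (f' (a + t * (b - a))%C)) ->
  (forall t : R, (0 <= t <= 1)%R -> (Cmod (f' (a + t * (b - a))%C) <= M)%R) ->
  (Cmod (f b - f a) <= M * Cmod (b - a))%R.
Proof.
  intros Hd HM. set (w := f b - f a).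
  destruct (MVT_gen (fun s : R => Re (Cconj w * f (a + s * (b - a))%C)) 0 1
    (fun s : R => Re (Cconj w * (f' (a + s * (b - a))%C * (b - a))))) as [t [Ht E]].
  - rewrite Rmin_left, Rmax_right by lra. intros t Ht. apply is_derive_Re_line. apply Hd. lra.
  - rewrite Rmin_left, Rmax_right by lra. intros t Ht. apply continuity_pt_filterlim.
    apply (ex_derive_continuous (fun s : R => Re (Cconj w * f (a + s * (b - a))%C))).
    eexists. apply is_derive_Re_line. apply Hd. lra.
  - rewrite Rmin_left, Rmax_right in Ht by lra.
    replace (a + 1%R * (b - a)) with b in E by ring. replace (a + 0%R * (b - a)) with a in E by ring.
    assert (E2 : (Re (Cconj w * f b) - Re (Cconj w * f a) = Cmod w * Cmod w)%R).
    { rewrite Cmod_sqr. replace (Re (Cconj w * f b) - Re (Cconj w * f a))%R with (Re (Cconj w * w)).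
      - destruct w as [x y]. simpl. ring.
      - unfold w at 2. replace (Cconj w * (f b - f a)) with (Cconj w * f b + - (Cconj w * f a)) by ring.
        rewrite re_plus, re_opp. ring. }
    rewrite E2, Rminus_0_r, Rmult_1_r in E.
    assert (H : (Cmod w * Cmod w <= Cmod w * (M * Cmod (b - a)))%R).
    { rewrite E. eapply Rle_trans; [apply Re_le_Cmod|]. rewrite !Cmod_mult, Cmod_conj.
      apply Rmult_le_compat_l; [apply Cmod_ge_0|]. apply Rmult_le_compat_r; [apply Cmod_ge_0|]. apply HM, Ht. }
    destruct (Req_dec (Cmod w) 0) as [E0|N0].
    + rewrite E0. apply Rmult_le_pos; [|apply Cmod_ge_0].
      eapply Rle_trans; [apply Cmod_ge_0|]. apply (HM 0%R). lra.
    + apply Rmult_le_reg_l with (Cmod w); [|exact H]. generalize (Cmod_ge_0 w). lra.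
Qed.

(** * Bisection of squares and complex integrals *)

Lemma nested_intervals (s l : nat -> R) :
  (forall n, (s n <= s (S n))%R) -> (forall n, (s (S n) + l (S n) <= s n + l n)%R) ->
  (forall n, (0 <= l n)%R) -> exists x : R, forall n, (s n <= x <= s n + l n)%R.
Proof.
  intros H1 H2 H0.
  assert (M1 : forall n k, (s n <= s (n + k)%nat)%R).
  { intros n k. induction k as [|k IH]. - rewrite Nat.add_0_r. lra.
    - rewrite Nat.add_succ_r. specialize (H1 (n + k)%nat). lra. }
  assert (M2 : forall n k, (s (n + k)%nat + l (n + k)%nat <= s n + l n)%R).
  { intros n k. induction k as [|k IH]. - rewrite Nat.add_0_r. lra.
    - rewrite Nat.add_succ_r. specialize (H2 (n + k)%nat). lra. }
  assert (M3 : forall n m, (s m <= s n + l n)%R).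
  { intros n m. specialize (M1 m n). specialize (M2 n m). rewrite (Nat.add_comm m n) in M1.
    specialize (H0 (n + m)%nat). lra. }
  destruct (completeness (fun x => exists n, x = s n)) as [x [Hx1 Hx2]].
  - exists (s 0%nat + l 0%nat)%R. intros y [n ->]. apply M3.
  - exists (s 0%nat). exists 0%nat. reflexivity.
  - exists x. intros n. split.
    + apply Hx1. exists n. reflexivity.
    + apply Hx2. intros y [m ->]. apply M3.
Qed.

Section Cousin.
Variable P : R -> R -> R -> Prop.

(** Selects a quadrant on which P fails. The last quadrant is the default and is taken untested:
    when the other three satisfy P, gluing shows that it inherits the failure. *)
Definition cousin_step (p : R * R) (l : R) : R * R :=
  let (s, t) := p in
  let h := (l / 2)%R in
  if excluded_middle_informative (~ P s t h) then (s, t) else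
  if excluded_middle_informative (~ P (s + h) t h) then ((s + h)%R, t) else
  if excluded_middle_informative (~ P s (t + h) h) then (s, (t + h)%R) else
  ((s + h)%R, (t + h)%R).

Fixpoint cousin_seq (n : nat) : R * R :=
  match n with
  | O => (0%R, 0%R)
  | S m => cousin_step (cousin_seq m) ((/ 2) ^ m)
  end.

(** Were P false on the unit square, gluing would make it false on nested squares of side 2^-n, and
    their common point contradicts the local hypothesis. Maxima on squares and Goursat's theorem are
    both obtained from this. *)
Lemma cousin :
  (forall s t l, (0 < l)%R -> P s t (l / 2) -> P (s + l / 2)%R t (l / 2) ->
     P s (t + l / 2)%R (l / 2) -> P (s + l / 2)%R (t + l / 2)%R (l / 2) -> P s t l) ->
  (forall s0 t0, (0 <= s0 <= 1)%R -> (0 <= t0 <= 1)%R -> exists delta, (0 < delta)%R /\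
     forall s t l, (0 < l < delta)%R -> (0 <= s)%R -> (s + l <= 1)%R -> (0 <= t)%R -> (t + l <= 1)%R ->
       (s <= s0 <= s + l)%R -> (t <= t0 <= t + l)%R -> P s t l) ->
  P 0 0 1.
Proof.
  intros Hglue Hloc. apply NNPP. intros HN.
  set (l := fun n : nat => ((/ 2) ^ n)%R).
  assert (Hl : forall n, (0 < l n)%R) by (intros n; apply pow_lt; lra).
  assert (Hl2 : forall n, (l (S n) = l n / 2)%R) by (intros n; unfold l; simpl; field).
  assert (Hc : forall n, let p := cousin_seq n in let q := cousin_seq (S n) in
     (fst q = fst p \/ fst q = fst p + l n / 2)%R /\ (snd q = snd p \/ snd q = snd p + l n / 2)%R /\
     (~ P (fst p) (snd p) (l n) -> ~ P (fst q) (snd q) (l (S n)))).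
  { intros n. cbv zeta. rewrite Hl2. change (cousin_seq (S n)) with (cousin_step (cousin_seq n) (l n)).
    destruct (cousin_seq n) as [s t]. unfold cousin_step.
    destruct (excluded_middle_informative (~ P s t (l n / 2)%R)) as [H1|H1]; [simpl; auto|].
    destruct (excluded_middle_informative (~ P (s + l n / 2)%R t (l n / 2)%R)) as [H2|H2]; [simpl; auto|].
    destruct (excluded_middle_informative (~ P s (t + l n / 2)%R (l n / 2)%R)) as [H3|H3]; [simpl; auto|].
    simpl. split; [auto|]. split; [auto|]. intros H H4. apply H.
    apply NNPP in H1. apply NNPP in H2. apply NNPP in H3. apply Hglue; auto. }
  assert (HNn : forall n, ~ P (fst (cousin_seq n)) (snd (cousin_seq n)) (l n)).
  { induction n as [|n IH]; [exact HN|]. apply (Hc n), IH. }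
  destruct (nested_intervals (fun n => fst (cousin_seq n)) l) as [x Hx].
  { intros n. destruct (Hc n) as [[->| ->] _]; specialize (Hl n); lra. }
  { intros n. rewrite Hl2. destruct (Hc n) as [[->| ->] _]; specialize (Hl n); lra. }
  { intros n. specialize (Hl n). lra. }
  destruct (nested_intervals (fun n => snd (cousin_seq n)) l) as [y Hy].
  { intros n. destruct (Hc n) as [_ [[->| ->] _]]; specialize (Hl n); lra. }
  { intros n. rewrite Hl2. destruct (Hc n) as [_ [[->| ->] _]]; specialize (Hl n); lra. }
  { intros n. specialize (Hl n). lra. }
  assert (Hb : forall n, (0 <= fst (cousin_seq n) /\ fst (cousin_seq n) + l n <= 1 /\
                          0 <= snd (cousin_seq n) /\ snd (cousin_seq n) + l n <= 1)%R).
  { induction n as [|n IH]; [unfold l; simpl; lra|]. rewrite Hl2. specialize (Hl n).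
    destruct (Hc n) as [[->| ->] [[->| ->] _]]; lra. }
  destruct (Hloc x y) as [d [Hd H]].
  { specialize (Hx 0%nat). unfold l in Hx. simpl in Hx. lra. }
  { specialize (Hy 0%nat). unfold l in Hy. simpl in Hy. lra. }
  destruct (pow_lt_1_zero (/ 2) (ltac:(rewrite Rabs_pos_eq; lra)) d Hd) as [N HNd].
  specialize (HNd N (Nat.le_refl N)). rewrite Rabs_pos_eq in HNd by (apply pow_le; lra).
  apply (HNn N). destruct (Hb N) as [B1 [B2 [B3 B4]]].
  apply H; auto.
Qed.
End Cousin.

Lemma square_max (g : R -> R -> R) :
  (forall s0 t0 eps, (0 <= s0 <= 1)%R -> (0 <= t0 <= 1)%R -> (0 < eps)%R -> exists delta, (0 < delta)%R /\
     forall s t, (0 <= s <= 1)%R -> (0 <= t <= 1)%R -> (Rabs (s - s0) < delta)%R -> (Rabs (t - t0) < delta)%R ->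
     (Rabs (g s t - g s0 t0) < eps)%R) ->
  exists s0 t0, (0 <= s0 <= 1)%R /\ (0 <= t0 <= 1)%R /\
    forall s t, (0 <= s <= 1)%R -> (0 <= t <= 1)%R -> (g s t <= g s0 t0)%R.
Proof.
  intros Hg.
  (* Local bounds in the class Q glue to a global one. With Q trivial this gives boundedness; with Q
     the numbers below the supremum M it gives a bound below M, unless M is attained. *)
  assert (Hgen : forall Q : R -> Prop, (forall M M', Q M -> Q M' -> Q (Rmax M M')) ->
    (forall s0 t0, (0 <= s0 <= 1)%R -> (0 <= t0 <= 1)%R -> exists eps, (0 < eps)%R /\ Q (g s0 t0 + eps)%R) ->
    exists M, Q M /\ forall s t, (0 <= s <= 1)%R -> (0 <= t <= 1)%R -> (g s t <= M)%R).
  { intros Q HQ HQl.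
    destruct (cousin (fun s t l => exists M, Q M /\ forall s' t', (0 <= s' <= 1)%R -> (0 <= t' <= 1)%R ->
      (s <= s' <= s + l)%R -> (t <= t' <= t + l)%R -> (g s' t' <= M)%R)) as [M [HM1 HM2]].
    - intros s t l Hl [M1 [Q1 H1]] [M2 [Q2 H2]] [M3 [Q3 H3]] [M4 [Q4 H4]].
      exists (Rmax (Rmax M1 M2) (Rmax M3 M4)). split; [apply HQ; apply HQ; assumption|].
      intros s' t' Hs Ht Hs' Ht'.
      destruct (Rle_dec s' (s + l / 2)) as [L1|L1]; destruct (Rle_dec t' (t + l / 2)) as [L2|L2].
      + apply Rle_trans with M1; [apply H1; lra|]. eapply Rle_trans; [|apply Rmax_l]. apply Rmax_l.
      + apply Rle_trans with M3; [apply H3; lra|]. eapply Rle_trans; [|apply Rmax_r]. apply Rmax_l.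
      + apply Rle_trans with M2; [apply H2; lra|]. eapply Rle_trans; [|apply Rmax_l]. apply Rmax_r.
      + apply Rle_trans with M4; [apply H4; lra|]. eapply Rle_trans; [|apply Rmax_r]. apply Rmax_r.
    - intros s0 t0 Hs0 Ht0. destruct (HQl s0 t0 Hs0 Ht0) as [eps [He Hq]].
      destruct (Hg s0 t0 eps Hs0 Ht0 He) as [d [Hd H]]. exists d. split; [exact Hd|].
      intros s t l Hl H1 H2 H3 H4 H5 H6. exists (g s0 t0 + eps)%R. split; [exact Hq|].
      intros s' t' Hs Ht Hs' Ht'.
      assert (H' : (Rabs (g s' t' - g s0 t0) < eps)%R). { apply H; auto; apply Rabs_lt_between; lra. }
      apply Rabs_lt_between in H'. lra.
    - exists M. split; [exact HM1|]. intros s t Hs Ht. apply HM2; lra. }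
  destruct (Hgen (fun _ => True)) as [B [_ HB]]; auto.
  { intros. exists 1%R. split; [lra|auto]. }
  destruct (completeness (fun y => exists s t, (0 <= s <= 1)%R /\ (0 <= t <= 1)%R /\ y = g s t)) as [M [HM1 HM2]].
  { exists B. intros y [s [t [Hs [Ht ->]]]]. apply HB; auto. }
  { exists (g 0%R 0%R). exists 0%R, 0%R. repeat split; lra. }
  apply NNPP. intros HN.
  destruct (Hgen (fun y => (y < M)%R)) as [M' [HM' HM'']].
  { intros; apply Rmax_case; assumption. }
  { intros s0 t0 Hs0 Ht0.
    assert (H : (g s0 t0 < M)%R).
    { destruct (Rle_lt_or_eq_dec (g s0 t0) M) as [H|H]; [|exact H|].
      - apply HM1. exists s0, t0. auto.
      - exfalso. apply HN. exists s0, t0. repeat split; try lra. intros s t Hs Ht. rewrite H. apply HM1. exists s, t. auto. }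
    exists ((M - g s0 t0) / 2)%R. split; lra. }
  apply (Rlt_not_le _ _ HM'). apply HM2. intros y [s [t [Hs [Ht ->]]]]. apply HM''; auto.
Qed.

(** * Integrals of complex-valued functions over an interval *)

Definition Cint (f : R -> C) (a b : R) : C := RInt (V := C_R_CompleteNormedModule) f a b.
Definition rcont (f : R -> C) (t : R) : Prop := continuous (U := C_R_CompleteNormedModule) f t.
(** Endpoints in either order, so that rectangles need no ordering of their corners. *)
Definition between (a b t : R) : Prop := (Rmin a b <= t <= Rmax a b)%R.

Lemma rcont_ex (f : R -> C) (a b : R) : (forall t, between a b t -> rcont f t) ->
  ex_RInt (V := C_R_CompleteNormedModule) f a b.
Proof. intros H. apply (ex_RInt_continuous (V := C_R_CompleteNormedModule)). exact H. Qed.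

Lemma rcont_intro (f : R -> C) (t : R) :
  (forall eps, (0 < eps)%R -> exists delta, (0 < delta)%R /\ forall s, (Rabs (s - t) < delta)%R -> (Cmod (f s - f t) < eps)%R) ->
  rcont f t.
Proof.
  intros H. apply filterlim_locally. intros eps.
  destruct (H eps (cond_pos eps)) as [d [Hd Hs]]. exists (mkposreal d Hd). intros s Hb.
  apply (C_NormedModule_mixin_compat1 (f t) (f s)). apply Hs. exact Hb.
Qed.

Lemma CI_Chasles (f : R -> C) (a b c : R) :
  (forall t, between a b t -> rcont f t) -> (forall t, between b c t -> rcont f t) ->
  Cint f a c = Cint f a b + Cint f b c.
Proof.
  intros H1 H2. symmetry. apply (RInt_Chasles (V := C_R_CompleteNormedModule) f a b c); apply rcont_ex; assumption.
Qed.

Lemma CI_minus (f g : R -> C) (a b : R) :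
  (forall t, between a b t -> rcont f t) -> (forall t, between a b t -> rcont g t) ->
  Cint (fun t => f t - g t) a b = Cint f a b - Cint g a b.
Proof.
  intros H1 H2. apply (RInt_minus (V := C_R_CompleteNormedModule) f g a b); apply rcont_ex; assumption.
Qed.

Lemma CI_bound (f : R -> C) (a b M : R) :
  (forall t, between a b t -> rcont f t) -> (forall t, between a b t -> (Cmod (f t) <= M)%R) ->
  (Cmod (Cint f a b) <= Rabs (b - a) * M)%R.
Proof.
  intros H1 H2. assert (He := rcont_ex _ _ _ H1).
  destruct (Rle_dec a b) as [L|L].
  - rewrite Rabs_pos_eq by lra.
    rewrite Cmod_norm.
    apply (norm_RInt_le_const (V := C_R_NormedModule) f a b (Cint f a b) M L).
    + intros x Hx. eapply Rle_trans; [apply Req_le; symmetry; apply (Cmod_norm (f x))|]. apply H2. unfold between. rewrite Rmin_left, Rmax_right; lra.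
    + apply (RInt_correct (V := C_R_CompleteNormedModule)). exact He.
  - rewrite Rabs_left by lra. replace (- (b - a))%R with (a - b)%R by ring.
    rewrite <- Cmod_opp, Cmod_norm.
    apply (norm_RInt_le_const (V := C_R_NormedModule) f b a (- Cint f a b) M); [lra| |].
    + intros x Hx. eapply Rle_trans; [apply Req_le; symmetry; apply (Cmod_norm (f x))|]. apply H2. unfold between. rewrite Rmin_right, Rmax_left; lra.
    + apply (is_RInt_swap (V := C_R_NormedModule)). apply (RInt_correct (V := C_R_CompleteNormedModule)). exact He.
Qed.

Lemma CI_primitive (F f : R -> C) (a b : R) :
  (forall t, between a b t -> is_derive (V := C_R_NormedModule) F t (f t)) ->
  (forall t, between a b t -> rcont f t) -> Cint f a b = F b - F a.
Proof.
  intros H1 H2. apply (is_RInt_unique (V := C_R_CompleteNormedModule)).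
  apply (is_RInt_derive (V := C_R_CompleteNormedModule) F f a b); [exact H1|exact H2].
Qed.

Lemma CI_const (c : C) (a b : R) : Cint (fun _ => c) a b = (b - a)%R * c.
Proof.
  unfold Cint. rewrite RInt_const. apply scal_R_Cmult.
Qed.

(** * Goursat's theorem *)

Lemma is_derive_line (F : C -> C) (p v l : C) (t : R) :
  cderiv F (p + t * v) l ->
  is_derive (V := C_R_NormedModule) (fun s : R => F (p + s * v)) t (l * v).
Proof.
  intros H. split.
  - apply (is_linear_scal_l (K := R_AbsRing) (V := C_R_NormedModule) (l * v)).
  - intros x Hx. apply (is_filter_lim_locally_unique (K := R_AbsRing) (V := R_NormedModule)) in Hx.
    rewrite <- Hx. intros eps.
    destruct (H (eps / (Cmod v + 1))%R) as [d [Hd Hw]].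
    { apply Rdiv_lt_0_compat; [apply cond_pos|]. generalize (Cmod_ge_0 v); lra. }
    assert (Hv : (0 < Cmod v + 1)%R). { generalize (Cmod_ge_0 v). lra. }
    assert (Hdv : (0 < d / (Cmod v + 1))%R) by (apply Rdiv_lt_0_compat; lra).
    exists (mkposreal _ Hdv). intros s Hb.
    change (Rabs (s - t) < d / (Cmod v + 1))%R in Hb.
    rewrite <- Cmod_norm.
    change (Cmod (F (p + s * v)%C - F (p + t * v)%C - scal (V := C_R_ModuleSpace) (s - t)%R (l * v)%C) <= eps * Rabs (s - t))%R.
    rewrite scal_R_Cmult.
    specialize (Hw (p + s * v)).
    replace (p + s * v - (p + t * v)) with ((s - t)%R * v) in Hw by (rewrite RtoC_minus; ring).
    rewrite Cmod_mult, Cmod_R in Hw.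
    apply Rlt_div_r in Hb; [|exact Hv].
    assert (H0 := Rabs_pos (s - t)). assert (H1 := Cmod_ge_0 v).
    replace ((s - t)%R * (l * v)) with (l * ((s - t)%R * v)) by ring.
    eapply Rle_trans; [apply Hw; nra|].
    replace (eps / (Cmod v + 1) * (Rabs (s - t) * Cmod v))%R with (eps * Rabs (s - t) * (Cmod v / (Cmod v + 1)))%R by (field; lra).
    assert (Cmod v / (Cmod v + 1) <= 1)%R by (apply Rle_div_l; lra).
    assert (0 <= eps * Rabs (s - t))%R by (apply Rmult_le_pos; [left; apply cond_pos|lra]). nra.
Qed.

Lemma rcont_line (f : C -> C) (p v : C) (t : R) :
  ccont f (p + t * v) -> rcont (fun s : R => f (p + s * v)) t.
Proof.
  intros H. apply rcont_intro. intros eps He. destruct (H eps He) as [d [Hd Hw]].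
  assert (Hv : (0 < Cmod v + 1)%R). { generalize (Cmod_ge_0 v). lra. }
  exists (d / (Cmod v + 1))%R. split; [apply Rdiv_lt_0_compat; lra|]. intros s Hs.
  apply Hw. replace (p + s * v - (p + t * v)) with ((s - t)%R * v) by (rewrite RtoC_minus; ring).
  rewrite Cmod_mult, Cmod_R. apply Rlt_div_r in Hs; [|exact Hv].
  assert (H0 := Rabs_pos (s - t)). nra.
Qed.

Lemma hline (y t : R) : (t, y) = (0%R, y) + t * 1 :> C.
Proof. unfold RtoC, Cplus, Cmult; simpl; f_equal; ring. Qed.
Lemma vline (x t : R) : (x, t) = (x, 0%R) + t * Ci :> C.
Proof. unfold Ci, RtoC, Cplus, Cmult; simpl; f_equal; ring. Qed.

Lemma rcont_h (f : C -> C) (y t : R) : ccont f (t, y) -> rcont (fun s : R => f (s, y)) t.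
Proof.
  intros H. apply (continuous_ext (fun s : R => f ((0%R, y) + s * 1))).
  { intros s. rewrite <- hline. reflexivity. }
  apply (rcont_line f (0%R, y) 1 t). rewrite <- hline. exact H.
Qed.
Lemma rcont_v (f : C -> C) (x t : R) : ccont f (x, t) -> rcont (fun s : R => f (x, s)) t.
Proof.
  intros H. apply (continuous_ext (fun s : R => f ((x, 0%R) + s * Ci))).
  { intros s. rewrite <- vline. reflexivity. }
  apply (rcont_line f (x, 0%R) Ci t). rewrite <- vline. exact H.
Qed.

(** The boundary integral, counterclockwise when X1 <= X2 and Y1 <= Y2; the factor [Ci] is dz = i dt
    on the vertical sides. *)
Definition rect_integral (f : C -> C) (X1 X2 Y1 Y2 : R) : C :=
  Cint (fun t => f (t, Y1)) X1 X2 + Ci * Cint (fun t => f (X2, t)) Y1 Y2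
  - Cint (fun t => f (t, Y2)) X1 X2 - Ci * Cint (fun t => f (X1, t)) Y1 Y2.

Definition in_rect (X1 X2 Y1 Y2 : R) (z : C) : Prop := between X1 X2 (Re z) /\ between Y1 Y2 (Im z).

Lemma between_sub (a b c d t : R) : between a b c -> between a b d -> between c d t -> between a b t.
Proof.
  unfold between, Rmin, Rmax. repeat destruct Rle_dec; lra.
Qed.
Lemma between_l (a b : R) : between a b a.
Proof. unfold between, Rmin, Rmax. repeat destruct Rle_dec; lra. Qed.
Lemma between_r (a b : R) : between a b b.
Proof. unfold between, Rmin, Rmax. repeat destruct Rle_dec; lra. Qed.
Lemma between_affine (a b s : R) : (0 <= s <= 1)%R -> between a b (a + s * (b - a)).
Proof. intros H. unfold between, Rmin, Rmax. repeat destruct Rle_dec; nra. Qed.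
Lemma between_affine2 (a b s s' r : R) : (s <= r <= s')%R ->
  between (a + s * (b - a)) (a + s' * (b - a)) (a + r * (b - a)).
Proof.
  intros [H1 H2]. assert (H0 : (s * (b - a) <= r * (b - a) <= s' * (b - a) \/ s' * (b - a) <= r * (b - a) <= s * (b - a))%R).
  { destruct (Rle_dec a b) as [L|L]; [left|right]; split; nra. }
  unfold between, Rmin, Rmax. repeat destruct Rle_dec; lra.
Qed.
Lemma between_dist (a b t u : R) : between a b t -> between a b u -> (Rabs (t - u) <= Rabs (b - a))%R.
Proof.
  unfold between, Rmin, Rmax. repeat destruct Rle_dec; intros;
  unfold Rabs; repeat destruct Rcase_abs; lra.
Qed.

Lemma bd_split_x (f : C -> C) (X1 X2 Xm Y1 Y2 : R) : between X1 X2 Xm ->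
  (forall z, in_rect X1 X2 Y1 Y2 z -> ccont f z) ->
  rect_integral f X1 X2 Y1 Y2 = rect_integral f X1 Xm Y1 Y2 + rect_integral f Xm X2 Y1 Y2.
Proof.
  intros Hm H. unfold rect_integral.
  rewrite (CI_Chasles (fun t => f (t, Y1)) X1 Xm X2), (CI_Chasles (fun t => f (t, Y2)) X1 Xm X2).
  - ring.
  - intros t Ht. apply rcont_h, H. split; simpl; [|apply between_r]. apply (between_sub X1 X2 X1 Xm); auto using between_l.
  - intros t Ht. apply rcont_h, H. split; simpl; [|apply between_r]. apply (between_sub X1 X2 Xm X2); auto using between_r.
  - intros t Ht. apply rcont_h, H. split; simpl; [|apply between_l]. apply (between_sub X1 X2 X1 Xm); auto using between_l.
  - intros t Ht. apply rcont_h, H. split; simpl; [|apply between_l]. apply (between_sub X1 X2 Xm X2); auto using between_r.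
Qed.

Lemma bd_split_y (f : C -> C) (X1 X2 Y1 Y2 Ym : R) : between Y1 Y2 Ym ->
  (forall z, in_rect X1 X2 Y1 Y2 z -> ccont f z) ->
  rect_integral f X1 X2 Y1 Y2 = rect_integral f X1 X2 Y1 Ym + rect_integral f X1 X2 Ym Y2.
Proof.
  intros Hm H. unfold rect_integral.
  rewrite (CI_Chasles (fun t => f (X1, t)) Y1 Ym Y2), (CI_Chasles (fun t => f (X2, t)) Y1 Ym Y2).
  - ring.
  - intros t Ht. apply rcont_v, H. split; simpl; [apply between_r|]. apply (between_sub Y1 Y2 Y1 Ym); auto using between_l.
  - intros t Ht. apply rcont_v, H. split; simpl; [apply between_r|]. apply (between_sub Y1 Y2 Ym Y2); auto using between_r.
  - intros t Ht. apply rcont_v, H. split; simpl; [apply between_l|]. apply (between_sub Y1 Y2 Y1 Ym); auto using between_l.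
  - intros t Ht. apply rcont_v, H. split; simpl; [apply between_l|]. apply (between_sub Y1 Y2 Ym Y2); auto using between_r.
Qed.

Lemma CI_h_primitive (F f : C -> C) (a b y : R) :
  (forall t, between a b t -> cderiv F (t, y) (f (t, y))) ->
  (forall t, between a b t -> ccont f (t, y)) ->
  Cint (fun t => f (t, y)) a b = F (b, y) - F (a, y).
Proof.
  intros H1 H2. apply (CI_primitive (fun t => F (t, y)) (fun t => f (t, y))).
  - intros t Ht. apply (is_derive_ext (V := C_R_NormedModule) (fun s : R => F ((0%R, y) + s * 1))).
    { intros s. rewrite <- hline. reflexivity. }
    rewrite <- (Cmult_1_r (f (t, y))). apply (is_derive_line F (0%R, y) 1). rewrite <- hline. apply H1, Ht.
  - intros t Ht. apply rcont_h, H2, Ht.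
Qed.

Lemma CI_v_primitive (F f : C -> C) (a b x : R) :
  (forall t, between a b t -> cderiv F (x, t) (f (x, t))) ->
  (forall t, between a b t -> ccont f (x, t)) ->
  Ci * Cint (fun t => f (x, t)) a b = F (x, b) - F (x, a).
Proof.
  intros H1 H2. rewrite (CI_primitive (fun t => (- Ci) * F (x, t)) (fun t => f (x, t))).
  - replace (Ci * (- Ci * F (x, b) - - Ci * F (x, a))) with ((- (Ci * Ci)) * (F (x, b) - F (x, a))) by ring.
    replace (- (Ci * Ci)) with (RtoC 1) by (unfold Ci, RtoC, Cmult, Copp; simpl; f_equal; ring). ring.
  - intros t Ht. apply (is_derive_ext (V := C_R_NormedModule) (fun s : R => (fun z => - Ci * F z) ((x, 0%R) + s * Ci))).
    { intros s. rewrite <- vline. reflexivity. }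
    replace (f (x, t)) with (- Ci * f (x, t) * Ci).
    2: { replace (- Ci * f (x, t) * Ci) with (- (Ci * Ci) * f (x, t)) by ring.
         replace (- (Ci * Ci)) with (RtoC 1) by (unfold Ci, RtoC, Cmult, Copp; simpl; f_equal; ring). ring. }
    apply (is_derive_line (fun z => - Ci * F z) (x, 0%R) Ci). rewrite <- vline. apply cderiv_scal, H1, Ht.
  - intros t Ht. apply rcont_v, H2, Ht.
Qed.

Lemma bd_primitive (F f : C -> C) (X1 X2 Y1 Y2 : R) :
  (forall z, in_rect X1 X2 Y1 Y2 z -> cderiv F z (f z)) ->
  (forall z, in_rect X1 X2 Y1 Y2 z -> ccont f z) -> rect_integral f X1 X2 Y1 Y2 = 0.
Proof.
  intros H1 H2. unfold rect_integral.
  rewrite (CI_h_primitive F f), (CI_h_primitive F f), (CI_v_primitive F f), (CI_v_primitive F f); [ring|..];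
  intros t Ht; (apply H1 || apply H2); split; simpl; auto using between_l, between_r.
Qed.

Lemma bd_minus (f g : C -> C) (X1 X2 Y1 Y2 : R) :
  (forall z, in_rect X1 X2 Y1 Y2 z -> ccont f z) ->
  (forall z, in_rect X1 X2 Y1 Y2 z -> ccont g z) ->
  rect_integral (fun z => f z - g z) X1 X2 Y1 Y2 = rect_integral f X1 X2 Y1 Y2 - rect_integral g X1 X2 Y1 Y2.
Proof.
  intros H1 H2. unfold rect_integral.
  rewrite (CI_minus (fun t => f (t, Y1)) (fun t => g (t, Y1))), (CI_minus (fun t => f (t, Y2)) (fun t => g (t, Y2))),
   (CI_minus (fun t => f (X1, t)) (fun t => g (X1, t))), (CI_minus (fun t => f (X2, t)) (fun t => g (X2, t))); [ring|..];
  intros t Ht; (apply rcont_h || apply rcont_v); (apply H1 || apply H2); split; simpl; auto using between_l, between_r.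
Qed.

Lemma bd_bound (f : C -> C) (X1 X2 Y1 Y2 M : R) :
  (forall z, in_rect X1 X2 Y1 Y2 z -> ccont f z) ->
  (forall z, in_rect X1 X2 Y1 Y2 z -> (Cmod (f z) <= M)%R) ->
  (Cmod (rect_integral f X1 X2 Y1 Y2) <= 2 * (Rabs (X2 - X1) + Rabs (Y2 - Y1)) * M)%R.
Proof.
  intros H1 H2. unfold rect_integral.
  assert (A1 : (Cmod (Cint (fun t => f (t, Y1)) X1 X2) <= Rabs (X2 - X1) * M)%R).
  { apply CI_bound; intros t Ht; [apply rcont_h, H1|apply H2]; split; simpl; auto using between_l, between_r. }
  assert (A2 : (Cmod (Cint (fun t => f (t, Y2)) X1 X2) <= Rabs (X2 - X1) * M)%R).
  { apply CI_bound; intros t Ht; [apply rcont_h, H1|apply H2]; split; simpl; auto using between_l, between_r. }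
  assert (A3 : (Cmod (Cint (fun t => f (X1, t)) Y1 Y2) <= Rabs (Y2 - Y1) * M)%R).
  { apply CI_bound; intros t Ht; [apply rcont_v, H1|apply H2]; split; simpl; auto using between_l, between_r. }
  assert (A4 : (Cmod (Cint (fun t => f (X2, t)) Y1 Y2) <= Rabs (Y2 - Y1) * M)%R).
  { apply CI_bound; intros t Ht; [apply rcont_v, H1|apply H2]; split; simpl; auto using between_l, between_r. }
  unfold Cminus.
  eapply Rle_trans; [apply Cmod_triangle|]. rewrite Cmod_opp, Cmod_mult, Cmod_Ci, Rmult_1_l.
  eapply Rle_trans; [apply Rplus_le_compat_r; apply Cmod_triangle|]. rewrite Cmod_opp.
  eapply Rle_trans; [apply Rplus_le_compat_r; apply Rplus_le_compat_r; apply Cmod_triangle|].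
  rewrite Cmod_mult, Cmod_Ci, Rmult_1_l. lra.
Qed.

(** Bisection is applied to the bound |integral| <= e l^2 on subrectangles of relative side l. The
    bound glues, since 4 (l/2)^2 = l^2, and holds locally because the affine approximation of f has
    a primitive. With e half the modulus of the whole integral it is absurd. *)
Lemma goursat (f : C -> C) (X1 X2 Y1 Y2 : R) :
  (forall z, in_rect X1 X2 Y1 Y2 z -> exists l, cderiv f z l) -> rect_integral f X1 X2 Y1 Y2 = 0.
Proof.
  intros H.
  assert (Hc : forall z, in_rect X1 X2 Y1 Y2 z -> ccont f z).
  { intros z Hz. destruct (H z Hz) as [l Hl]. apply (cderiv_ccont _ _ _ Hl). }
  set (X := fun s => (X1 + s * (X2 - X1))%R). set (Y := fun s => (Y1 + s * (Y2 - Y1))%R).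
  set (q := (Rabs (X2 - X1) + Rabs (Y2 - Y1))%R).
  assert (Hq : (0 <= q)%R) by (unfold q; generalize (Rabs_pos (X2 - X1)) (Rabs_pos (Y2 - Y1)); lra).
  apply Cmod_eq_0. apply Rle_antisym; [|apply Cmod_ge_0]. apply Rnot_lt_le. intros Hpos.
  set (e := (Cmod (rect_integral f X1 X2 Y1 Y2) / 2)%R).
  assert (He : (0 < e)%R) by (unfold e; lra).
  assert (Hsub : forall s s' t t' z, (0 <= s <= s')%R -> (s' <= 1)%R -> (0 <= t <= t')%R -> (t' <= 1)%R ->
    in_rect (X s) (X s') (Y t) (Y t') z -> in_rect X1 X2 Y1 Y2 z).
  { intros s s' t t' z Hs Hs' Ht Ht' [A1 A2].
    split; [apply (between_sub _ _ (X s) (X s'))|apply (between_sub _ _ (Y t) (Y t'))]; auto; apply between_affine; lra. }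
  (* The trivial premises are those of the predicate below at s = t = 0 and l = 1; they keep all
     subrectangles inside the given one. *)
  assert (HP : (0 <= 0)%R -> (0 + 1 <= 1)%R -> (0 <= 0)%R -> (0 + 1 <= 1)%R -> (Cmod (rect_integral f (X 0) (X (0 + 1)) (Y 0) (Y (0 + 1))) <= e * (1 * 1))%R).
  { apply (cousin (fun s t l => (0 <= s)%R -> (s + l <= 1)%R -> (0 <= t)%R -> (t + l <= 1)%R ->
                   (Cmod (rect_integral f (X s) (X (s + l)) (Y t) (Y (t + l))) <= e * (l * l))%R)).
    - intros s t l Hl P1 P2 P3 P4 B1 B2 B3 B4.
      rewrite (bd_split_x f _ _ (X (s + l / 2)%R)), (bd_split_y f (X s) _ _ _ (Y (t + l / 2)%R)), (bd_split_y f _ (X (s + l)%R) _ _ (Y (t + l / 2)%R)).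
      + replace (s + l)%R with (s + l / 2 + l / 2)%R in * by field. replace (t + l)%R with (t + l / 2 + l / 2)%R in * by field.
        specialize (P1 ltac:(lra) ltac:(lra) ltac:(lra) ltac:(lra)). specialize (P2 ltac:(lra) ltac:(lra) ltac:(lra) ltac:(lra)).
        specialize (P3 ltac:(lra) ltac:(lra) ltac:(lra) ltac:(lra)). specialize (P4 ltac:(lra) ltac:(lra) ltac:(lra) ltac:(lra)).
        eapply Rle_trans; [apply Cmod_triangle|]. eapply Rle_trans; [apply Rplus_le_compat; apply Cmod_triangle|].
        lra.
      + apply between_affine2; lra.
      + intros z Hz. apply Hc. revert Hz. apply Hsub; lra.
      + apply between_affine2; lra.
      + intros z Hz. apply Hc. revert Hz. apply Hsub; lra.
      + apply between_affine2; lra.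
      + intros z Hz. apply Hc. revert Hz. apply Hsub; lra.
    - intros s0 t0 Hs0 Ht0.
      set (z0 := (X s0, Y t0) : C).
      destruct (H z0) as [a Ha]. { split; simpl; apply between_affine; lra. }
      (* The boundary of the subrectangle has length 2 l q and the error on it is at most this
         constant times l q, so the product is below e l^2; q + 1 instead of q covers a degenerate
         rectangle. *)
      destruct (Ha (e / (2 * (q + 1) * (q + 1)))%R) as [d [Hd Hw]].
      { apply Rdiv_lt_0_compat; [lra|]. repeat apply Rmult_lt_0_compat; lra. }
      exists (d / (q + 1))%R. split; [apply Rdiv_lt_0_compat; lra|].
      intros s t l Hl B1 B2 B3 B4 B5 B6 _ _ _ _.
      set (g := fun z : C => f z0 + a * (z - z0)).
      assert (Hgc : forall z, ccont g z).
      { intros z. apply (cderiv_ccont g z (0 + a * (1 - 0))). unfold g. apply cderiv_plus; [apply cderiv_const|].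
        apply cderiv_scal. apply cderiv_minus; [apply cderiv_id|apply cderiv_const]. }
      assert (Hbg : rect_integral g (X s) (X (s + l)%R) (Y t) (Y (t + l)%R) = 0).
      { apply (bd_primitive (fun z => f z0 * z + a * (((z - z0) * (z - z0)) / 2))).
        - intros z _. unfold g. eapply cderiv_eq.
          + apply cderiv_plus; [apply cderiv_scal, cderiv_id|]. apply cderiv_scal.
            apply (cderiv_mult (fun z => (z - z0) * (z - z0)) (fun _ => / 2)); [|apply cderiv_const].
            apply (cderiv_mult (fun z => z - z0) (fun z => z - z0));
            apply cderiv_minus; [apply cderiv_id|apply cderiv_const|apply cderiv_id|apply cderiv_const].
          + cbv beta. field.
        - intros z _. apply Hgc. }
      replace (rect_integral f (X s) (X (s + l)%R) (Y t) (Y (t + l)%R)) with (rect_integral (fun z => f z - g z) (X s) (X (s + l)%R) (Y t) (Y (t + l)%R)).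
      2: { rewrite bd_minus, Hbg; [ring| |auto]. intros z Hz. apply Hc. revert Hz. apply Hsub; lra. }
      assert (Ex : (Rabs (X (s + l) - X s) = l * Rabs (X2 - X1))%R).
      { unfold X. replace (X1 + (s + l) * (X2 - X1) - (X1 + s * (X2 - X1)))%R with (l * (X2 - X1))%R by ring.
        rewrite Rabs_mult, (Rabs_pos_eq l) by lra. reflexivity. }
      assert (Ey : (Rabs (Y (t + l) - Y t) = l * Rabs (Y2 - Y1))%R).
      { unfold Y. replace (Y1 + (t + l) * (Y2 - Y1) - (Y1 + t * (Y2 - Y1)))%R with (l * (Y2 - Y1))%R by ring.
        rewrite Rabs_mult, (Rabs_pos_eq l) by lra. reflexivity. }
      eapply Rle_trans; [apply (bd_bound _ _ _ _ _ (e / (2 * (q + 1) * (q + 1)) * (l * q)))|].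
      + intros z Hz. assert (Hfz : ccont f z) by (apply Hc; revert Hz; apply Hsub; lra).
        specialize (Hgc z). intros eps Heps.
        destruct (Hfz (eps / 2)%R) as [d1 [Hd1 W1]]; [lra|]. destruct (Hgc (eps / 2)%R) as [d2 [Hd2 W2]]; [lra|].
        exists (Rmin d1 d2). split; [apply Rmin_glb_lt; assumption|]. intros w Hw'.
        replace (f w - g w - (f z - g z)) with ((f w - f z) + - (g w - g z)) by ring.
        eapply Rle_lt_trans; [apply Cmod_triangle|]. rewrite Cmod_opp.
        specialize (W1 w (Rlt_le_trans _ _ _ Hw' (Rmin_l _ _))). specialize (W2 w (Rlt_le_trans _ _ _ Hw' (Rmin_r _ _))). lra.
      + intros z [Hz1 Hz2].
        assert (Hzz : (Cmod (z - z0) <= l * q)%R).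
        { eapply Rle_trans; [apply Cmod_le_ReIm|].
          replace (l * q)%R with (l * Rabs (X2 - X1) + l * Rabs (Y2 - Y1))%R by (unfold q; ring).
          rewrite <- Ex, <- Ey. apply Rplus_le_compat.
          - replace (Re (z - z0)) with (Re z - X s0)%R by (unfold z0; destruct z; reflexivity).
            apply between_dist; [exact Hz1|]. apply between_affine2. lra.
          - replace (Im (z - z0)) with (Im z - Y t0)%R by (unfold z0; destruct z; reflexivity).
            apply between_dist; [exact Hz2|]. apply between_affine2. lra. }
        unfold g. replace (f z - (f z0 + a * (z - z0))) with (f z - f z0 - a * (z - z0)) by ring.
        eapply Rle_trans; [apply Hw|].
        * eapply Rle_lt_trans; [exact Hzz|]. destruct Hl as [Hl1 Hl2]. apply Rlt_div_r in Hl2; [|lra]. nra.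
        * apply Rmult_le_compat_l; [|exact Hzz]. apply Rlt_le, Rdiv_lt_0_compat; [lra|]. repeat apply Rmult_lt_0_compat; lra.
      + rewrite Ex, Ey. replace (2 * (l * Rabs (X2 - X1) + l * Rabs (Y2 - Y1)))%R with (2 * (l * q))%R by (unfold q; ring).
        replace (2 * (l * q) * (e / (2 * (q + 1) * (q + 1)) * (l * q)))%R with (e * (l * l) * ((q * q) / ((q + 1) * (q + 1))))%R by (field; lra).
        assert ((q * q) / ((q + 1) * (q + 1)) <= 1)%R. { apply Rle_div_l; nra. }
        assert (0 <= e * (l * l))%R by (apply Rmult_le_pos; [lra|nra]). nra. }
  specialize (HP ltac:(lra) ltac:(lra) ltac:(lra) ltac:(lra)).
  replace (X 0%R) with X1 in HP by (unfold X; ring). replace (X (0 + 1)%R) with X2 in HP by (unfold X; ring).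
  replace (Y 0%R) with Y1 in HP by (unfold Y; ring). replace (Y (0 + 1)%R) with Y2 in HP by (unfold Y; ring).
  unfold e in HP. lra.
Qed.

(** * Primitives and the maximum principle *)

Definition copen (D : C -> Prop) : Prop :=
  forall z, D z -> exists delta, (0 < delta)%R /\ forall w, (Cmod (w - z) < delta)%R -> D w.
Definition holo (D : C -> Prop) (f : C -> C) : Prop := forall z, D z -> exists l, cderiv f z l.
(** What is needed to integrate along a horizontal and then a vertical segment; half-planes and open
    squares have the property. *)
Definition rect_closed (D : C -> Prop) : Prop :=
  forall z w x, D z -> D w -> in_rect (Re z) (Re w) (Im z) (Im w) x -> D x.
Definition zero_near (f : C -> C) (c : C) : Prop :=
  exists delta, (0 < delta)%R /\ forall w, (Cmod (w - c) < delta)%R -> f w = 0.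

Lemma Re_minus (a b : C) : Re (a - b) = (Re a - Re b)%R.
Proof. destruct a, b. reflexivity. Qed.
Lemma Im_minus (a b : C) : Im (a - b) = (Im a - Im b)%R.
Proof. destruct a, b. reflexivity. Qed.

(** F integrates along a horizontal and then a vertical segment from c. Goursat's theorem on one
    auxiliary rectangle turns F w - F z into integrals along the short path from z to w, and
    continuity of f at z concludes. *)
Lemma holo_primitive (D : C -> Prop) (f : C -> C) (c : C) :
  copen D -> rect_closed D -> holo D f -> D c ->
  exists F : C -> C, forall z, D z -> cderiv F z (f z).
Proof.
  intros HO HR Hf Hc.
  assert (Hcont : forall z, D z -> ccont f z).
  { intros z Hz. destruct (Hf z Hz) as [l Hl]. apply (cderiv_ccont _ _ _ Hl). }
  set (F := fun z : C => Cint (fun t => f (t, Im c)) (Re c) (Re z) + Ci * Cint (fun t => f (Re z, t)) (Im c) (Im z)).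
  exists F. intros z Hz eps He.
  destruct (Hcont z Hz (eps / 2)%R) as [d1 [Hd1 W1]]; [lra|].
  destruct (HO z Hz) as [d2 [Hd2 W2]].
  (* Points of the two-segment path from z to w are within 2 |w - z| of z, hence the half. *)
  exists (Rmin d1 d2 / 2)%R. split. { assert (0 < Rmin d1 d2)%R by (apply Rmin_glb_lt; assumption). lra. }
  intros w Hw.
  assert (Hm : (Cmod (w - z) < d1 / 2 /\ Cmod (w - z) < d2 / 2)%R).
  { generalize (Rmin_l d1 d2) (Rmin_r d1 d2). lra. }
  assert (Hrx : (Rabs (Re w - Re z) <= Cmod (w - z))%R) by (rewrite <- Re_minus; apply re_le_Cmod).
  assert (Hry : (Rabs (Im w - Im z) <= Cmod (w - z))%R) by (rewrite <- Im_minus; apply Im_le_Cmod).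
  assert (Dw : D w). { apply W2. generalize (Cmod_ge_0 (w - z)); lra. }
  assert (near1 : forall t, between (Re z) (Re w) t -> (Cmod ((t, Im z) - z) < d1 /\ Cmod ((t, Im z) - z) < d2)%R).
  { intros t Ht. assert (B : (Cmod ((t, Im z) - z) <= Cmod (w - z))%R).
    { eapply Rle_trans; [apply Cmod_le_ReIm|]. rewrite Re_minus, Im_minus. simpl.
      replace (Im z - Im z)%R with 0%R by ring. rewrite Rabs_R0, Rplus_0_r.
      eapply Rle_trans; [apply (between_dist (Re z) (Re w)); [exact Ht|apply between_l]|exact Hrx]. }
    generalize (Cmod_ge_0 (w - z)); lra. }
  assert (near2 : forall t, between (Im z) (Im w) t -> (Cmod ((Re w, t) - z) < d1 /\ Cmod ((Re w, t) - z) < d2)%R).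
  { intros t Ht. assert (B : (Cmod ((Re w, t) - z) <= Cmod (w - z) + Cmod (w - z))%R).
    { eapply Rle_trans; [apply Cmod_le_ReIm|]. rewrite Re_minus, Im_minus. simpl.
      apply Rplus_le_compat; [exact Hrx|].
      eapply Rle_trans; [apply (between_dist (Im z) (Im w)); [exact Ht|apply between_l]|exact Hry]. }
    lra. }
  assert (Dxy : D (Re w, Im z)). { apply W2. apply near1, between_r. }
  assert (Dcx : forall t, between (Re c) (Re z) t -> D (t, Im c)).
  { intros t Ht. apply (HR c z); auto. split; [exact Ht|apply between_l]. }
  assert (Dcw : forall t, between (Re c) (Re w) t -> D (t, Im c)).
  { intros t Ht. apply (HR c w); auto. split; [exact Ht|apply between_l]. }
  assert (Dzw : forall t, between (Re z) (Re w) t -> D (t, Im c)).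
  { intros t Ht. apply (HR (Re z, Im c) (Re w, Im c)).
    - apply Dcx, between_r. - apply Dcw, between_r. - split; [exact Ht|apply between_l]. }
  assert (Dyw : forall t, between (Im c) (Im z) t -> D (Re w, t)).
  { intros t Ht. apply (HR (Re w, Im c) (Re w, Im z)); [apply Dcw, between_r|exact Dxy|]. split; [apply between_l|exact Ht]. }
  (* The rectangle between the verticals over Re z and Re w, from height Im c to height Im z: it
     moves the vertical part of the path from one to the other. *)
  assert (Hbd : rect_integral f (Re z) (Re w) (Im c) (Im z) = 0).
  { apply goursat. intros x Hx. apply Hf. apply (HR (Re z, Im c) (Re w, Im z)); [apply Dcx, between_r|exact Dxy|exact Hx]. }
  assert (E1 : F w - F z = Cint (fun t => f (t, Im z)) (Re z) (Re w) + Ci * Cint (fun t => f (Re w, t)) (Im z) (Im w)).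
  { unfold F. unfold rect_integral in Hbd.
    rewrite (CI_Chasles (fun t => f (t, Im c)) (Re c) (Re z) (Re w)).
    2: { intros t Ht. apply rcont_h, Hcont, Dcx, Ht. }
    2: { intros t Ht. apply rcont_h, Hcont, Dzw, Ht. }
    rewrite (CI_Chasles (fun t => f (Re w, t)) (Im c) (Im z) (Im w)).
    2: { intros t Ht. apply rcont_v, Hcont, Dyw, Ht. }
    2: { intros t Ht. apply rcont_v, Hcont, W2, near2, Ht. }
    match goal with |- ?L = ?R => replace L with (R + 0) by (rewrite <- Hbd; ring) end. ring. }
  assert (C1 : forall t, between (Re z) (Re w) t -> rcont (fun t => f (t, Im z)) t).
  { intros t Ht. apply rcont_h, Hcont, W2, near1, Ht. }
  assert (C2 : forall t, between (Im z) (Im w) t -> rcont (fun t => f (Re w, t)) t).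
  { intros t Ht. apply rcont_v, Hcont, W2, near2, Ht. }
  assert (C0 : forall t : R, rcont (fun _ => f z) t) by (intros t; apply continuous_const).
  assert (E2 : F w - F z - f z * (w - z) =
    Cint (fun t => f (t, Im z) - f z) (Re z) (Re w) + Ci * Cint (fun t => f (Re w, t) - f z) (Im z) (Im w)).
  { rewrite E1, (CI_minus (fun t => f (t, Im z)) (fun _ => f z)), (CI_minus (fun t => f (Re w, t)) (fun _ => f z)), !CI_const by auto.
    replace (w - z) with ((Re w - Re z)%R + Ci * (Im w - Im z)%R). { ring. }
    rewrite <- Re_minus, <- Im_minus. symmetry. apply C_Re_Im. }
  assert (C1' : forall t, between (Re z) (Re w) t -> rcont (fun t => f (t, Im z) - f z) t).
  { intros t Ht. apply (continuous_minus (V := C_R_NormedModule)); [apply C1, Ht|apply C0]. }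
  assert (C2' : forall t, between (Im z) (Im w) t -> rcont (fun t => f (Re w, t) - f z) t).
  { intros t Ht. apply (continuous_minus (V := C_R_NormedModule)); [apply C2, Ht|apply C0]. }
  rewrite E2.
  eapply Rle_trans; [apply Cmod_triangle|]. rewrite Cmod_mult, Cmod_Ci, Rmult_1_l.
  eapply Rle_trans.
  { apply Rplus_le_compat.
    - apply (CI_bound _ _ _ (eps / 2)); [exact C1'|]. intros t Ht. left. apply W1, near1, Ht.
    - apply (CI_bound _ _ _ (eps / 2)); [exact C2'|]. intros t Ht. left. apply W1, near2, Ht. }
  nra.
Qed.

Definition in_square (c : C) (r : R) (z : C) : Prop :=
  (Rabs (Re z - Re c) <= r)%R /\ (Rabs (Im z - Im c) <= r)%R.

Lemma square_argmax (g : C -> R) (c : C) (r : R) : (0 < r)%R ->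
  (forall z, in_square c r z -> forall eps, (0 < eps)%R -> exists delta, (0 < delta)%R /\
     forall w, (Cmod (w - z) < delta)%R -> (Rabs (g w - g z) < eps)%R) ->
  exists z0, in_square c r z0 /\ forall z, in_square c r z -> (g z <= g z0)%R.
Proof.
  intros Hr Hg.
  set (p := fun s t : R => ((Re c + r * (2 * s - 1))%R, (Im c + r * (2 * t - 1))%R) : C).
  assert (Hp : forall s t, (0 <= s <= 1)%R -> (0 <= t <= 1)%R -> in_square c r (p s t)).
  { intros s t Hs Ht. split; simpl; apply Rabs_le_between; nra. }
  destruct (square_max (fun s t => g (p s t))) as [s0 [t0 [Hs0 [Ht0 Hm]]]].
  - intros s0 t0 eps Hs0 Ht0 He. destruct (Hg (p s0 t0) (Hp _ _ Hs0 Ht0) eps He) as [d [Hd H]].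
    exists (d / (4 * r + 1))%R. split; [apply Rdiv_lt_0_compat; lra|].
    intros s t _ _ Hs Ht. apply H. eapply Rle_lt_trans; [apply Cmod_le_ReIm|].
    apply Rlt_div_r in Hs; [|lra]. apply Rlt_div_r in Ht; [|lra].
    rewrite Re_minus, Im_minus. simpl.
    replace (Re c + r * (2 * s - 1) - (Re c + r * (2 * s0 - 1)))%R with (2 * r * (s - s0))%R by ring.
    replace (Im c + r * (2 * t - 1) - (Im c + r * (2 * t0 - 1)))%R with (2 * r * (t - t0))%R by ring.
    rewrite !Rabs_mult, !(Rabs_pos_eq r), (Rabs_pos_eq 2) by lra.
    generalize (Rabs_pos (s - s0)) (Rabs_pos (t - t0)). nra.
  - exists (p s0 t0). split; [apply Hp; assumption|]. intros z [Hz1 Hz2].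
    apply Rabs_le_between in Hz1. apply Rabs_le_between in Hz2.
    specialize (Hm ((Re z - Re c) / (2 * r) + / 2)%R ((Im z - Im c) / (2 * r) + / 2)%R).
    replace (p ((Re z - Re c) / (2 * r) + / 2) ((Im z - Im c) / (2 * r) + / 2))%R with z in Hm.
    2: { unfold p. destruct z as [x y]. simpl. f_equal; field; lra. }
    apply Hm.
    + assert (H1 : (- / 2 <= (Re z - Re c) / (2 * r))%R) by (apply Rle_div_r; lra).
      assert (H2 : ((Re z - Re c) / (2 * r) <= / 2)%R) by (apply Rle_div_l; lra). lra.
    + assert (H1 : (- / 2 <= (Im z - Im c) / (2 * r))%R) by (apply Rle_div_r; lra).
      assert (H2 : ((Im z - Im c) / (2 * r) <= / 2)%R) by (apply Rle_div_l; lra). lra.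
Qed.

Definition twice_diff (D : C -> Prop) (h : C -> C) : Prop :=
  exists h1, forall z, D z -> cderiv h z (h1 z) /\ exists l, cderiv h1 z l.

(** The remainder [phi] has derivative h1 x - h1 z - l (x - z), which is o(|x - z|); the mean value
    inequality integrates this bound. *)
Lemma taylor2 (D : C -> Prop) (h h1 : C -> C) (z l : C) : copen D -> D z ->
  (forall w, D w -> cderiv h w (h1 w)) -> cderiv h1 z l ->
  forall eps, (0 < eps)%R -> exists delta, (0 < delta)%R /\ forall w, (Cmod w < delta)%R ->
    (Cmod (h (z + w)%C - h z - h1 z * w - l / 2 * (w * w)) <= eps * (Cmod w * Cmod w))%R.
Proof.
  intros HO Hz Hh Hl eps He. destruct (HO z Hz) as [d1 [Hd1 W1]]. destruct (Hl eps He) as [d2 [Hd2 W2]].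
  exists (Rmin d1 d2). split; [apply Rmin_glb_lt; assumption|]. intros w Hw.
  set (phi := fun x : C => h x - h1 z * (x - z) - l / 2 * ((x - z) * (x - z))).
  assert (Hseg : forall t : R, (0 <= t <= 1)%R -> (Cmod (z + t * (z + w - z) - z) <= Cmod w)%R).
  { intros t Ht. replace (z + t * (z + w - z) - z) with (t * w) by ring. rewrite Cmod_mult, Cmod_R, Rabs_pos_eq by lra.
    generalize (Cmod_ge_0 w). nra. }
  assert (H : (Cmod (phi (z + w)%C - phi z) <= eps * Cmod w * Cmod (z + w - z))%R).
  { apply (mean_value_ineq phi (fun x => h1 x - h1 z - l * (x - z))).
    - intros t Ht. unfold phi. eapply cderiv_eq.
      + apply cderiv_minus; [apply cderiv_minus|].
        * apply Hh. apply W1. eapply Rle_lt_trans; [apply Hseg, Ht|]. eapply Rlt_le_trans; [exact Hw|apply Rmin_l].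
        * apply cderiv_scal, cderiv_minus; [apply cderiv_id|apply cderiv_const].
        * apply cderiv_scal. apply (cderiv_mult (fun x => x - z) (fun x => x - z)); apply cderiv_minus; (apply cderiv_id || apply cderiv_const).
      + cbv beta. field.
    - intros t Ht. eapply Rle_trans.
      + apply W2. eapply Rle_lt_trans; [apply Hseg, Ht|]. eapply Rlt_le_trans; [exact Hw|apply Rmin_r].
      + apply Rmult_le_compat_l; [lra|]. apply Hseg, Ht. }
  unfold phi in H. replace (z + w - z) with w in H by ring.
  replace (h (z + w) - h1 z * w - l / 2 * (w * w) - (h z - h1 z * (z - z) - l / 2 * ((z - z) * (z - z))))
    with (h (z + w) - h z - h1 z * w - l / 2 * (w * w)) in H by ring. lra.
Qed.

Lemma Cmod_sqr_ge (a b : C) : (2 * Re (Cconj a * b) - Cmod a * Cmod a <= Cmod b * Cmod b)%R.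
Proof. rewrite !Cmod_sqr. destruct a as [x y], b as [u v]. simpl.
  generalize (Rle_0_sqr (x - u)) (Rle_0_sqr (y - v)). unfold Rsqr. nra. Qed.

Lemma ccont_Cmod (h : C -> C) (z : C) : ccont h z -> forall eps, (0 < eps)%R -> exists delta, (0 < delta)%R /\
     forall w, (Cmod (w - z) < delta)%R -> (Rabs (Cmod (h w) - Cmod (h z)) < eps)%R.
Proof.
  intros H eps He. destruct (H eps He) as [d [Hd W]]. exists d. split; [exact Hd|].
  intros w Hw. eapply Rle_lt_trans; [|apply W, Hw].
  apply Rabs_le_between. generalize (Cmod_triangle_rev (h w) (h z)) (Cmod_triangle_rev (h z) (h w)).
  rewrite (Cmod_minus_sym (h z)). lra.
Qed.

(* At an interior maximum of |h|^2 + e |z - c|^2, the average over the four points z0 + t, z0 - t, z0 + i t, z0 - i t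
   contradicts maximality: the first and second order terms of h cancel and the last summand gains e t^2. *)
Lemma max_principle (D : C -> Prop) (h : C -> C) (c : C) (r M : R) : (0 < r)%R -> copen D ->
  (forall z, in_square c r z -> D z) -> twice_diff D h ->
  (forall z, in_square c r z -> Rabs (Re z - Re c) = r \/ Rabs (Im z - Im c) = r -> (Cmod (h z) <= M)%R) ->
  forall z, in_square c r z -> (Cmod (h z) <= M)%R.
Proof.
  intros Hr HO HK [h1 Hh] HM z1 Hz1. apply Rnot_lt_le. intros Hlt.
  assert (HM0 : (0 <= M)%R).
  { eapply Rle_trans; [apply Cmod_ge_0|]. apply (HM ((Re c + r)%R, Im c)).
    - split; simpl; apply Rabs_le_between; lra.
    - left. simpl. replace (Re c + r - Re c)%R with r by ring. apply Rabs_pos_eq. lra. }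
  (* On the square |z - c|^2 <= 2 r^2, so the added term is at most half of the excess |h z1|^2 -
     M^2, and a maximum of g cannot lie on the boundary. *)
  set (e := ((Cmod (h z1) * Cmod (h z1) - M * M) / (4 * r * r))%R).
  assert (He : (0 < e)%R). { apply Rdiv_lt_0_compat; nra. }
  assert (Ee : (e * (4 * r * r) = Cmod (h z1) * Cmod (h z1) - M * M)%R) by (unfold e; field; lra).
  set (g := fun z => (Cmod (h z) * Cmod (h z) + e * (Cmod (z - c) * Cmod (z - c)))%R).
  assert (Hcs : forall k : C -> C, forall z, ccont k z -> forall eps, (0 < eps)%R -> exists delta, (0 < delta)%R /\
     forall w, (Cmod (w - z) < delta)%R -> (Rabs (Cmod (k w) * Cmod (k w) - Cmod (k z) * Cmod (k z)) < eps)%R).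
  { intros k z Hk eps Heps. set (B := (2 * Cmod (k z) + 1)%R).
    assert (HB : (0 < B)%R) by (unfold B; generalize (Cmod_ge_0 (k z)); lra).
    destruct (ccont_Cmod k z Hk (Rmin 1 (eps / B))) as [d [Hd W]].
    { apply Rmin_glb_lt; [lra|]. apply Rdiv_lt_0_compat; lra. }
    exists d. split; [exact Hd|]. intros w Hw. specialize (W w Hw).
    assert (W1 : (Rabs (Cmod (k w) - Cmod (k z)) < 1)%R) by (eapply Rlt_le_trans; [exact W|apply Rmin_l]).
    assert (W2 : (Rabs (Cmod (k w) - Cmod (k z)) < eps / B)%R) by (eapply Rlt_le_trans; [exact W|apply Rmin_r]).
    apply Rlt_div_r in W2; [|exact HB].
    replace (Cmod (k w) * Cmod (k w) - Cmod (k z) * Cmod (k z))%R with ((Cmod (k w) - Cmod (k z)) * (Cmod (k w) + Cmod (k z)))%R by ring.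
    rewrite Rabs_mult. eapply Rle_lt_trans; [|exact W2]. apply Rmult_le_compat_l; [apply Rabs_pos|].
    generalize (Cmod_ge_0 (k w)) (Cmod_ge_0 (k z)). intros. rewrite Rabs_pos_eq by lra.
    apply Rabs_lt_between in W1. unfold B. lra. }
  destruct (square_argmax g c r Hr) as [z0 [Hz0 Hmax]].
  { intros z Hz eps Heps. destruct (Hh z (HK z Hz)) as [Hd _]. apply cderiv_ccont in Hd.
    destruct (Hcs h z Hd (eps / 2)%R) as [d1 [Hd1 W1]]; [lra|].
    destruct (Hcs (fun w => w - c) z) with (eps := (eps / (2 * e))%R) as [d2 [Hd2 W2]].
    { apply (cderiv_ccont _ _ (1 - 0)). apply cderiv_minus; [apply cderiv_id|apply cderiv_const]. }
    { apply Rdiv_lt_0_compat; lra. }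
    exists (Rmin d1 d2). split; [apply Rmin_glb_lt; assumption|]. intros w Hw. unfold g.
    specialize (W1 w (Rlt_le_trans _ _ _ Hw (Rmin_l _ _))). specialize (W2 w (Rlt_le_trans _ _ _ Hw (Rmin_r _ _))).
    apply Rlt_div_r in W2; [|lra].
    match goal with |- (Rabs ?x < _)%R => replace x with ((Cmod (h w) * Cmod (h w) - Cmod (h z) * Cmod (h z)) + e * (Cmod (w - c) * Cmod (w - c) - Cmod (z - c) * Cmod (z - c)))%R by ring end.
    eapply Rle_lt_trans; [apply Rabs_triang|]. rewrite Rabs_mult, (Rabs_pos_eq e) by lra. lra. }
  assert (Hg1 : (M * M + e * (2 * r * r) < g z0)%R).
  { eapply Rlt_le_trans; [|apply Hmax; exact Hz1]. unfold g. generalize (Cmod_ge_0 (z1 - c)). nra. }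
  assert (Hint : (Rabs (Re z0 - Re c) < r /\ Rabs (Im z0 - Im c) < r)%R).
  { assert (HN : ~ (Rabs (Re z0 - Re c) = r \/ Rabs (Im z0 - Im c) = r)).
    { intros HH. specialize (HM z0 Hz0 HH). unfold g in Hg1. rewrite (Cmod_sqr (z0 - c)), Re_minus, Im_minus in Hg1.
      destruct Hz0 as [A1 A2]. apply Rabs_le_between in A1. apply Rabs_le_between in A2.
      assert ((Re z0 - Re c) * (Re z0 - Re c) <= r * r)%R by nra.
      assert ((Im z0 - Im c) * (Im z0 - Im c) <= r * r)%R by nra.
      generalize (Cmod_ge_0 (h z0)). intros. nra. }
    destruct Hz0 as [A1 A2]. split.
    - destruct A1 as [A1|A1]; [exact A1|]. exfalso. apply HN. left. exact A1.
    - destruct A2 as [A2|A2]; [exact A2|]. exfalso. apply HN. right. exact A2. }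
  destruct (Hh z0 (HK z0 Hz0)) as [Hd [l Hl]].
  (* The remainders contribute at most 8 |A| eta t^2 <= 2 e t^2 to the sum over the four points,
     against a gain of 4 e t^2. *)
  set (A := h z0). set (eta := (e / (4 * (Cmod A + 1)))%R).
  assert (HA : (0 <= Cmod A)%R) by apply Cmod_ge_0.
  assert (Heta : (0 < eta)%R) by (apply Rdiv_lt_0_compat; lra).
  assert (Eeta : (eta * (4 * (Cmod A + 1)) = e)%R) by (unfold eta; field; lra).
  destruct (taylor2 D h h1 z0 l HO (HK z0 Hz0) (fun w Hw => proj1 (Hh w Hw)) Hl eta Heta) as [d [Hd0 W]].
  set (t := (Rmin (d / 2) (Rmin (r - Rabs (Re z0 - Re c)) (r - Rabs (Im z0 - Im c))))%R).
  assert (Ht : (0 < t)%R). { unfold t. repeat apply Rmin_glb_lt; lra. }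
  assert (Htd : (t < d)%R). { apply Rle_lt_trans with (d / 2)%R; [apply Rmin_l|lra]. }
  assert (Ht1 : (t <= r - Rabs (Re z0 - Re c))%R). { eapply Rle_trans; [apply Rmin_r|apply Rmin_l]. }
  assert (Ht2 : (t <= r - Rabs (Im z0 - Im c))%R). { eapply Rle_trans; [apply Rmin_r|apply Rmin_r]. }
  assert (Hsq : forall w, (Rabs (Re w) <= t)%R -> (Rabs (Im w) <= t)%R -> in_square c r (z0 + w)).
  { intros w Hw1 Hw2. split; rewrite ?re_plus, ?im_plus.
    - replace (Re z0 + Re w - Re c)%R with ((Re z0 - Re c) + Re w)%R by ring. eapply Rle_trans; [apply Rabs_triang|]. lra.
    - replace (Im z0 + Im w - Im c)%R with ((Im z0 - Im c) + Im w)%R by ring. eapply Rle_trans; [apply Rabs_triang|]. lra. }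
  assert (Hpt : forall w, Cmod w = t -> (Rabs (Re w) <= t)%R -> (Rabs (Im w) <= t)%R -> exists q : C,
     (Cmod q <= eta * (t * t))%R /\ h (z0 + w) = A + h1 z0 * w + l / 2 * (w * w) + q /\ (g (z0 + w)%C <= g z0)%R).
  { intros w Ew Hw1 Hw2. exists (h (z0 + w) - h z0 - h1 z0 * w - l / 2 * (w * w)). split; [|split].
    - eapply Rle_trans; [apply W; lra|]. rewrite Ew. lra.
    - unfold A. ring.
    - apply Hmax, Hsq; assumption. }
  destruct (Hpt (RtoC t)) as [q1 [Q1 [E1 G1]]]. { rewrite Cmod_R, Rabs_pos_eq; lra. } { simpl. rewrite Rabs_pos_eq; lra. } { simpl. rewrite Rabs_R0; lra. }
  destruct (Hpt (- RtoC t)) as [q2 [Q2 [E2 G2]]]. { rewrite Cmod_opp, Cmod_R, Rabs_pos_eq; lra. } { simpl. rewrite Rabs_Ropp, Rabs_pos_eq; lra. } { simpl. rewrite Ropp_0, Rabs_R0; lra. }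
  destruct (Hpt (Ci * RtoC t)) as [q3 [Q3 [E3 G3]]]. { rewrite Cmod_mult, Cmod_Ci, Cmod_R, Rabs_pos_eq; lra. } { simpl. apply Rabs_le_between; lra. } { simpl. apply Rabs_le_between; lra. }
  destruct (Hpt (- (Ci * RtoC t))) as [q4 [Q4 [E4 G4]]]. { rewrite Cmod_opp, Cmod_mult, Cmod_Ci, Cmod_R, Rabs_pos_eq; lra. } { simpl. apply Rabs_le_between; lra. } { simpl. apply Rabs_le_between; lra. }
  assert (Esum : h (z0 + t) + h (z0 + - t) + h (z0 + Ci * t) + h (z0 + - (Ci * t)) = 4 * A + (q1 + q2 + q3 + q4)).
  { rewrite E1, E2, E3, E4.
    replace (A + h1 z0 * (Ci * t) + l / 2 * (Ci * t * (Ci * t)) + q3) with (A + h1 z0 * (Ci * t) + l / 2 * ((Ci * Ci) * (t * t)) + q3) by ring.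
    replace (- (Ci * t) * - (Ci * t)) with ((Ci * Ci) * (t * t)) by ring.
    replace (Ci * Ci) with (- RtoC 1) by (unfold Ci, RtoC, Cmult, Copp; simpl; f_equal; ring). field. }
  set (H1 := h (z0 + t)) in *. set (H2 := h (z0 + - t)) in *. set (H3 := h (z0 + Ci * t)) in *. set (H4 := h (z0 + - (Ci * t))) in *.
  assert (S1 := Cmod_sqr_ge A H1). assert (S2 := Cmod_sqr_ge A H2). assert (S3 := Cmod_sqr_ge A H3). assert (S4 := Cmod_sqr_ge A H4).
  assert (SR : (Re (Cconj A * H1) + Re (Cconj A * H2) + Re (Cconj A * H3) + Re (Cconj A * H4) =
                4 * (Cmod A * Cmod A) + Re (Cconj A * (q1 + q2 + q3 + q4)))%R).
  { rewrite <- !re_plus. replace (Cconj A * H1 + Cconj A * H2 + Cconj A * H3 + Cconj A * H4) with (Cconj A * (H1 + H2 + H3 + H4)) by ring.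
    rewrite Esum, Cmod_sqr. replace (Cconj A * (4 * A + (q1 + q2 + q3 + q4))) with (4%R * (Cconj A * A) + Cconj A * (q1 + q2 + q3 + q4)) by ring.
    rewrite re_plus, re_scal_l. f_equal. destruct A; simpl; ring. }
  assert (Hq : (- (Cmod A * (4 * (eta * (t * t)))) <= Re (Cconj A * (q1 + q2 + q3 + q4)))%R).
  { assert (HH : (Cmod (Cconj A * (q1 + q2 + q3 + q4)) <= Cmod A * (4 * (eta * (t * t))))%R).
    { rewrite Cmod_mult, Cmod_conj. apply Rmult_le_compat_l; [exact HA|].
      eapply Rle_trans; [apply Cmod_triangle|]. eapply Rle_trans; [apply Rplus_le_compat_r, Cmod_triangle|].
      eapply Rle_trans; [apply Rplus_le_compat_r, Rplus_le_compat_r, Cmod_triangle|]. lra. }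
    generalize (re_le_Cmod (Cconj A * (q1 + q2 + q3 + q4))). intros H5. apply Rabs_le_between in H5. lra. }
  unfold g in G1, G2, G3, G4. fold A H1 H2 H3 H4 in G1, G2, G3, G4.
  rewrite (Cmod_sqr (z0 - c)), (Cmod_sqr (z0 + t - c)) in G1. rewrite (Cmod_sqr (z0 - c)), (Cmod_sqr (z0 + - t - c)) in G2.
  rewrite (Cmod_sqr (z0 - c)), (Cmod_sqr (z0 + Ci * t - c)) in G3. rewrite (Cmod_sqr (z0 - c)), (Cmod_sqr (z0 + - (Ci * t) - c)) in G4.
  destruct z0 as [x0 y0], c as [xc yc]. simpl in G1, G2, G3, G4.
  assert (Hfin : (4 * e * (t * t) <= 8 * (Cmod A * (eta * (t * t))))%R).
  { clear - G1 G2 G3 G4 S1 S2 S3 S4 SR Hq.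
    ring_simplify in G1. ring_simplify in G2. ring_simplify in G3. ring_simplify in G4.
    ring_simplify in S1. ring_simplify in S2. ring_simplify in S3. ring_simplify in S4. ring_simplify in SR. ring_simplify in Hq.
    ring_simplify. lra. }
  assert (0 < t * t)%R by nra. rewrite <- Eeta in Hfin. nra.
Qed.

(** * The identity theorem *)

Lemma zero_near_open (f : C -> C) (c : C) : zero_near f c ->
  exists delta, (0 < delta)%R /\ forall w, (Cmod (w - c) < delta)%R -> zero_near f w.
Proof.
  intros [d [Hd H]]. exists d. split; [exact Hd|]. intros w Hw.
  exists (d - Cmod (w - c))%R. split; [lra|]. intros x Hx. apply H.
  eapply Rle_lt_trans; [apply (Cmod_triangle_dist x w c)|]. lra.
Qed.

Lemma zero_near_cderiv (f : C -> C) (c : C) : zero_near f c -> cderiv f c 0.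
Proof.
  intros [d [Hd H]]. apply cderiv_ext_loc with (fun _ => 0); [|apply cderiv_const].
  exists d. split; [exact Hd|]. intros w Hw. symmetry. apply H, Hw.
Qed.

(** Since h vanishes identically near c, so does the quotient, and the singularity at c disappears;
    away from c the quotient rule applies. *)
Lemma twice_diff_div (D : C -> Prop) (h : C -> C) (c : C) : copen D -> twice_diff D h -> zero_near h c ->
  twice_diff D (fun z => h z / (z - c)) /\ zero_near (fun z => h z / (z - c)) c.
Proof.
  intros HO [h1 Hh] HZ.
  assert (HZ' : zero_near (fun z => h z / (z - c)) c).
  (* At w = c the denominator is 0, but the quotient is then 0 times the default inverse, still
     0. *)
  { destruct HZ as [d [Hd H]]. exists d. split; [exact Hd|]. intros w Hw. rewrite (H w Hw). unfold Cdiv. ring. }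
  split; [|exact HZ'].
  exists (fun z => if excluded_middle_informative (z = c) then RtoC 0 else (h1 z * (z - c) - h z) / ((z - c) * (z - c))).
  intros z Hz. destruct (Hh z Hz) as [Hd [l Hl]].
  destruct (excluded_middle_informative (z = c)) as [E|N].
  - subst z. split.
    + apply zero_near_cderiv, HZ'.
    + exists 0. apply zero_near_cderiv. destruct (zero_near_open _ _ HZ) as [d1 [Hd1 W1]].
      destruct (HO c Hz) as [d2 [Hd2 W2]].
      exists (Rmin d1 d2). split; [apply Rmin_glb_lt; assumption|]. intros w Hw.
      assert (Hw1 := Rlt_le_trans _ _ _ Hw (Rmin_l _ _)). assert (Hw2 := Rlt_le_trans _ _ _ Hw (Rmin_r _ _)).
      destruct (excluded_middle_informative (w = c)) as [_|_]; [reflexivity|].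
      assert (Hzw := W1 w Hw1).
      rewrite (cderiv_unique _ _ _ _ (proj1 (Hh w (W2 w Hw2))) (zero_near_cderiv _ _ Hzw)).
      destruct Hzw as [d3 [Hd3 W3]]. rewrite (W3 w). { unfold Cdiv. ring. }
      replace (w - w) with (RtoC 0) by ring. rewrite Cmod_0. exact Hd3.
  - assert (Hn : z - c <> 0) by (apply Cminus_eq_contra, N). split.
    + eapply cderiv_eq.
      * apply (cderiv_div h (fun z => z - c)); [exact Hd| |exact Hn]. apply cderiv_minus; [apply cderiv_id|apply cderiv_const].
      * cbv beta. field. exact Hn.
    + eexists. eapply cderiv_ext_loc.
      2: { apply (cderiv_div (fun z => h1 z * (z - c) - h z) (fun z => (z - c) * (z - c))).
           - apply cderiv_minus; [|exact Hd]. apply (cderiv_mult h1 (fun z => z - c)); [exact Hl|].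
             apply cderiv_minus; [apply cderiv_id|apply cderiv_const].
           - apply (cderiv_mult (fun z => z - c) (fun z => z - c)); apply cderiv_minus; (apply cderiv_id || apply cderiv_const).
           - apply Cmult_neq_0; exact Hn. }
      exists (Cmod (z - c)). split; [apply Cmod_gt_0, Hn|]. intros w Hw. cbv beta.
      destruct (excluded_middle_informative (w = c)) as [E|_]; [|reflexivity].
      subst w. rewrite Cmod_minus_sym in Hw. lra.
Qed.

(* The maximum principle applied to h / (z - c)^n gives |h z| <= M (|z - c| / r)^n for every n. *)
Lemma identity_square (D : C -> Prop) (h : C -> C) (c : C) (r : R) : (0 < r)%R -> copen D ->
  (forall z, in_square c r z -> D z) -> twice_diff D h -> zero_near h c ->
  forall z, (Cmod (z - c) < r)%R -> h z = 0.
Proof.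
  intros Hr HO HK Hh HZ.
  assert (Hk : forall n : nat, exists k, twice_diff D k /\ zero_near k c /\ forall z, z <> c -> k z = h z / (z - c) ^ n).
  { induction n as [|n [k [K1 [K2 K3]]]].
    - exists h. repeat split; auto. intros z _. simpl. field.
    - destruct (twice_diff_div D k c HO K1 K2) as [K4 K5]. exists (fun z => k z / (z - c)). repeat split; auto.
      intros z Hz. rewrite K3 by exact Hz. rewrite Cpow_S. assert (z - c <> 0) by (apply Cminus_eq_contra, Hz).
      field. split; [|exact H]. apply Cpow_nz, H. }
  destruct (square_argmax (fun z => Cmod (h z)) c r Hr) as [z0 [_ Hmax]].
  { intros z Hz. apply ccont_Cmod. destruct Hh as [h1 Hh]. apply (cderiv_ccont _ _ (h1 z)). apply Hh, HK, Hz. }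
  set (M := Cmod (h z0)) in *. assert (HM : (0 <= M)%R) by apply Cmod_ge_0.
  intros z Hz. destruct (classic (z = c)) as [->|Hzc].
  { destruct HZ as [d [Hd W]]. apply W. replace (c - c) with (RtoC 0) by ring. rewrite Cmod_0. exact Hd. }
  assert (Hpos : (0 < Cmod (z - c))%R) by (apply Cmod_gt_0, Cminus_eq_contra, Hzc).
  set (q := (Cmod (z - c) / r)%R).
  assert (Hq : (0 <= q < 1)%R). { unfold q. split; [apply Rlt_le, Rdiv_lt_0_compat; lra|]. apply Rlt_div_l; lra. }
  assert (Hbnd : forall n, (Cmod (h z) <= M * q ^ n)%R).
  { intros n. destruct (Hk n) as [k [K1 [_ K3]]].
    assert (B : (Cmod (k z) <= M / r ^ n)%R).
    { apply (max_principle D k c r (M / r ^ n) Hr HO HK K1).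
      - intros w Hw Hbd. assert (Hcw : (r <= Cmod (w - c))%R).
        { destruct Hbd as [<-|<-]; [rewrite <- Re_minus; apply re_le_Cmod|rewrite <- Im_minus; apply Im_le_Cmod]. }
        assert (Hwc : w <> c). { intros ->. replace (c - c) with (RtoC 0) in Hcw by ring. rewrite Cmod_0 in Hcw. lra. }
        rewrite K3 by exact Hwc. rewrite Cmod_div, Cmod_pow by (apply Cpow_nz, Cminus_eq_contra, Hwc).
        apply Rmult_le_compat; [apply Cmod_ge_0| |apply Hmax, Hw|].
        + apply Rlt_le, Rinv_0_lt_compat, pow_lt. lra.
        + apply Rinv_le_contravar; [apply pow_lt; lra|]. apply pow_incr. lra.
      - split; [rewrite <- Re_minus; eapply Rle_trans; [apply re_le_Cmod|lra]|rewrite <- Im_minus; eapply Rle_trans; [apply Im_le_Cmod|lra]]. }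
    rewrite K3 in B by exact Hzc. rewrite Cmod_div, Cmod_pow in B by (apply Cpow_nz, Cminus_eq_contra, Hzc).
    apply (fun H => proj1 (Rle_div_l _ _ _ H)) in B; [|apply pow_lt; exact Hpos]. unfold q. unfold Rdiv at 1. rewrite Rpow_mult_distr, pow_inv.
    eapply Rle_trans; [exact B|]. apply Req_le. unfold Rdiv. ring. }
  apply Cmod_eq_0. apply Rle_antisym; [|apply Cmod_ge_0]. apply Rnot_lt_le. intros Hlt.
  destruct (pow_lt_1_zero q) with (y := (Cmod (h z) / (M + 1))%R) as [N HN].
  { rewrite Rabs_pos_eq; lra. } { apply Rdiv_lt_0_compat; lra. }
  specialize (HN N (Nat.le_refl N)). rewrite Rabs_pos_eq in HN by (apply pow_le; lra).
  apply Rlt_div_r in HN; [|lra]. specialize (Hbnd N). assert (0 <= q ^ N)%R by (apply pow_le; lra). nra.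
Qed.

(** Applied to a primitive F, which has two derivatives by construction: F - F c vanishes near c,
    hence on the ball, and f is its derivative. *)
Lemma identity_ball (f : C -> C) (c : C) (r : R) :
  (forall z, (Rabs (Re z - Re c) < r)%R -> (Rabs (Im z - Im c) < r)%R -> exists l, cderiv f z l) ->
  zero_near f c -> forall z, (Cmod (z - c) < r)%R -> f z = 0.
Proof.
  intros Hf HZ z Hz.
  set (D := fun z : C => (Rabs (Re z - Re c) < r)%R /\ (Rabs (Im z - Im c) < r)%R).
  assert (Hr : (0 < r)%R) by (generalize (Cmod_ge_0 (z - c)); lra).
  assert (HO : copen D).
  { intros w [H1 H2]. exists (Rmin (r - Rabs (Re w - Re c)) (r - Rabs (Im w - Im c))).
    split; [apply Rmin_glb_lt; lra|]. intros x Hx.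
    assert (Hx1 := Rlt_le_trans _ _ _ Hx (Rmin_l _ _)). assert (Hx2 := Rlt_le_trans _ _ _ Hx (Rmin_r _ _)).
    assert (A1 := re_le_Cmod (x - w)). assert (A2 := Im_le_Cmod (x - w)). rewrite Re_minus in A1. rewrite Im_minus in A2.
    split.
    - replace (Re x - Re c)%R with ((Re x - Re w) + (Re w - Re c))%R by ring. eapply Rle_lt_trans; [apply Rabs_triang|]. lra.
    - replace (Im x - Im c)%R with ((Im x - Im w) + (Im w - Im c))%R by ring. eapply Rle_lt_trans; [apply Rabs_triang|]. lra. }
  assert (Hbt : forall a b x m, (Rabs (a - m) < r)%R -> (Rabs (b - m) < r)%R -> between a b x -> (Rabs (x - m) < r)%R).
  { intros a b x m H1 H2. unfold between, Rmin, Rmax. apply Rabs_lt_between in H1. apply Rabs_lt_between in H2.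
    intros H3. apply Rabs_lt_between. destruct Rle_dec; lra. }
  assert (HR : rect_closed D).
  { intros a b x [A1 A2] [B1 B2] [X1 X2]. split; [apply (Hbt (Re a) (Re b))|apply (Hbt (Im a) (Im b))]; assumption. }
  assert (Dc : D c). { split; [replace (Re c - Re c)%R with 0%R by ring|replace (Im c - Im c)%R with 0%R by ring]; rewrite Rabs_R0; exact Hr. }
  destruct (holo_primitive D f c HO HR (fun z Hz => Hf z (proj1 Hz) (proj2 Hz)) Dc) as [F HF].
  set (r' := ((Cmod (z - c) + r) / 2)%R).
  assert (Hr' : (Cmod (z - c) < r' < r)%R) by (unfold r'; lra).
  assert (HK : forall w, in_square c r' w -> D w).
  { intros w [H1 H2]. split; lra. }
  assert (HFz : forall w, (Cmod (w - c) < r')%R -> F w - F c = 0).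
  { apply (identity_square D (fun w => F w - F c) c r'); auto.
    - generalize (Cmod_ge_0 (z - c)); lra.
    - exists f. intros w Hw. split.
      + eapply cderiv_eq; [apply cderiv_minus; [apply HF, Hw|apply cderiv_const]|]. ring.
      + apply Hf; apply Hw.
    - destruct HZ as [d [Hd W]]. destruct (HO c Dc) as [d' [Hd' W']].
      exists (Rmin d d'). split; [apply Rmin_glb_lt; assumption|]. intros w Hw.
      assert (Hseg : forall t : R, (0 <= t <= 1)%R -> (Cmod (c + t * (w - c) - c) < Rmin d d')%R).
      { intros t Ht. replace (c + t * (w - c) - c) with (t * (w - c)) by ring. rewrite Cmod_mult, Cmod_R, Rabs_pos_eq by lra.
        generalize (Cmod_ge_0 (w - c)). nra. }
      apply Cmod_eq_0. apply Rle_antisym; [|apply Cmod_ge_0].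
      rewrite <- (Rmult_0_l (Cmod (w - c))). apply (mean_value_ineq F f).
      + intros t Ht. apply HF, W'. eapply Rlt_le_trans; [apply Hseg, Ht|apply Rmin_r].
      + intros t Ht. rewrite W; [rewrite Cmod_0; lra|]. eapply Rlt_le_trans; [apply Hseg, Ht|apply Rmin_l]. }
  apply (cderiv_unique F z).
  - apply HF, HK. split; [rewrite <- Re_minus; eapply Rle_trans; [apply re_le_Cmod|lra]|rewrite <- Im_minus; eapply Rle_trans; [apply Im_le_Cmod|lra]].
  - apply cderiv_ext_loc with (fun _ => F c); [|apply cderiv_const].
    exists (r' - Cmod (z - c))%R. split; [lra|]. intros w Hw. symmetry. apply Ceq_minus, HFz.
    eapply Rle_lt_trans; [apply (Cmod_triangle_dist w z c)|]. lra.
Qed.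

(** Connectedness of [0, 1] in the form that continuation uses: open, and closed under limits from
    the left. *)
Lemma real_induction (P : R -> Prop) : P 0%R ->
  (forall t, (0 <= t <= 1)%R -> P t -> exists delta, (0 < delta)%R /\ forall s, (0 <= s <= 1)%R -> (Rabs (s - t) < delta)%R -> P s) ->
  (forall t, (0 < t <= 1)%R -> (forall s, (0 <= s < t)%R -> P s) -> P t) ->
  forall t, (0 <= t <= 1)%R -> P t.
Proof.
  intros H0 Hop Hcl t Ht.
  set (E := fun x => (0 <= x <= 1)%R /\ forall s, (0 <= s <= x)%R -> P s).
  assert (E0 : E 0%R). { split; [lra|]. intros s Hs. replace s with 0%R by lra. exact H0. }
  destruct (completeness E) as [m [Hm1 Hm2]].
  { exists 1%R. intros x [Hx _]. lra. } { exists 0%R. exact E0. }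
  assert (Hm : (0 <= m <= 1)%R). { split; [apply Hm1, E0|]. apply Hm2. intros x [Hx _]. lra. }
  assert (Hlt : forall s, (0 <= s < m)%R -> P s).
  { intros s Hs. apply NNPP. intros HN. assert (H : (m <= s)%R); [|lra]. apply Hm2. intros x [Hx Hx'].
    apply Rnot_lt_le. intros Hsx. apply HN, Hx'. lra. }
  assert (HPm : P m). { destruct (Req_dec m 0) as [->|Hm0]; [exact H0|]. apply Hcl; [lra|exact Hlt]. }
  destruct (Hop m Hm HPm) as [d [Hd W]].
  assert (Hm1' : m = 1%R).
  { apply NNPP. intros Hne. set (x := Rmin 1 (m + d / 2)%R).
    assert (Hx : (m < x <= 1 /\ x <= m + d / 2)%R). { unfold x. split; [split; [apply Rmin_glb_lt; lra|apply Rmin_l]|apply Rmin_r]. }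
    assert (Ex : E x). { split; [lra|]. intros s Hs. destruct (Rlt_dec s m) as [L|L]; [apply Hlt; lra|].
      apply W; [lra|]. apply Rabs_lt_between. lra. }
    specialize (Hm1 x Ex). lra. }
  destruct (Req_dec t 1) as [->|Ht1]; [rewrite <- Hm1'; exact HPm|]. apply Hlt. lra.
Qed.

Lemma line_dist (a b : C) (s t : R) : Cmod (a + s * (b - a) - (a + t * (b - a))) = (Rabs (s - t) * Cmod (b - a))%R.
Proof.
  replace (a + s * (b - a) - (a + t * (b - a))) with ((s - t)%R * (b - a)) by (rewrite RtoC_minus; ring).
  rewrite Cmod_mult, Cmod_R. reflexivity.
Qed.

Lemma line_near (a b : C) (t eps : R) : (0 < eps)%R -> exists delta, (0 < delta)%R /\
  forall s : R, (Rabs (s - t) < delta)%R -> (Cmod (a + s * (b - a) - (a + t * (b - a))) < eps)%R.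
Proof.
  intros He. assert (Hb : (0 < Cmod (b - a) + 1)%R) by (generalize (Cmod_ge_0 (b - a)); lra).
  exists (eps / (Cmod (b - a) + 1))%R. split; [apply Rdiv_lt_0_compat; lra|]. intros s Hs.
  rewrite line_dist. apply Rlt_div_r in Hs; [|exact Hb]. generalize (Rabs_pos (s - t)). nra.
Qed.

Lemma identity_segment (D : C -> Prop) (f : C -> C) (a b : C) : copen D -> holo D f ->
  (forall t : R, (0 <= t <= 1)%R -> D (a + t * (b - a))) -> zero_near f a ->
  forall t : R, (0 <= t <= 1)%R -> zero_near f (a + t * (b - a)).
Proof.
  intros HO Hf HD HZ. apply real_induction.
  - replace (a + 0%R * (b - a)) with a by ring. exact HZ.
  - intros t Ht H. destruct (zero_near_open _ _ H) as [d [Hd W]].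
    destruct (line_near a b t d Hd) as [d' [Hd' W']]. exists d'. split; [exact Hd'|]. intros s _ Hs. apply W, W', Hs.
  - intros t Ht Hs. destruct (HO _ (HD t ltac:(lra))) as [d [Hd W]].
    (* With c within d/8 of z0, the ball of radius d/4 about c covers a neighbourhood of z0, and its
       circumscribed square stays within distance d of z0. *)
    destruct (line_near a b t (d / 8)%R ltac:(lra)) as [d' [Hd' W']].
    set (s := Rmax 0 (t - d' / 2)%R).
    assert (Hst : (0 <= s < t /\ t - d' / 2 <= s)%R). { unfold s. split; [split; [apply Rmax_l|apply Rmax_lub_lt; lra]|apply Rmax_r]. }
    assert (Hnear := W' s ltac:(apply Rabs_lt_between; lra)).
    specialize (Hs s (proj1 Hst)).
    set (c := a + s * (b - a)) in *. set (z0 := a + t * (b - a)) in *.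
    assert (HI : forall z, (Cmod (z - c) < d / 4)%R -> f z = 0).
    { apply identity_ball; [|exact Hs]. intros z Hz1 Hz2. apply Hf, W.
      eapply Rle_lt_trans; [apply (Cmod_triangle_dist z c z0)|].
      assert (B := Cmod_le_ReIm (z - c)). rewrite Re_minus, Im_minus in B. lra. }
    exists (d / 8)%R. split; [lra|]. intros w Hw. apply HI.
    eapply Rle_lt_trans; [apply (Cmod_triangle_dist w z0 c)|]. rewrite (Cmod_minus_sym z0 c). lra.
Qed.

(** * Absolutely convergent complex series *)

Definition abssum (a : nat -> C) : Prop := ex_series (fun n => Cmod (a n)).

Lemma abssum_le (a : nat -> C) (b : nat -> R) : (forall n, (Cmod (a n) <= b n)%R) -> ex_series b -> abssum a.
Proof.
  intros H. apply (ex_series_le (K := R_AbsRing) (V := R_CompleteNormedModule)). intros n.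
  change (Rabs (Cmod (a n)) <= b n)%R. rewrite Rabs_pos_eq by apply Cmod_ge_0. apply H.
Qed.

Lemma ex_series_Rle (a b : nat -> R) : (forall n, (Rabs (a n) <= b n)%R) -> ex_series b -> ex_series a.
Proof. intros H. apply (ex_series_le (K := R_AbsRing) (V := R_CompleteNormedModule)). exact H. Qed.

Lemma ex_Rscal (c : R) (b : nat -> R) : ex_series b -> ex_series (fun n => (c * b n)%R).
Proof. intros H. exact (ex_series_scal_l (K := R_AbsRing) c b H). Qed.

Lemma abssum_Re (a : nat -> C) : abssum a -> ex_series (fun n => Re (a n)).
Proof. apply ex_series_Rle. intros n. apply re_le_Cmod. Qed.
Lemma abssum_Im (a : nat -> C) : abssum a -> ex_series (fun n => Im (a n)).
Proof. apply ex_series_Rle. intros n. apply Im_le_Cmod. Qed.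

Lemma abssum_plus (a b : nat -> C) : abssum a -> abssum b -> abssum (fun n => a n + b n).
Proof.
  intros Ha Hb. apply abssum_le with (fun n => (Cmod (a n) + Cmod (b n))%R).
  - intros n. apply Cmod_triangle.
  - apply (ex_series_plus (K := R_AbsRing) (V := R_NormedModule)); assumption.
Qed.
Lemma abssum_scal (c : C) (a : nat -> C) : abssum a -> abssum (fun n => c * a n).
Proof.
  intros Ha. apply abssum_le with (fun n => (Cmod c * Cmod (a n))%R).
  - intros n. rewrite Cmod_mult. lra.
  - apply (ex_Rscal (Cmod c) (fun n => Cmod (a n))). exact Ha.
Qed.
Lemma abssum_ext (a b : nat -> C) : (forall n, a n = b n) -> abssum a -> abssum b.
Proof. intros H. apply ex_series_ext. intros n. rewrite H. reflexivity. Qed.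

Lemma C_eq (x y : C) : Re x = Re y -> Im x = Im y -> x = y.
Proof. destruct x, y. simpl. intros -> ->. reflexivity. Qed.

Lemma CSeries_ext (a b : nat -> C) : (forall n, a n = b n) -> CSeries a = CSeries b.
Proof. intros H. unfold CSeries. f_equal; apply Series_ext; intros n; rewrite H; reflexivity. Qed.

Lemma CSeries_plus (a b : nat -> C) : abssum a -> abssum b ->
  CSeries (fun n => a n + b n) = CSeries a + CSeries b.
Proof.
  intros Ha Hb. apply C_eq; rewrite ?re_plus, ?im_plus; simpl.
  - rewrite <- Series_plus by (apply abssum_Re; assumption). apply Series_ext. intros n. apply re_plus.
  - rewrite <- Series_plus by (apply abssum_Im; assumption). apply Series_ext. intros n. apply im_plus.
Qed.

Lemma CSeries_scal (c : C) (a : nat -> C) : abssum a -> CSeries (fun n => c * a n) = c * CSeries a.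
Proof.
  intros Ha. apply C_eq; rewrite ?re_mult, ?im_mult; simpl.
  - rewrite <- !Series_scal_l, <- Series_minus.
    + apply Series_ext. intros n. apply re_mult.
    + apply (ex_Rscal (Re c) (fun n => Re (a n))), abssum_Re, Ha.
    + apply (ex_Rscal (Im c) (fun n => Im (a n))), abssum_Im, Ha.
  - rewrite <- !Series_scal_l, <- Series_plus.
    + apply Series_ext. intros n. apply im_mult.
    + apply (ex_Rscal (Re c) (fun n => Im (a n))), abssum_Im, Ha.
    + apply (ex_Rscal (Im c) (fun n => Re (a n))), abssum_Re, Ha.
Qed.

(** Componentwise estimates would lose a constant. Pairing with conj S, where S is the sum, reduces
    the bound to a real series: |S|^2 is the sum of Re (conj S * a n). *)
Lemma CSeries_bound (a : nat -> C) (b : nat -> R) : (forall n, (Cmod (a n) <= b n)%R) -> ex_series b ->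
  (Cmod (CSeries a) <= Series b)%R.
Proof.
  intros H Hb. assert (Ha : abssum a) by (apply abssum_le with b; assumption).
  set (S := CSeries a).
  assert (Hb0 : (0 <= Series b)%R).
  { rewrite <- (Rmult_0_l (Series b)), <- Series_scal_l.
    apply Series_le; [|exact Hb]. intros n. rewrite Rmult_0_l. split; [lra|]. eapply Rle_trans; [apply Cmod_ge_0|apply H]. }
  assert (E : (Cmod S * Cmod S <= Cmod S * Series b)%R).
  { replace (Cmod S * Cmod S)%R with (Re (Cconj S * S)) by (rewrite Cmod_sqr; destruct S; simpl; ring).
    unfold S at 2. rewrite <- CSeries_scal by exact Ha. simpl. rewrite <- Series_scal_l.
    eapply Rle_trans; [apply Rle_abs|]. eapply Rle_trans; [apply Series_Rabs|].
    - apply ex_series_Rle with (fun n => (Cmod S * b n)%R); [|apply (ex_Rscal (Cmod S) b), Hb].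
      intros n. rewrite Rabs_Rabsolu. eapply Rle_trans; [apply (re_le_Cmod (Cconj S * a n))|]. rewrite Cmod_mult, Cmod_conj.
      apply Rmult_le_compat_l; [apply Cmod_ge_0|apply H].
    - apply Series_le; [|apply (ex_Rscal (Cmod S) b), Hb]. intros n. split; [apply Rabs_pos|].
      eapply Rle_trans; [apply (re_le_Cmod (Cconj S * a n))|]. rewrite Cmod_mult, Cmod_conj.
      apply Rmult_le_compat_l; [apply Cmod_ge_0|apply H]. }
  destruct (Req_dec (Cmod S) 0) as [->|N]; [exact Hb0|].
  apply Rmult_le_reg_l with (Cmod S); [|exact E]. generalize (Cmod_ge_0 S). lra.
Qed.

Lemma abssum_shift (a : nat -> C) (N : nat) : abssum a -> abssum (fun n => a (N + n)%nat).
Proof. intros H. apply (ex_series_incr_n (K := R_AbsRing) (V := R_NormedModule) (fun n => Cmod (a n)) N). exact H. Qed.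

Lemma CSeries_incr_1 (a : nat -> C) : abssum a -> CSeries a = a 0%nat + CSeries (fun n => a (S n)).
Proof.
  intros H. apply C_eq; rewrite ?re_plus, ?im_plus; simpl; (rewrite Series_incr_1; [reflexivity|]).
  - apply abssum_Re, H. - apply abssum_Im, H.
Qed.

Fixpoint csum (a : nat -> C) (N : nat) : C := match N with O => 0 | S m => csum a m + a m end.

Lemma CSeries_csum (a : nat -> C) (N : nat) : abssum a -> CSeries a = csum a N + CSeries (fun n => a (N + n)%nat).
Proof.
  intros H. induction N as [|N IH]. - simpl. rewrite Cplus_0_l. apply CSeries_ext. reflexivity.
  - rewrite IH, (CSeries_incr_1 (fun n => a (N + n)%nat)) by (apply abssum_shift, H). simpl.
    rewrite Nat.add_0_r, Cplus_assoc. f_equal. apply CSeries_ext. intros n. f_equal. lia.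
Qed.

Lemma Series_tail_small (b : nat -> R) : (forall n, (0 <= b n)%R) -> ex_series b -> forall eps, (0 < eps)%R ->
  exists N, forall M, (N <= M)%nat -> (Rabs (Series (fun n => b (M + n)%nat)) < eps)%R.
Proof.
  intros H0 Hb eps He. assert (H := Series_correct b Hb).
  destruct (proj1 (filterlim_locally _ _) H (mkposreal eps He)) as [N HN].
  (* [sum_n] includes its last index: M terms end at index pred M, and M must be positive. *)
  exists (S N). intros M HM. specialize (HN (pred M) ltac:(lia)).
  rewrite (Series_incr_n b M) in HN by (exact Hb || lia).
  change (Rabs (sum_n b (pred M) - (sum_f_R0 b (pred M) + Series (fun k => b (M + k)%nat))) < eps)%R in HN.
  rewrite sum_n_Reals in HN.
  replace (sum_f_R0 b (pred M) - (sum_f_R0 b (pred M) + Series (fun k => b (M + k)%nat)))%R with (- Series (fun k => b (M + k)%nat))%R in HN by ring.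
  rewrite Rabs_Ropp in HN. exact HN.
Qed.

Lemma CSeries_limit (a : nat -> C) : abssum a -> forall eps, (0 < eps)%R ->
  exists N, forall M, (N <= M)%nat -> (Cmod (CSeries a - csum a M) < eps)%R.
Proof.
  intros H eps He. destruct (Series_tail_small (fun n => Cmod (a n)) (fun n => Cmod_ge_0 _) H eps He) as [N HN].
  exists N. intros M HM. rewrite (CSeries_csum a M H). replace (csum a M + CSeries (fun n => a (M + n)%nat) - csum a M) with (CSeries (fun n => a (M + n)%nat)) by ring.
  eapply Rle_lt_trans; [|apply (HN M HM)]. eapply Rle_trans; [|apply Rle_abs].
  apply CSeries_bound; [intros; lra|]. apply abssum_shift, H.
Qed.

Lemma csum_CSeries (f : nat -> nat -> C) (N : nat) : (forall m, abssum (f m)) ->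
  abssum (fun n => csum (fun m => f m n) N) /\
  CSeries (fun n => csum (fun m => f m n) N) = csum (fun m => CSeries (f m)) N.
Proof.
  intros H. induction N as [|N [IH1 IH2]]; simpl.
  - split.
    + apply abssum_ext with (fun n => 0 * f 0%nat n); [intros; ring|]. apply abssum_scal, H.
    + transitivity (0 * CSeries (f 0%nat)); [|ring]. rewrite <- CSeries_scal by apply H. apply CSeries_ext. intros; ring.
  - split; [apply abssum_plus; auto|]. rewrite CSeries_plus, IH2; auto.
Qed.

Lemma Series_nonneg (b : nat -> R) : (forall n, (0 <= b n)%R) -> ex_series b -> (0 <= Series b)%R.
Proof.
  intros H Hb. eapply Rle_trans; [apply Cmod_ge_0|]. apply (CSeries_bound (fun n => RtoC (b n))); [|exact Hb].
  intros n. rewrite Cmod_R, Rabs_pos_eq; [lra|apply H].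
Qed.

Lemma small_eq_0 (z : C) (K : R) : (forall eps, (0 < eps)%R -> (Cmod z <= K * eps)%R) -> z = 0.
Proof.
  intros H. apply Cmod_eq_0. apply Rle_antisym; [|apply Cmod_ge_0]. apply Rnot_lt_le. intros Hz.
  assert (HK := Rabs_pos K). specialize (H (Cmod z / (2 * (Rabs K + 1)))%R ltac:(apply Rdiv_lt_0_compat; lra)).
  assert (K * (Cmod z / (2 * (Rabs K + 1))) <= (Rabs K + 1) * (Cmod z / (2 * (Rabs K + 1))))%R.
  { apply Rmult_le_compat_r; [apply Rlt_le, Rdiv_lt_0_compat; lra|]. generalize (Rle_abs K); lra. }
  replace ((Rabs K + 1) * (Cmod z / (2 * (Rabs K + 1))))%R with (Cmod z / 2)%R in H0 by (field; lra). lra.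
Qed.

(** Truncation in m: finitely many rows commute with the sum over n, and each of the two remaining
    double sums is at most the sum of B times a tail of A. *)
Lemma CSeries_Fubini (f : nat -> nat -> C) (A B : nat -> R) :
  (forall m n, (Cmod (f m n) <= A m * B n)%R) -> (forall m, (0 <= A m)%R) -> (forall n, (0 <= B n)%R) ->
  ex_series A -> ex_series B ->
  CSeries (fun m => CSeries (f m)) = CSeries (fun n => CSeries (fun m => f m n)).
Proof.
  intros H HA HB EA EB.
  assert (S1 : forall m, abssum (f m)).
  { intros m. apply abssum_le with (fun n => (A m * B n)%R); [apply H|]. apply (ex_Rscal (A m) B EB). }
  assert (S2 : forall n, abssum (fun m => f m n)).
  { intros n. apply abssum_le with (fun m => (B n * A m)%R); [intros m; rewrite Rmult_comm; apply H|]. apply (ex_Rscal (B n) A EA). }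
  assert (B1 : forall m, (Cmod (CSeries (f m)) <= A m * Series B)%R).
  { intros m. rewrite <- Series_scal_l. apply CSeries_bound; [apply H|]. apply (ex_Rscal (A m) B EB). }
  assert (HSB : (0 <= Series B)%R) by (apply Series_nonneg; assumption).
  assert (S3 : abssum (fun m => CSeries (f m))).
  { apply abssum_le with (fun m => (Series B * A m)%R); [intros m; rewrite Rmult_comm; apply B1|]. apply (ex_Rscal (Series B) A EA). }
  apply Ceq_minus. apply small_eq_0 with (2 * Series B)%R. intros eps He.
  destruct (Series_tail_small A HA EA eps He) as [N HN]. specialize (HN N (Nat.le_refl N)).
  assert (EA' : ex_series (fun m => A (N + m)%nat)) by (apply (ex_series_incr_n (K := R_AbsRing) (V := R_NormedModule) A N), EA).
  rewrite (CSeries_csum _ N S3).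
  rewrite (CSeries_ext (fun n => CSeries (fun m => f m n)) (fun n => csum (fun m => f m n) N + CSeries (fun m => f (N + m)%nat n))).
  2: { intros n. apply (CSeries_csum (fun m => f m n)), S2. }
  assert (B2 : forall n, (Cmod (CSeries (fun m => f (N + m)%nat n)) <= eps * B n)%R).
  { intros n. apply Rle_trans with (B n * Series (fun m => A (N + m)%nat))%R.
    - rewrite <- Series_scal_l. apply CSeries_bound; [intros m; rewrite Rmult_comm; apply H|]. apply (ex_Rscal (B n) _ EA').
    - rewrite Rmult_comm. apply Rmult_le_compat_r; [apply HB|]. left. eapply Rle_lt_trans; [apply Rle_abs|exact HN]. }
  rewrite CSeries_plus.
  2: { apply (csum_CSeries (fun m n => f m n)), S1. }
  2: { apply abssum_le with (1 := B2). apply (ex_Rscal eps B EB). }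
  rewrite (proj2 (csum_CSeries f N S1)).
  replace (csum (fun m => CSeries (f m)) N + CSeries (fun n => CSeries (f (N + n)%nat)) - (csum (fun m => CSeries (f m)) N + CSeries (fun n => CSeries (fun m => f (N + m)%nat n))))
    with (CSeries (fun n => CSeries (f (N + n)%nat)) - CSeries (fun n => CSeries (fun m => f (N + m)%nat n))) by ring.
  unfold Cminus. eapply Rle_trans; [apply Cmod_triangle|]. rewrite Cmod_opp.
  replace (2 * Series B * eps)%R with (Series B * eps + eps * Series B)%R by ring. apply Rplus_le_compat.
  - apply Rle_trans with (Series B * Series (fun m => A (N + m)%nat))%R.
    + rewrite <- Series_scal_l. apply CSeries_bound; [intros m; rewrite Rmult_comm; apply B1|]. apply (ex_Rscal (Series B) _ EA').
    + apply Rmult_le_compat_l; [exact HSB|]. left. eapply Rle_lt_trans; [apply Rle_abs|exact HN].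
  - rewrite <- Series_scal_l. apply CSeries_bound; [exact B2|]. apply (ex_Rscal eps B EB).
Qed.

Lemma CSeries_even_odd (a : nat -> C) : abssum a -> abssum (fun n => a (2 * n)%nat) -> abssum (fun n => a (2 * n + 1)%nat) ->
  CSeries a = CSeries (fun n => a (2 * n)%nat) + CSeries (fun n => a (2 * n + 1)%nat).
Proof.
  intros H1 H2 H3. apply Ceq_minus. apply small_eq_0 with 3%R. intros eps He.
  destruct (CSeries_limit _ H1 eps He) as [N1 W1]. destruct (CSeries_limit _ H2 eps He) as [N2 W2].
  destruct (CSeries_limit _ H3 eps He) as [N3 W3].
  set (N := (N1 + N2 + N3)%nat).
  specialize (W1 (2 * N)%nat ltac:(lia)). specialize (W2 N ltac:(lia)). specialize (W3 N ltac:(lia)).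
  assert (E : forall n, csum a (2 * n) = csum (fun n => a (2 * n)%nat) n + csum (fun n => a (2 * n + 1)%nat) n).
  { induction n as [|n IH]; [simpl; ring|]. replace (2 * S n)%nat with (S (S (2 * n))) by lia.
    change (csum a (S (S (2 * n)))) with (csum a (2 * n) + a (2 * n)%nat + a (S (2 * n))%nat). rewrite IH. simpl csum.
    replace (S (2 * n)) with (2 * n + 1)%nat by lia. simpl Nat.mul. ring. }
  rewrite E in W1.
  match goal with |- (Cmod ?z <= _)%R => set (x := CSeries a) in *; set (y := CSeries (fun n => a (2 * n)%nat)) in *; set (w := CSeries (fun n => a (2 * n + 1)%nat)) in * end.
  set (p := csum (fun n => a (2 * n)%nat) N) in *. set (q := csum (fun n => a (2 * n + 1)%nat) N) in *.
  replace (x - (y + w)) with ((x - (p + q)) + - (y - p) + - (w - q)) by ring.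
  eapply Rle_trans; [apply Cmod_triangle|]. eapply Rle_trans; [apply Rplus_le_compat_r, Cmod_triangle|]. rewrite !Cmod_opp. lra.
Qed.

(** * Series indexed by all integers *)

Definition zneg (n : nat) : Z := (- Z.of_nat n - 1)%Z.
Definition exZ (b : Z -> R) : Prop := ex_series (fun n => b (Z.of_nat n)) /\ ex_series (fun n => b (zneg n)).
Definition SeriesZ (b : Z -> R) : R := (Series (fun n => b (Z.of_nat n)) + Series (fun n => b (zneg n)))%R.
Definition absZ (a : Z -> C) : Prop := exZ (fun n => Cmod (a n)).

Lemma absZ_le (a : Z -> C) (b : Z -> R) : (forall n, (Cmod (a n) <= b n)%R) -> exZ b -> absZ a.
Proof.
  intros H [H1 H2]. split.
  - apply (abssum_le (fun n => a (Z.of_nat n)) (fun n => b (Z.of_nat n))); [intros; apply H|exact H1].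
  - apply (abssum_le (fun n => a (zneg n)) (fun n => b (zneg n))); [intros; apply H|exact H2].
Qed.

Lemma exZ_le (a b : Z -> R) : (forall n, (0 <= a n <= b n)%R) -> exZ b -> exZ a.
Proof.
  intros H [H1 H2]. split.
  - apply (ex_series_Rle _ (fun n => b (Z.of_nat n))); [|exact H1]. intros n. rewrite Rabs_pos_eq; apply H.
  - apply (ex_series_Rle _ (fun n => b (zneg n))); [|exact H2]. intros n. rewrite Rabs_pos_eq; apply H.
Qed.

Lemma exZ_scal (c : R) (b : Z -> R) : exZ b -> exZ (fun n => (c * b n)%R).
Proof. intros [H1 H2]. split; apply (ex_Rscal c); assumption. Qed.

Lemma SeriesZ_scal (c : R) (b : Z -> R) : SeriesZ (fun n => (c * b n)%R) = (c * SeriesZ b)%R.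
Proof. unfold SeriesZ. rewrite !Series_scal_l. ring. Qed.

Lemma SeriesZ_nonneg (b : Z -> R) : (forall n, (0 <= b n)%R) -> exZ b -> (0 <= SeriesZ b)%R.
Proof. intros H [H1 H2]. apply Rplus_le_le_0_compat; apply Series_nonneg; auto. Qed.

Lemma absZ_ext (a b : Z -> C) : (forall n, a n = b n) -> absZ a -> absZ b.
Proof. intros H. apply absZ_le. intros n. rewrite H. lra. Qed.

Lemma CSeriesZ_def (a : Z -> C) : CSeriesZ a = CSeries (fun n => a (Z.of_nat n)) + CSeries (fun n => a (zneg n)).
Proof. reflexivity. Qed.

Lemma CSeriesZ_ext (a b : Z -> C) : (forall n, a n = b n) -> CSeriesZ a = CSeriesZ b.
Proof. intros H. rewrite !CSeriesZ_def. f_equal; apply CSeries_ext; intros; apply H. Qed.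
Lemma CSeriesZ_plus (a b : Z -> C) : absZ a -> absZ b -> CSeriesZ (fun n => a n + b n) = CSeriesZ a + CSeriesZ b.
Proof.
  intros [H1 H2] [H3 H4]. rewrite !CSeriesZ_def.
  rewrite (CSeries_plus (fun n => a (Z.of_nat n)) (fun n => b (Z.of_nat n))) by assumption.
  rewrite (CSeries_plus (fun n => a (zneg n)) (fun n => b (zneg n))) by assumption. ring.
Qed.
Lemma CSeriesZ_scal (c : C) (a : Z -> C) : absZ a -> CSeriesZ (fun n => c * a n) = c * CSeriesZ a.
Proof.
  intros [H1 H2]. rewrite !CSeriesZ_def. rewrite (CSeries_scal c (fun n => a (Z.of_nat n))) by assumption.
  rewrite (CSeries_scal c (fun n => a (zneg n))) by assumption. ring.
Qed.

Lemma CSeriesZ_bound (a : Z -> C) (b : Z -> R) : (forall n, (Cmod (a n) <= b n)%R) -> exZ b ->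
  (Cmod (CSeriesZ a) <= SeriesZ b)%R.
Proof.
  intros H [H1 H2]. eapply Rle_trans; [apply Cmod_triangle|]. apply Rplus_le_compat; apply CSeries_bound; auto.
Qed.

(** A single term crosses from one half of the sum to the other. *)
Lemma CSeriesZ_shift1 (a : Z -> C) : absZ a -> absZ (fun n => a (n + 1)%Z) /\ CSeriesZ (fun n => a (n + 1)%Z) = CSeriesZ a.
Proof.
  intros [H1 H2].
  assert (E1 : forall n, a (Z.of_nat (S n)) = a (Z.of_nat n + 1)%Z) by (intros; f_equal; lia).
  assert (E2 : forall n, a (zneg n) = a (zneg (S n) + 1)%Z) by (intros; f_equal; unfold zneg; lia).
  assert (A1 : abssum (fun n => a (Z.of_nat n + 1)%Z)).
  { apply abssum_ext with (1 := E1). apply (abssum_shift _ 1 H1). }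
  assert (A2 : abssum (fun n => a (zneg n + 1)%Z)).
  { apply (ex_series_incr_1 (K := R_AbsRing) (V := R_NormedModule) (fun n => Cmod (a (zneg n + 1)%Z))).
    apply (abssum_ext _ _ E2). exact H2. }
  split; [split; assumption|]. rewrite !CSeriesZ_def.
  rewrite (CSeries_incr_1 (fun n => a (Z.of_nat n))) by exact H1.
  rewrite (CSeries_incr_1 (fun n => a (zneg n + 1)%Z)) by exact A2.
  rewrite (CSeries_ext _ _ E1). rewrite (CSeries_ext _ _ E2). unfold zneg at 1. simpl. ring.
Qed.

Lemma CSeriesZ_shiftm1 (a : Z -> C) : absZ a -> absZ (fun n => a (n - 1)%Z) /\ CSeriesZ (fun n => a (n - 1)%Z) = CSeriesZ a.
Proof.
  intros [H1 H2].
  assert (E1 : forall n, a (zneg (S n)) = a (zneg n - 1)%Z) by (intros; f_equal; unfold zneg; lia).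
  assert (E2 : forall n, a (Z.of_nat n) = a (Z.of_nat (S n) - 1)%Z) by (intros; f_equal; lia).
  assert (A1 : abssum (fun n => a (zneg n - 1)%Z)).
  { apply abssum_ext with (1 := E1). apply (abssum_shift _ 1 H2). }
  assert (A2 : abssum (fun n => a (Z.of_nat n - 1)%Z)).
  { apply (ex_series_incr_1 (K := R_AbsRing) (V := R_NormedModule) (fun n => Cmod (a (Z.of_nat n - 1)%Z))).
    apply (abssum_ext _ _ E2). exact H1. }
  assert (HA : absZ (fun n => a (n - 1)%Z)) by (split; assumption). split; [exact HA|].
  rewrite <- (proj2 (CSeriesZ_shift1 _ HA)). apply CSeriesZ_ext. intros n. f_equal. lia.
Qed.

Lemma CSeriesZ_shift (a : Z -> C) (k : Z) : absZ a -> absZ (fun n => a (n + k)%Z) /\ CSeriesZ (fun n => a (n + k)%Z) = CSeriesZ a.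
Proof.
  intros H. induction k as [|k [IH1 IH2]|k [IH1 IH2]] using Z.peano_ind.
  - split; [apply (absZ_ext a)|apply CSeriesZ_ext]; auto; intros; f_equal; lia.
  - destruct (CSeriesZ_shift1 _ IH1) as [J1 J2]. split.
    + apply (absZ_ext (fun n => a (n + 1 + k)%Z)); [intros; f_equal; lia|exact J1].
    + rewrite <- IH2, <- J2. apply CSeriesZ_ext. intros; f_equal; lia.
  - destruct (CSeriesZ_shiftm1 _ IH1) as [J1 J2]. split.
    + apply (absZ_ext (fun n => a (n - 1 + k)%Z)); [intros; f_equal; lia|exact J1].
    + rewrite <- IH2, <- J2. apply CSeriesZ_ext. intros; f_equal; lia.
Qed.

(** The map n -> -n-1 exchanges the two halves of the sum exactly; every reflection is this one
    combined with a shift. *)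
Lemma CSeriesZ_flip (a : Z -> C) : absZ a -> absZ (fun n => a (- n - 1)%Z) /\ CSeriesZ (fun n => a (- n - 1)%Z) = CSeriesZ a.
Proof.
  intros [H1 H2].
  assert (E : forall n, a (Z.of_nat n) = a (- zneg n - 1)%Z) by (intros; f_equal; unfold zneg; lia).
  split.
  - split; [exact H2|]. apply (abssum_ext _ _ E), H1.
  - rewrite !CSeriesZ_def.
    rewrite <- (CSeries_ext _ _ E). apply Cplus_comm.
Qed.

Lemma CSeriesZ_reflect (a : Z -> C) (k : Z) : absZ a -> absZ (fun n => a (k - n)%Z) /\ CSeriesZ (fun n => a (k - n)%Z) = CSeriesZ a.
Proof.
  intros H. destruct (CSeriesZ_shift a (k + 1) H) as [J1 J2]. destruct (CSeriesZ_flip _ J1) as [J3 J4]. split.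
  - apply (absZ_ext (fun n => a (- n - 1 + (k + 1))%Z)); [intros; f_equal; lia|exact J3].
  - rewrite <- J2, <- J4. apply CSeriesZ_ext. intros; f_equal; lia.
Qed.

Lemma CSeriesZ_even_odd (a : Z -> C) : absZ a -> absZ (fun n => a (2 * n)%Z) -> absZ (fun n => a (2 * n + 1)%Z) ->
  CSeriesZ a = CSeriesZ (fun n => a (2 * n)%Z) + CSeriesZ (fun n => a (2 * n + 1)%Z).
Proof.
  intros [H1 H2] [H3 H4] [H5 H6].
  assert (E1 : forall n : nat, a (2 * Z.of_nat n)%Z = a (Z.of_nat (2 * n))) by (intros; f_equal; lia).
  assert (E2 : forall n : nat, a (2 * Z.of_nat n + 1)%Z = a (Z.of_nat (2 * n + 1))) by (intros; f_equal; lia).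
  assert (E3 : forall n : nat, a (2 * zneg n)%Z = a (zneg (2 * n + 1))) by (intros; f_equal; unfold zneg; lia).
  assert (E4 : forall n : nat, a (2 * zneg n + 1)%Z = a (zneg (2 * n))) by (intros; f_equal; unfold zneg; lia).
  rewrite !CSeriesZ_def.
  rewrite (CSeries_even_odd (fun n => a (Z.of_nat n))); [|exact H1|apply (abssum_ext _ _ E1), H3|apply (abssum_ext _ _ E2), H5].
  rewrite (CSeries_even_odd (fun n => a (zneg n))); [|exact H2|apply (abssum_ext _ _ E4), H6|apply (abssum_ext _ _ E3), H4].
  rewrite <- (CSeries_ext _ _ E1), <- (CSeries_ext _ _ E2), <- (CSeries_ext _ _ E3), <- (CSeries_ext _ _ E4).
  ring.
Qed.

Lemma CSeriesZ_Fubini (f : Z -> Z -> C) (A B : Z -> R) :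
  (forall m n, (Cmod (f m n) <= A m * B n)%R) -> (forall m, (0 <= A m)%R) -> (forall n, (0 <= B n)%R) ->
  exZ A -> exZ B ->
  CSeriesZ (fun m => CSeriesZ (f m)) = CSeriesZ (fun n => CSeriesZ (fun m => f m n)).
Proof.
  intros H HA HB [A1 A2] [B1 B2].
  assert (F : forall u v : nat -> Z, ex_series (fun m => A (u m)) -> ex_series (fun n => B (v n)) ->
    CSeries (fun m => CSeries (fun n => f (u m) (v n))) = CSeries (fun n => CSeries (fun m => f (u m) (v n)))).
  { intros u v Hu Hv. apply (CSeries_Fubini (fun m n => f (u m) (v n)) (fun m => A (u m)) (fun n => B (v n))); auto. }
  assert (Am : forall u v : nat -> Z, ex_series (fun m => A (u m)) -> ex_series (fun n => B (v n)) ->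
    abssum (fun m => CSeries (fun n => f (u m) (v n)))).
  { intros u v Hu Hv. apply abssum_le with (fun m => (Series (fun n => B (v n)) * A (u m))%R); [|apply (ex_Rscal _ (fun m => A (u m))), Hu].
    intros m. rewrite Rmult_comm, <- Series_scal_l. apply CSeries_bound; [intros; apply H|]. apply (ex_Rscal _ (fun n => B (v n))), Hv. }
  assert (An : forall u v : nat -> Z, ex_series (fun m => A (u m)) -> ex_series (fun n => B (v n)) ->
    abssum (fun n => CSeries (fun m => f (u m) (v n)))).
  { intros u v Hu Hv. apply abssum_le with (fun n => (Series (fun m => A (u m)) * B (v n))%R); [|apply (ex_Rscal _ (fun n => B (v n))), Hv].
    intros n. rewrite Rmult_comm, <- Series_scal_l. apply CSeries_bound; [intros; rewrite Rmult_comm; apply H|]. apply (ex_Rscal _ (fun m => A (u m))), Hu. }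
  rewrite !CSeriesZ_def.
  transitivity (CSeries (fun m => CSeries (fun n => f (Z.of_nat m) (Z.of_nat n)) + CSeries (fun n => f (Z.of_nat m) (zneg n))) +
                CSeries (fun m => CSeries (fun n => f (zneg m) (Z.of_nat n)) + CSeries (fun n => f (zneg m) (zneg n)))); [reflexivity|].
  transitivity (CSeries (fun n => CSeries (fun m => f (Z.of_nat m) (Z.of_nat n)) + CSeries (fun m => f (zneg m) (Z.of_nat n))) +
                CSeries (fun n => CSeries (fun m => f (Z.of_nat m) (zneg n)) + CSeries (fun m => f (zneg m) (zneg n)))); [|reflexivity].
  rewrite !CSeries_plus by auto.
  rewrite !F by assumption. ring.
Qed.

(** A first-order expansion with explicit radius d and quadratic constant K. Over a series such
    bounds add up as soon as the constants are summable, which justifies termwise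
    differentiation. *)
Definition qexp (f : C -> C) (z l : C) (d K : R) : Prop :=
  forall h : C, (Cmod h < d)%R -> (Cmod (f (z + h)%C - f z - l * h) <= K * (Cmod h * Cmod h))%R.

Lemma qexp_cderiv (f : C -> C) (z l : C) (d K : R) : (0 < d)%R -> qexp f z l d K -> cderiv f z l.
Proof.
  intros Hd H eps He. assert (HK := Rabs_pos K).
  exists (Rmin d (eps / (Rabs K + 1))). split. { apply Rmin_glb_lt; [exact Hd|]. apply Rdiv_lt_0_compat; lra. }
  intros w Hw. assert (H1 := Rlt_le_trans _ _ _ Hw (Rmin_l _ _)). assert (H2 := Rlt_le_trans _ _ _ Hw (Rmin_r _ _)).
  specialize (H (w - z) H1). replace (z + (w - z)) with w in H by ring. eapply Rle_trans; [exact H|].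
  rewrite <- Rmult_assoc. apply Rmult_le_compat_r; [apply Cmod_ge_0|].
  apply Rlt_div_r in H2; [|lra]. generalize (Cmod_ge_0 (w - z)) (Rle_abs K). nra.
Qed.

Lemma CSeries_qexp (f : nat -> C -> C) (z : C) (l : nat -> C) (d : R) (K : nat -> R) :
  (forall n, qexp (f n) z (l n) d (K n)) -> ex_series K -> abssum (fun n => f n z) -> abssum l ->
  (forall h, (Cmod h < d)%R -> abssum (fun n => f n (z + h))) /\
  qexp (fun z => CSeries (fun n => f n z)) z (CSeries l) d (Series K).
Proof.
  intros H HK Hf Hl.
  assert (B : forall h, (Cmod h < d)%R -> abssum (fun n => f n (z + h) - f n z - l n * h)).
  { intros h Hh. apply abssum_le with (fun n => (Cmod h * Cmod h * K n)%R); [|apply (ex_Rscal _ K HK)].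
    intros n. rewrite Rmult_comm. apply H, Hh. }
  assert (B' : forall h, (Cmod h < d)%R -> abssum (fun n => f n (z + h))).
  { intros h Hh. apply abssum_ext with (fun n => (f n (z + h) - f n z - l n * h) + (f n z + h * l n)); [intros; ring|].
    apply abssum_plus; [apply B, Hh|]. apply abssum_plus; [exact Hf|apply abssum_scal, Hl]. }
  split; [exact B'|]. intros h Hh. cbv beta.
  replace (CSeries (fun n => f n (z + h)) - CSeries (fun n => f n z) - CSeries l * h) with (CSeries (fun n => f n (z + h) - f n z - l n * h)).
  - rewrite Rmult_comm, <- Series_scal_l. apply CSeries_bound; [|apply (ex_Rscal _ K HK)]. intros n. rewrite Rmult_comm. apply H, Hh.
  - rewrite (CSeries_ext _ (fun n => f n (z + h) + (- (1)) * (f n z + h * l n))) by (intros; ring).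
    rewrite CSeries_plus, CSeries_scal, CSeries_plus, CSeries_scal; auto using abssum_scal, abssum_plus. ring.
Qed.

Lemma CSeriesZ_qexp (f : Z -> C -> C) (z : C) (l : Z -> C) (d : R) (K : Z -> R) :
  (forall n, qexp (f n) z (l n) d (K n)) -> exZ K -> absZ (fun n => f n z) -> absZ l ->
  qexp (fun z => CSeriesZ (fun n => f n z)) z (CSeriesZ l) d (SeriesZ K).
Proof.
  intros H [K1 K2] [F1 F2] [L1 L2].
  assert (Q1 := CSeries_qexp (fun n => f (Z.of_nat n)) z (fun n => l (Z.of_nat n)) d (fun n => K (Z.of_nat n)) (fun n => H _) K1 F1 L1).
  assert (Q2 := CSeries_qexp (fun n => f (zneg n)) z (fun n => l (zneg n)) d (fun n => K (zneg n)) (fun n => H _) K2 F2 L2).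
  destruct Q1 as [_ Q1]. destruct Q2 as [_ Q2].
  intros h Hh. specialize (Q1 h Hh). specialize (Q2 h Hh). cbv beta in *.
  rewrite !CSeriesZ_def. unfold SeriesZ.
  match goal with |- (Cmod ?x <= _)%R => match type of Q1 with (Cmod ?y <= _)%R => match type of Q2 with (Cmod ?w <= _)%R =>
    replace x with (y + w) by ring end end end.
  eapply Rle_trans; [apply Cmod_triangle|]. lra.
Qed.

(** * Exponential and Gaussian sums *)

Lemma cexp_plus (z w : C) : cexp (z + w) = cexp z * cexp w.
Proof.
  unfold cexp. rewrite re_plus, im_plus, exp_plus, cos_plus, sin_plus. unfold Cmult. simpl. f_equal; ring.
Qed.
Lemma cexp_0 : cexp 0 = 1.
Proof. unfold cexp. simpl. rewrite exp_0, cos_0, sin_0. unfold RtoC. f_equal; ring. Qed.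
Lemma Cmod_cexp (z : C) : Cmod (cexp z) = exp (Re z).
Proof.
  unfold cexp. set (x := Re z). set (y := Im z).
  replace ((exp x * cos y)%R, (exp x * sin y)%R) with (RtoC (exp x) * (cos y, sin y)) by (unfold RtoC, Cmult; simpl; f_equal; ring).
  rewrite Cmod_mult, Cmod_R, Rabs_pos_eq by (left; apply exp_pos).
  unfold Cmod. simpl. rewrite !Rmult_1_r. generalize (sin2_cos2 y). unfold Rsqr. intros H.
  replace (cos y * cos y + sin y * sin y)%R with 1%R by lra. rewrite sqrt_1. ring.
Qed.
Lemma cexp_neq_0 (z : C) : cexp z <> 0.
Proof. apply Cmod_gt_0. rewrite Cmod_cexp. apply exp_pos. Qed.

Lemma exp_le_compat (x y : R) : (x <= y)%R -> (exp x <= exp y)%R.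
Proof. intros [H| ->]; [left; apply exp_increasing, H|right; reflexivity]. Qed.
Lemma exp_minus_1 (x : R) : (Rabs (exp x - 1) <= Rabs x * exp (Rabs x))%R.
Proof.
  destruct (MVT_gen exp 0 x exp) as [c [Hc E]].
  - intros; apply is_derive_Reals, derivable_pt_lim_exp.
  - intros; apply derivable_continuous_pt, derivable_pt_exp.
  - rewrite exp_0, Rminus_0_r in E. rewrite E, Rabs_mult, Rmult_comm. apply Rmult_le_compat_l; [apply Rabs_pos|].
    rewrite Rabs_pos_eq by (left; apply exp_pos). apply exp_le_compat. revert Hc. unfold Rmin, Rmax, Rabs. repeat destruct Rle_dec; destruct Rcase_abs; lra.
Qed.
Lemma exp_minus_1_x (x : R) : (Rabs (exp x - 1 - x) <= x * x * exp (Rabs x))%R.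
Proof.
  destruct (MVT_gen (fun x => exp x - x)%R 0 x (fun x => exp x - 1)%R) as [c [Hc E]].
  - intros; auto_derive; [auto|ring].
  - intros; apply continuity_pt_filterlim. apply (ex_derive_continuous (fun x => exp x - x)%R). auto_derive. auto.
  - rewrite exp_0, Rminus_0_r in E. replace (exp x - 1 - x)%R with ((exp c - 1) * x)%R by lra.
    assert (Hcx : (Rabs c <= Rabs x)%R). { revert Hc. unfold Rmin, Rmax, Rabs. repeat destruct Rle_dec; repeat destruct Rcase_abs; lra. }
    rewrite Rabs_mult. replace (x * x)%R with (Rabs x * Rabs x)%R by (rewrite <- Rabs_mult; apply Rabs_pos_eq; nra).
    apply Rle_trans with (Rabs c * exp (Rabs c) * Rabs x)%R; [apply Rmult_le_compat_r; [apply Rabs_pos|apply exp_minus_1]|].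
    assert (exp (Rabs c) <= exp (Rabs x))%R by (apply exp_le_compat, Hcx).
    generalize (Rabs_pos c) (Rabs_pos x) (exp_pos (Rabs c)). intros.
    rewrite Rmult_comm, Rmult_assoc. apply Rmult_le_compat_l; [lra|]. apply Rmult_le_compat; lra.
Qed.
Lemma sin_abs_le (y : R) : (Rabs (sin y) <= Rabs y)%R.
Proof.
  destruct (MVT_gen sin 0 y cos) as [c [Hc E]].
  - intros; apply is_derive_Reals, derivable_pt_lim_sin.
  - intros; apply derivable_continuous_pt, derivable_pt_sin.
  - rewrite sin_0, !Rminus_0_r in E. rewrite E, Rabs_mult.
    assert (Rabs (cos c) <= 1)%R by (apply Rabs_le_between, COS_bound). generalize (Rabs_pos y). nra.
Qed.
Lemma cos_minus_1 (y : R) : (Rabs (cos y - 1) <= Rabs y * Rabs y)%R /\ (Rabs (cos y - 1) <= Rabs y)%R.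
Proof.
  destruct (MVT_gen cos 0 y (fun x => - sin x)%R) as [c [Hc E]].
  - intros; apply is_derive_Reals, derivable_pt_lim_cos.
  - intros; apply derivable_continuous_pt, derivable_pt_cos.
  - rewrite cos_0, !Rminus_0_r in E. rewrite E, Rabs_mult, Rabs_Ropp.
    assert (Hcx : (Rabs c <= Rabs y)%R). { revert Hc. unfold Rmin, Rmax, Rabs. repeat destruct Rle_dec; repeat destruct Rcase_abs; lra. }
    generalize (sin_abs_le c) (Rabs_pos y) (Rabs_pos (sin c)). intros.
    assert (Rabs (sin c) <= 1)%R by (apply Rabs_le_between, SIN_bound). split; nra.
Qed.
Lemma sin_minus_x (y : R) : (Rabs (sin y - y) <= Rabs y * Rabs y)%R.
Proof.
  destruct (MVT_gen (fun x => sin x - x)%R 0 y (fun x => cos x - 1)%R) as [c [Hc E]].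
  - intros; auto_derive; [auto|ring].
  - intros; apply continuity_pt_filterlim. apply (ex_derive_continuous (fun x => sin x - x)%R). auto_derive. auto.
  - rewrite sin_0, !Rminus_0_r in E. rewrite E, Rabs_mult.
    assert (Hcx : (Rabs c <= Rabs y)%R). { revert Hc. unfold Rmin, Rmax, Rabs. repeat destruct Rle_dec; repeat destruct Rcase_abs; lra. }
    generalize (proj2 (cos_minus_1 c)) (Rabs_pos y). intros. nra.
Qed.

Lemma cexp_remainder (h : C) : (Cmod (cexp h - 1 - h) <= 3 * (Cmod h * Cmod h) * exp (Cmod h))%R.
Proof.
  destruct h as [x y]. eapply Rle_trans; [apply Cmod_le_ReIm|].
  set (m := Cmod (x, y)).
  assert (Hm : (m * m = x * x + y * y)%R) by (unfold m; rewrite Cmod_sqr; reflexivity).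
  assert (Hx : (Rabs x <= m)%R) by (apply (re_le_Cmod (x, y))).
  assert (Hy : (Rabs y <= m)%R) by (apply (Im_le_Cmod (x, y))).
  assert (He : (exp (Rabs x) <= exp m)%R) by (apply exp_le_compat, Hx).
  assert (He' : (exp x <= exp m)%R) by (apply exp_le_compat; generalize (Rle_abs x); lra).
  assert (Hp := exp_pos m). assert (Hpx := exp_pos x).
  assert (Hxx : (Rabs x * Rabs x = x * x)%R) by (rewrite <- Rabs_mult; apply Rabs_pos_eq; nra).
  assert (Hyy : (Rabs y * Rabs y = y * y)%R) by (rewrite <- Rabs_mult; apply Rabs_pos_eq; nra).
  assert (HR : (Rabs (Re (cexp (x, y) - 1 - (x, y))) <= (x * x + y * y) * exp m)%R).
  { simpl. replace (exp x * cos y + - (1) + - x)%R with ((exp x - 1 - x) + exp x * (cos y - 1))%R by ring.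
    eapply Rle_trans; [apply Rabs_triang|]. rewrite Rabs_mult, (Rabs_pos_eq (exp x)) by lra.
    generalize (exp_minus_1_x x) (proj1 (cos_minus_1 y)). rewrite Hyy. intros.
    assert (x * x * exp (Rabs x) <= x * x * exp m)%R by (apply Rmult_le_compat_l; nra).
    assert (exp x * Rabs (cos y - 1) <= exp m * (y * y))%R by (apply Rmult_le_compat; auto; try lra; apply Rabs_pos). lra. }
  assert (HI : (Rabs (Im (cexp (x, y) - 1 - (x, y))) <= (Rabs x * Rabs y + y * y) * exp m)%R).
  { simpl. replace (exp x * sin y + - 0 + - y)%R with (y * (exp x - 1) + exp x * (sin y - y))%R by ring.
    eapply Rle_trans; [apply Rabs_triang|]. rewrite !Rabs_mult, (Rabs_pos_eq (exp x)) by lra.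
    generalize (exp_minus_1 x) (sin_minus_x y) (Rabs_pos x) (Rabs_pos y). rewrite Hyy. intros.
    assert (Rabs y * Rabs (exp x - 1) <= Rabs y * (Rabs x * exp m))%R.
    { apply Rmult_le_compat_l; [lra|]. eapply Rle_trans; [apply exp_minus_1|]. apply Rmult_le_compat_l; lra. }
    assert (exp x * Rabs (sin y - y) <= exp m * (y * y))%R by (apply Rmult_le_compat; auto; try lra; apply Rabs_pos). lra. }
  rewrite Hm. assert (Rabs x * Rabs y <= x * x + y * y)%R.
  { rewrite <- Hxx, <- Hyy. generalize (Rle_0_sqr (Rabs x - Rabs y)) (Rabs_pos x) (Rabs_pos y). unfold Rsqr. nra. }
  nra.
Qed.

Lemma cexp_qexp (c tau : C) (d : R) : (0 < d)%R ->
  qexp (fun t => cexp (c * t)) tau (c * cexp (c * tau)) d (3 * (Cmod c * Cmod c) * exp (Re (c * tau) + Cmod c * d))%R.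
Proof.
  intros Hd h Hh.
  replace (cexp (c * (tau + h)) - cexp (c * tau) - c * cexp (c * tau) * h) with (cexp (c * tau) * (cexp (c * h) - 1 - c * h)).
  2: { replace (c * (tau + h)) with (c * tau + c * h) by ring. rewrite cexp_plus. ring. }
  rewrite Cmod_mult, Cmod_cexp, exp_plus.
  eapply Rle_trans; [apply Rmult_le_compat_l; [left; apply exp_pos|apply cexp_remainder]|].
  rewrite Cmod_mult.
  assert (H : (exp (Cmod c * Cmod h) <= exp (Cmod c * d))%R).
  { apply exp_le_compat, Rmult_le_compat_l; [apply Cmod_ge_0|lra]. }
  assert (H1 := exp_pos (Re (c * tau))). assert (H2 := Cmod_ge_0 c). assert (H3 := Cmod_ge_0 h).
  set (is_origin_or := exp (Re (c * tau))) in *. set (e2 := exp (Cmod c * Cmod h)) in *. set (e3 := exp (Cmod c * d)) in *.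
  replace (3 * (Cmod c * Cmod c) * (is_origin_or * e3) * (Cmod h * Cmod h))%R with (is_origin_or * (3 * (Cmod c * Cmod h * (Cmod c * Cmod h))) * e3)%R by ring.
  replace (is_origin_or * (3 * (Cmod c * Cmod h * (Cmod c * Cmod h)) * e2))%R with (is_origin_or * (3 * (Cmod c * Cmod h * (Cmod c * Cmod h))) * e2)%R by ring.
  apply Rmult_le_compat_l; [|exact H]. apply Rmult_le_pos; [lra|]. assert (0 <= Cmod c * Cmod h)%R by (apply Rmult_le_pos; lra). nra.
Qed.

Lemma cderiv_cexp_lin (c tau : C) : cderiv (fun t => cexp (c * t)) tau (c * cexp (c * tau)).
Proof. apply (qexp_cderiv _ _ _ 1%R) with (2 := cexp_qexp c tau 1%R Rlt_0_1). lra. Qed.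

(** Each factor 1 + x is absorbed by half of the exponential: 1 + x <= (1 + 2/s) exp (s x / 2). *)
Lemma pow_exp_bound (p : nat) (s : R) : (0 < s)%R -> exists K, (0 < K)%R /\ forall x, (0 <= x)%R -> ((1 + x) ^ p * exp (- s * x) <= K)%R.
Proof.
  intros Hs. induction p as [|p IH] in s, Hs |- *.
  - exists 1%R. split; [lra|]. intros x Hx. simpl. rewrite Rmult_1_l, <- exp_0. apply exp_le_compat. nra.
  - destruct (IH (s / 2)%R ltac:(lra)) as [K [HK H]]. exists ((1 + 2 / s) * K)%R.
    assert (H2s : (0 < 2 / s)%R) by (apply Rdiv_lt_0_compat; lra).
    split; [apply Rmult_lt_0_compat; lra|]. intros x Hx. specialize (H x Hx).
    replace (- s * x)%R with (- (s / 2) * x + - (s / 2 * x))%R by field. rewrite exp_plus. simpl.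
    replace ((1 + x) * (1 + x) ^ p * (exp (- (s / 2) * x) * exp (- (s / 2 * x))))%R with ((1 + x) * exp (- (s / 2 * x)) * ((1 + x) ^ p * exp (- (s / 2) * x)))%R by ring.
    assert (P1 : (0 <= (1 + x) ^ p * exp (- (s / 2) * x))%R) by (apply Rmult_le_pos; [apply pow_le; lra|left; apply exp_pos]).
    apply Rmult_le_compat; try lra. { apply Rmult_le_pos; [lra|left; apply exp_pos]. }
    assert (Hex : (1 + s / 2 * x <= exp (s / 2 * x))%R) by (apply exp_ineq1_le).
    rewrite exp_Ropp. apply Rle_div_l; [apply exp_pos|].
    apply Rle_trans with ((1 + 2 / s) * (1 + s / 2 * x))%R; [|apply Rmult_le_compat_l; lra].
    replace ((1 + 2 / s) * (1 + s / 2 * x))%R with (1 + x + 2 / s + s / 2 * x)%R by (field; lra). nra.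
Qed.

(** * Gaussian sums and their derivatives *)

Definition sq (k : Z) : R := (IZR k * IZR k)%R.
Lemma sq_nonneg (k : Z) : (0 <= sq k)%R.
Proof. unfold sq. nra. Qed.

(** After a shift, comparison with the telescoping series of 2/(n+1) - 2/(n+2). *)
Lemma ex_series_inv_sq : ex_series (fun n => / (1 + INR n * INR n))%R.
Proof.
  apply (ex_series_incr_1 (K := R_AbsRing) (V := R_NormedModule)).
  apply ex_series_Rle with (fun n => (/ (INR n + 1) - / (INR n + 2))%R * 2)%R.
  - intros n. rewrite S_INR. assert (Hn := pos_INR n). rewrite Rabs_pos_eq.
    + replace ((/ (INR n + 1) - / (INR n + 2)) * 2)%R with (/ ((INR n + 1) * (INR n + 2) / 2))%R by (field; lra).
      apply Rinv_le_contravar; nra.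
    + left. apply Rinv_0_lt_compat. nra.
  - exists 2%R. change (is_lim_seq (sum_n (fun n => (/ (INR n + 1) - / (INR n + 2))%R * 2)%R) 2%R).
    apply (is_lim_seq_ext (fun n => 2 * (1 - / (INR n + 2)))%R).
    + intros n. induction n as [|n IH].
      * rewrite sum_O. simpl. field.
      * rewrite sum_Sn, <- IH. rewrite S_INR. change plus with Rplus. assert (Hn := pos_INR n). field. lra.
    + replace (Finite 2) with (Rbar_mult 2 (Rbar_minus 1 0)) by (simpl; f_equal; ring).
      apply is_lim_seq_scal_l. apply is_lim_seq_minus'; [apply is_lim_seq_const|].
      apply (is_lim_seq_inv (fun n => INR n + 2)%R p_infty); [|discriminate].
      apply (is_lim_seq_plus _ _ p_infty 2); [apply is_lim_seq_INR|apply is_lim_seq_const|]. reflexivity.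
Qed.

Lemma exZ_inv_sq : exZ (fun k => / (1 + sq k))%R.
Proof.
  split.
  - apply (ex_series_ext (fun n => / (1 + INR n * INR n))%R); [|apply ex_series_inv_sq].
    intros n. unfold sq. rewrite <- INR_IZR_INZ. reflexivity.
  - apply (ex_series_Rle _ (fun n => / (1 + INR n * INR n))%R); [|apply ex_series_inv_sq].
    intros n. unfold sq, zneg. rewrite minus_IZR, opp_IZR, <- INR_IZR_INZ. assert (Hn := pos_INR n).
    replace ((- INR n - 1) * (- INR n - 1))%R with (INR n * INR n + 2 * INR n + 1)%R by ring.
    assert (Hq : (0 <= INR n * INR n)%R) by (apply Rmult_le_pos; lra).
    rewrite Rabs_pos_eq. { apply Rinv_le_contravar; lra. } left. apply Rinv_0_lt_compat. lra.
Qed.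

Lemma exZ_poly_gauss (p : nat) (s : R) : (0 < s)%R -> exZ (fun k => (1 + sq k) ^ p * exp (- s * sq k))%R.
Proof.
  intros Hs. destruct (pow_exp_bound (S p) s Hs) as [K [HK H]].
  apply exZ_le with (fun k => K * / (1 + sq k))%R; [|apply exZ_scal, exZ_inv_sq].
  intros k. assert (Hk := sq_nonneg k). split; [apply Rmult_le_pos; [apply pow_le; lra|left; apply exp_pos]|].
  specialize (H (sq k) Hk). simpl in H. apply Rmult_le_reg_r with (1 + sq k)%R; [lra|].
  rewrite (Rmult_assoc K), Rinv_l, Rmult_1_r by lra. eapply Rle_trans; [|exact H]. right. ring.
Qed.

Lemma exZ_gauss (s : R) : (0 < s)%R -> exZ (fun k => exp (- s * sq k))%R.
Proof.
  intros Hs. apply exZ_le with (2 := exZ_poly_gauss 0 s Hs). intros k. simpl. rewrite Rmult_1_l. split; [left; apply exp_pos|lra].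
Qed.

Definition exp_series (c : Z -> C) (a : Z -> R) (tau : C) : C := CSeriesZ (fun k => c k * cexp (a k * PI * Ci * tau)).
(** The constants are loose enough for the three exponents that occur: k^2, k^2 + k and (k+1)^2. *)
Definition quad_growth (a : Z -> R) : Prop := forall k, (0 <= a k)%R /\ (sq k - 4 <= 4 * a k)%R /\ (a k <= 2 * (1 + sq k))%R.
(** For exponents of quadratic growth this class is stable under multiplication by pi i a(k), that
    is, under differentiation of the series in tau. *)
Definition poly_growth (c : Z -> C) : Prop := exists M p, (0 <= M)%R /\ forall k, (Cmod (c k) <= M * (1 + sq k) ^ p)%R.

Lemma Re_arg (a : R) (tau : C) : Re (a * PI * Ci * tau) = (- (PI * a * Im tau))%R.
Proof. destruct tau as [x y]. simpl. ring. Qed.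
Lemma Cmod_arg (a : R) : (0 <= a)%R -> Cmod (a * PI * Ci) = (PI * a)%R.
Proof. intros Ha. rewrite !Cmod_mult, Cmod_Ci, !Cmod_R, !Rabs_pos_eq; [ring| |exact Ha]. generalize PI_RGT_0; lra. Qed.

Lemma Cmod_gs_term (c : Z -> C) (a : Z -> R) (k : Z) (tau : C) :
  Cmod (c k * cexp (a k * PI * Ci * tau)) = (Cmod (c k) * exp (- (PI * a k * Im tau)))%R.
Proof. rewrite Cmod_mult, Cmod_cexp, Re_arg. reflexivity. Qed.

Lemma gauss_bound (c : Z -> C) (a : Z -> R) : quad_growth a -> poly_growth c -> forall y, (0 < y)%R ->
  exZ (fun k => Cmod (c k) * exp (- (PI * a k * y)))%R.
Proof.
  intros Ha [M [p [HM Hc]]] y Hy. assert (HP := PI_RGT_0).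
  apply exZ_le with (fun k => (M * exp (PI * y)) * ((1 + sq k) ^ p * exp (- (PI * y / 4) * sq k)))%R.
  2: { apply exZ_scal, exZ_poly_gauss. apply Rdiv_lt_0_compat; [apply Rmult_lt_0_compat; lra|lra]. }
  intros k. split; [apply Rmult_le_pos; [apply Cmod_ge_0|left; apply exp_pos]|].
  replace (M * exp (PI * y) * ((1 + sq k) ^ p * exp (- (PI * y / 4) * sq k)))%R with ((M * (1 + sq k) ^ p) * (exp (PI * y) * exp (- (PI * y / 4) * sq k)))%R by ring.
  rewrite <- exp_plus. apply Rmult_le_compat; [apply Cmod_ge_0|left; apply exp_pos|apply Hc|].
  apply exp_le_compat. destruct (Ha k) as [H0 [H1 H2]].
  assert (0 < PI * y)%R by (apply Rmult_lt_0_compat; lra). nra.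
Qed.

Lemma gs_absZ (c : Z -> C) (a : Z -> R) (tau : C) : quad_growth a -> poly_growth c -> (0 < Im tau)%R ->
  absZ (fun k => c k * cexp (a k * PI * Ci * tau)).
Proof.
  intros Ha Hc Ht. apply absZ_le with (2 := gauss_bound c a Ha Hc (Im tau) Ht). intros k. rewrite Cmod_gs_term. lra.
Qed.

Lemma poly_growth_mult (c : Z -> C) (a : Z -> R) : quad_growth a -> poly_growth c -> poly_growth (fun k => a k * PI * Ci * c k).
Proof.
  intros Ha [M [p [HM H]]]. exists (2 * PI * M)%R, (S p). assert (HP := PI_RGT_0). split; [nra|].
  intros k. destruct (Ha k) as [H0 [_ H2]]. rewrite Cmod_mult, Cmod_arg by exact H0. simpl.
  replace (2 * PI * M * ((1 + sq k) * (1 + sq k) ^ p))%R with ((PI * (2 * (1 + sq k))) * (M * (1 + sq k) ^ p))%R by ring.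
  apply Rmult_le_compat; [nra|apply Cmod_ge_0|nra|apply H].
Qed.

Lemma gs_cderiv (c : Z -> C) (a : Z -> R) (tau : C) : quad_growth a -> poly_growth c -> (0 < Im tau)%R ->
  cderiv (exp_series c a) tau (exp_series (fun k => a k * PI * Ci * c k) a tau).
Proof.
  intros Ha Hc Ht. assert (HP := PI_RGT_0). set (y := Im tau) in *.
  assert (Hc1 := poly_growth_mult c a Ha Hc). assert (Hc2 := poly_growth_mult _ a Ha Hc1).
  (* The radius is half the height: the remainder constants are then controlled by the series at
     height y/2, which still converges. *)
  apply (qexp_cderiv _ _ _ (y / 2)%R (SeriesZ (fun k => 3 * (Cmod (a k * PI * Ci * (a k * PI * Ci * c k)) * exp (- (PI * a k * (y / 2))))))%R); [lra|].
  apply (CSeriesZ_qexp (fun k t => c k * cexp (a k * PI * Ci * t))).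
  - intros k h Hh. assert (H := cexp_qexp (a k * PI * Ci) tau (y / 2)%R ltac:(lra) h Hh). cbv beta in H.
    replace (c k * cexp (a k * PI * Ci * (tau + h)) - c k * cexp (a k * PI * Ci * tau) - a k * PI * Ci * c k * cexp (a k * PI * Ci * tau) * h)
      with (c k * (cexp (a k * PI * Ci * (tau + h)) - cexp (a k * PI * Ci * tau) - a k * PI * Ci * cexp (a k * PI * Ci * tau) * h)) by ring.
    rewrite Cmod_mult. eapply Rle_trans; [apply Rmult_le_compat_l; [apply Cmod_ge_0|exact H]|].
    destruct (Ha k) as [H0 _]. rewrite Re_arg, !(Cmod_mult (a k * PI * Ci)), Cmod_arg by exact H0. fold y.
    replace (- (PI * a k * y) + PI * a k * (y / 2))%R with (- (PI * a k * (y / 2)))%R by field. apply Req_le. ring.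
  - apply exZ_scal. apply gauss_bound; [exact Ha|exact Hc2|lra].
  - apply gs_absZ; assumption.
  - apply gs_absZ; assumption.
Qed.

(** For a >= 1 and y >= 1 the inequality (a - 1) (y - 1) >= 0 gives exp (- pi a y) <= exp pi * exp
    (- pi y) * exp (- pi a), so the sum at height 1 serves for all heights. *)
Lemma gs_decay (c : Z -> C) (a : Z -> R) : quad_growth a -> poly_growth c -> (forall k, c k = 0 \/ (1 <= a k)%R) ->
  exists K, (0 <= K)%R /\ forall tau, (1 <= Im tau)%R -> (Cmod (exp_series c a tau) <= K * exp (- (PI * Im tau)))%R.
Proof.
  intros Ha Hc Hca. assert (HP := PI_RGT_0). assert (HB := gauss_bound c a Ha Hc 1%R Rlt_0_1).
  exists (exp PI * SeriesZ (fun k => Cmod (c k) * exp (- (PI * a k * 1))))%R. split.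
  { apply Rmult_le_pos; [left; apply exp_pos|]. apply SeriesZ_nonneg; [|exact HB]. intros k. apply Rmult_le_pos; [apply Cmod_ge_0|left; apply exp_pos]. }
  intros tau Ht. rewrite (Rmult_comm (exp PI)), Rmult_assoc, Rmult_comm, <- SeriesZ_scal.
  apply CSeriesZ_bound; [|apply exZ_scal, HB].
  intros k. rewrite Cmod_gs_term. destruct (Hca k) as [->|H1]; [rewrite Cmod_0; lra|].
  replace (exp PI * exp (- (PI * Im tau)) * (Cmod (c k) * exp (- (PI * a k * 1))))%R with (Cmod (c k) * (exp PI * exp (- (PI * Im tau)) * exp (- (PI * a k * 1))))%R by ring.
  apply Rmult_le_compat_l; [apply Cmod_ge_0|]. rewrite <- !exp_plus. apply exp_le_compat.
  assert (0 <= (a k - 1) * (Im tau - 1))%R by (apply Rmult_le_pos; lra).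
  assert (0 <= PI * ((a k - 1) * (Im tau - 1)))%R by (apply Rmult_le_pos; lra). lra.
Qed.

Lemma CSeries_zero (a : nat -> C) : (forall n, a n = 0) -> CSeries a = 0.
Proof.
  intros H. rewrite (CSeries_ext a (fun n => 0 * (fun _ => 0) n)) by (intros; rewrite H; ring).
  unfold CSeries. apply C_eq; simpl.
  - rewrite (Series_ext _ (fun n => 0 * 0)%R) by (intros; ring). rewrite (Series_scal_l 0 (fun _ => 0%R)). ring.
  - rewrite (Series_ext _ (fun n => 0 * 0)%R) by (intros; ring). rewrite (Series_scal_l 0 (fun _ => 0%R)). ring.
Qed.

Lemma ex_series_zero_tail (a : nat -> R) : (forall n, a (S n) = 0%R) -> ex_series a.
Proof.
  intros H. apply (ex_series_incr_1 (K := R_AbsRing) (V := R_NormedModule)).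
  apply ex_series_Rle with (fun n => 0 * / (1 + INR n * INR n))%R; [|apply ex_Rscal, ex_series_inv_sq].
  intros n. rewrite H, Rabs_R0. lra.
Qed.

Definition deltaZ (j : Z) (v : C) (k : Z) : C := if (k =? j)%Z then v else 0.

Lemma CSeriesZ_delta (j : Z) (v : C) : absZ (deltaZ j v) /\ CSeriesZ (deltaZ j v) = v.
Proof.
  assert (E1 : forall n, deltaZ 0 v (Z.of_nat (S n)) = 0). { intros n. unfold deltaZ. destruct (Z.eqb_spec (Z.of_nat (S n)) 0); [lia|reflexivity]. }
  assert (E2 : forall n, deltaZ 0 v (zneg n) = 0). { intros n. unfold deltaZ. destruct (Z.eqb_spec (zneg n) 0); [unfold zneg in *; lia|reflexivity]. }
  assert (A0 : absZ (deltaZ 0 v)).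
  { split; apply ex_series_zero_tail; intros n; [rewrite E1|rewrite E2]; apply Cmod_0. }
  assert (S0 : CSeriesZ (deltaZ 0 v) = v).
  { rewrite CSeriesZ_def, CSeries_incr_1 by apply A0. rewrite (CSeries_zero _ E1), (CSeries_zero _ E2). unfold deltaZ. simpl. ring. }
  destruct (CSeriesZ_shift (deltaZ 0 v) (- j) A0) as [J1 J2].
  assert (E : forall k, deltaZ 0 v (k + - j) = deltaZ j v k).
  { intros k. unfold deltaZ. destruct (Z.eqb_spec (k + - j) 0), (Z.eqb_spec k j); reflexivity || lia. }
  split; [exact (absZ_ext _ _ E J1)|]. rewrite <- (CSeriesZ_ext _ _ E), J2. exact S0.
Qed.

(** * Landen's relations *)

(** A domination that survives invertible affine changes of the index pair, up to its constants, and
    that permits the exchange of the two sums. *)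
Definition gauss_dominated (f : Z -> Z -> C) : Prop := exists M c, (0 < c)%R /\ (0 <= M)%R /\
  forall m n, (Cmod (f m n) <= M * exp (- c * sq m) * exp (- c * sq n))%R.

Lemma gdom_sub (f : Z -> Z -> C) (u v : Z -> Z -> Z) (c0 c1 : R) : gauss_dominated f -> (0 < c0)%R ->
  (forall m n, (c0 * (sq m + sq n) - c1 <= sq (u m n) + sq (v m n))%R) -> gauss_dominated (fun m n => f (u m n) (v m n)).
Proof.
  intros [M [c [Hc [HM H]]]] Hc0 Huv. exists (M * exp (c * c1))%R, (c * c0)%R. split; [nra|]. split.
  { apply Rmult_le_pos; [lra|left; apply exp_pos]. }
  intros m n. eapply Rle_trans; [apply H|]. rewrite !Rmult_assoc. apply Rmult_le_compat_l; [lra|].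
  rewrite <- !exp_plus. apply exp_le_compat. specialize (Huv m n). nra.
Qed.

Lemma gdom_swap (f : Z -> Z -> C) : gauss_dominated f -> gauss_dominated (fun m n => f n m).
Proof.
  intros [M [c [Hc [HM H]]]]. exists M, c. repeat split; auto. intros m n. eapply Rle_trans; [apply H|]. right. ring.
Qed.

Lemma gdom_inner (f : Z -> Z -> C) (m : Z) : gauss_dominated f -> absZ (f m).
Proof.
  intros [M [c [Hc [HM H]]]]. apply absZ_le with (1 := H m). apply exZ_scal, exZ_gauss, Hc.
Qed.

Lemma gdom_outer (f : Z -> Z -> C) : gauss_dominated f -> absZ (fun m => CSeriesZ (f m)).
Proof.
  intros [M [c [Hc [HM H]]]].
  apply absZ_le with (fun m => (M * SeriesZ (fun n => exp (- c * sq n))) * exp (- c * sq m))%R; [|apply exZ_scal, exZ_gauss, Hc].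
  intros m. replace (M * SeriesZ (fun n => exp (- c * sq n)) * exp (- c * sq m))%R with ((M * exp (- c * sq m)) * SeriesZ (fun n => exp (- c * sq n)))%R by ring.
  rewrite <- SeriesZ_scal. apply CSeriesZ_bound; [apply H|]. apply exZ_scal, exZ_gauss, Hc.
Qed.

Lemma gdom_Fubini (f : Z -> Z -> C) : gauss_dominated f ->
  CSeriesZ (fun m => CSeriesZ (f m)) = CSeriesZ (fun n => CSeriesZ (fun m => f m n)).
Proof.
  intros [M [c [Hc [HM H]]]].
  apply (CSeriesZ_Fubini f (fun m => M * exp (- c * sq m))%R (fun n => exp (- c * sq n)) H).
  - intros m. apply Rmult_le_pos; [lra|left; apply exp_pos]. - intros n. left. apply exp_pos.
  - apply exZ_scal, exZ_gauss, Hc. - apply exZ_gauss, Hc.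
Qed.

(* Summation over Z^2 rotated by 45 degrees: (m, n) = (a + b, a - b) or (a + b + 1, a - b) according to the parity of m - n. *)
Lemma rotate_sum (f : Z -> Z -> C) : gauss_dominated f ->
  CSeriesZ (fun m => CSeriesZ (f m)) =
  CSeriesZ (fun a => CSeriesZ (fun b => f (a + b) (a - b))%Z) + CSeriesZ (fun a => CSeriesZ (fun b => f (a + b + 1) (a - b))%Z).
Proof.
  intros Hf.
  (* Row by row, n = m - k and k is split by parity; the sums are then exchanged and m is shifted by
     b or by b + 1. The estimates here and below keep every stage dominated. *)
  assert (Hq : forall m k : Z, (/ 4 * (sq m + sq k) <= sq m + sq (m - k))%R).
  { intros m k. unfold sq. rewrite minus_IZR. set (x := IZR m). set (y := IZR k).
    generalize (Rle_0_sqr (x - y)) (Rle_0_sqr (2 * x - y)) (Rle_0_sqr (4 * x - 3 * y)) (Rle_0_sqr x) (Rle_0_sqr y). unfold Rsqr. nra. }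
  assert (H0 : gauss_dominated (fun m k => f m (m - k)%Z)).
  { apply (gdom_sub f (fun m k => m) (fun m k => (m - k)%Z) (/ 4) 0 Hf); [lra|]. intros m k. generalize (Hq m k). lra. }
  assert (H1 : gauss_dominated (fun m b => f m (m - 2 * b)%Z)).
  { apply (gdom_sub _ (fun m b => m) (fun m b => (2 * b)%Z) 1 0 H0); [lra|]. intros m b. unfold sq. rewrite mult_IZR. simpl. nra. }
  assert (H2 : gauss_dominated (fun m b => f m (m - (2 * b + 1))%Z)).
  { apply (gdom_sub _ (fun m b => m) (fun m b => (2 * b + 1)%Z) 1 0 H0); [lra|]. intros m b.
    rewrite Rmult_1_l, Rminus_0_r. apply Rplus_le_compat_l. unfold sq. rewrite <- !mult_IZR. apply IZR_le.
    assert (0 <= (- (3 * b + 1)) * (- (b + 1)))%Z by (destruct (Z_le_gt_dec 0 b); [nia|apply Z.mul_nonneg_nonneg; lia]). nia. }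
  rewrite (CSeriesZ_ext _ (fun m => CSeriesZ (fun b => f m (m - 2 * b)%Z) + CSeriesZ (fun b => f m (m - (2 * b + 1))%Z))).
  2: { intros m. destruct (CSeriesZ_reflect (f m) m (gdom_inner _ m Hf)) as [J1 J2]. rewrite <- J2.
       apply (CSeriesZ_even_odd (fun k => f m (m - k)%Z)); [exact J1|apply (gdom_inner _ m H1)|apply (gdom_inner _ m H2)]. }
  rewrite (CSeriesZ_plus (fun m => CSeriesZ (fun b => f m (m - 2 * b)%Z)) (fun m => CSeriesZ (fun b => f m (m - (2 * b + 1))%Z)));
    [|apply (gdom_outer _ H1)|apply (gdom_outer _ H2)].
  assert (Hr : forall a b : Z, (1 * (sq a + sq b) - 0 <= sq (a + b) + sq (a - b))%R).
  { intros a b. unfold sq. rewrite minus_IZR, plus_IZR. nra. }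
  assert (Hr' : forall a b : Z, (/ 4 * (sq a + sq b) - 4 <= sq (a + b + 1) + sq (a - b))%R).
  { intros a b. unfold sq. rewrite minus_IZR, !plus_IZR. set (x := IZR a). set (y := IZR b).
    generalize (Rle_0_sqr (x + 1)) (Rle_0_sqr (y + 1)) (Rle_0_sqr x) (Rle_0_sqr y). unfold Rsqr. nra. }
  f_equal.
  - rewrite (gdom_Fubini _ H1). rewrite (gdom_Fubini (fun a b => f (a + b) (a - b))%Z).
    2: { apply (gdom_sub f (fun a b => a + b)%Z (fun a b => a - b)%Z 1 0 Hf); [lra|exact Hr]. }
    apply CSeriesZ_ext. intros b.
    destruct (CSeriesZ_shift (fun m => f m (m - 2 * b)%Z) b (gdom_inner _ b (gdom_swap _ H1))) as [_ J2].
    rewrite <- J2. apply CSeriesZ_ext. intros a. f_equal. lia.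
  - rewrite (gdom_Fubini _ H2). rewrite (gdom_Fubini (fun a b => f (a + b + 1) (a - b))%Z).
    2: { apply (gdom_sub f (fun a b => a + b + 1)%Z (fun a b => a - b)%Z (/ 4) 4 Hf); [lra|exact Hr']. }
    apply CSeriesZ_ext. intros b.
    destruct (CSeriesZ_shift (fun m => f m (m - (2 * b + 1))%Z) (b + 1) (gdom_inner _ b (gdom_swap _ H2))) as [_ J2].
    rewrite <- J2. apply CSeriesZ_ext. intros a. f_equal; lia.
Qed.

Lemma CSeriesZ_prod (a b : Z -> C) : absZ a -> absZ b ->
  CSeriesZ (fun m => CSeriesZ (fun n => a m * b n)) = CSeriesZ a * CSeriesZ b.
Proof.
  intros Ha Hb. rewrite (CSeriesZ_ext _ (fun m => CSeriesZ b * a m)).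
  - rewrite CSeriesZ_scal by exact Ha. ring.
  - intros m. rewrite CSeriesZ_scal by exact Hb. ring.
Qed.

Definition one (k : Z) : C := 1.
Definition alt_sign (k : Z) : C := if Z.even k then 1 else - (1).
Definition e3 (k : Z) : R := IZR (k * k).
Definition e2 (k : Z) : R := IZR (k * k + k).
(** The third theta constant; it enters because theta3^4 - theta2^4 = theta4^4, so that 1 - s^4 is a
    square up to sign. *)
Definition theta4 (tau : C) : C := exp_series alt_sign e3 tau.
(** [theta2] without its factor exp (pi i tau / 4): integral exponents, and a nonzero limit at i
    infinity. *)
Definition phi2 (tau : C) : C := exp_series one e2 tau.

Lemma theta3_gs (tau : C) : theta3 tau = exp_series one e3 tau.
Proof. apply CSeriesZ_ext. intros k. unfold one, e3. ring. Qed.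
Lemma theta2_phi2 (tau : C) : theta2 tau = cexp (1 / 4 * PI * Ci * tau) * phi2 tau.
Proof. unfold theta2, phi2, exp_series. f_equal. apply CSeriesZ_ext. intros k. unfold one, e2. ring. Qed.

Lemma quad_e3 : quad_growth e3.
Proof. intros k. unfold e3, sq. rewrite mult_IZR. nra. Qed.
Lemma quad_e2 : quad_growth e2.
Proof.
  intros k. unfold e2. split; [apply IZR_le; nia|]. unfold sq. rewrite plus_IZR, mult_IZR.
  set (x := IZR k). generalize (Rle_0_sqr (x - 1)) (Rle_0_sqr (3 * x + 2)). unfold Rsqr. split; nra.
Qed.
Lemma Cmod_alt_sign (k : Z) : Cmod (alt_sign k) = 1%R.
Proof. unfold alt_sign. destruct (Z.even k); rewrite ?Cmod_opp; apply Cmod_1. Qed.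
Lemma poly_one : poly_growth one.
Proof. exists 1%R, 0%nat. split; [lra|]. intros k. unfold one. rewrite Cmod_1. simpl. lra. Qed.
Lemma poly_alt_sign : poly_growth alt_sign.
Proof. exists 1%R, 0%nat. split; [lra|]. intros k. rewrite Cmod_alt_sign. simpl. lra. Qed.

Lemma alt_sign_plus (a b : Z) : alt_sign (a + b) = alt_sign a * alt_sign b.
Proof. unfold alt_sign. rewrite Z.even_add. destruct (Z.even a), (Z.even b); simpl; ring. Qed.
Lemma alt_sign_sq (a : Z) : alt_sign a * alt_sign a = 1.
Proof. unfold alt_sign. destruct (Z.even a); ring. Qed.
Lemma alt_sign_opp (a : Z) : alt_sign (- a) = alt_sign a.
Proof. unfold alt_sign. rewrite Z.even_opp. reflexivity. Qed.

Lemma gdom_gs (c1 c2 : Z -> C) (a1 a2 : Z -> R) (tau : C) :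
  (forall k, Cmod (c1 k) <= 1)%R -> (forall k, Cmod (c2 k) <= 1)%R -> quad_growth a1 -> quad_growth a2 -> (0 < Im tau)%R ->
  gauss_dominated (fun m n => (c1 m * cexp (a1 m * PI * Ci * tau)) * (c2 n * cexp (a2 n * PI * Ci * tau))).
Proof.
  intros H1 H2 Q1 Q2 Ht. assert (HP := PI_RGT_0). assert (Hy : (0 < PI * Im tau)%R) by (apply Rmult_lt_0_compat; lra).
  exists (exp (2 * (PI * Im tau))), (PI * Im tau / 4)%R. split; [lra|]. split; [left; apply exp_pos|]. intros m n.
  rewrite Cmod_mult, !Cmod_gs_term.
  apply Rle_trans with (1 * exp (- (PI * a1 m * Im tau)) * (1 * exp (- (PI * a2 n * Im tau))))%R.
  { apply Rmult_le_compat; try (apply Rmult_le_pos; [apply Cmod_ge_0|left; apply exp_pos]);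
    (apply Rmult_le_compat_r; [left; apply exp_pos|auto]). }
  rewrite !Rmult_1_l, <- !exp_plus. apply exp_le_compat.
  destruct (Q1 m) as [_ [A1 _]]. destruct (Q2 n) as [_ [A2 _]]. nra.
Qed.

(** The power q^x of the nome q = exp (pi i tau). *)
Definition E (x : Z) (tau : C) : C := cexp (IZR x * PI * Ci * tau).
Lemma qexpo_def (x : Z) (tau : C) : cexp (IZR x * PI * Ci * tau) = E x tau.
Proof. reflexivity. Qed.
Lemma qexpo_plus (x y : Z) (tau : C) : E (x + y) tau = E x tau * E y tau.
Proof. unfold E. rewrite <- cexp_plus. f_equal. rewrite plus_IZR, RtoC_plus. ring. Qed.
Lemma qexpo_double (x : Z) (tau : C) : E (2 * x) tau = E x (2 * tau).
Proof. unfold E. f_equal. rewrite mult_IZR, RtoC_mult. simpl. ring. Qed.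

Lemma Im_double (tau : C) : Im (2 * tau) = (2 * Im tau)%R.
Proof. apply im_scal_l. Qed.

Lemma one_le (k : Z) : (Cmod (one k) <= 1)%R.
Proof. unfold one. rewrite Cmod_1. lra. Qed.
Lemma alt_sign_le (k : Z) : (Cmod (alt_sign k) <= 1)%R.
Proof. rewrite Cmod_alt_sign. lra. Qed.

Section Landen.
Variable tau : C.
Hypothesis Htau : (0 < Im tau)%R.

Lemma Im2 : (0 < Im (2 * tau))%R.
Proof. rewrite Im_double. lra. Qed.

Lemma gs_prod (c1 c2 : Z -> C) (a1 a2 : Z -> R) (t : C) :
  poly_growth c1 -> poly_growth c2 -> quad_growth a1 -> quad_growth a2 -> (0 < Im t)%R ->
  CSeriesZ (fun m => CSeriesZ (fun n => (c1 m * cexp (a1 m * PI * Ci * t)) * (c2 n * cexp (a2 n * PI * Ci * t)))) = exp_series c1 a1 t * exp_series c2 a2 t.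
Proof. intros. apply CSeriesZ_prod; apply gs_absZ; assumption. Qed.

Lemma CSeriesZ2_scal (c : C) (f g : Z -> Z -> C) : gauss_dominated f -> (forall m n, g m n = c * f m n) ->
  CSeriesZ (fun m => CSeriesZ (g m)) = c * CSeriesZ (fun m => CSeriesZ (f m)).
Proof.
  intros Hf H. rewrite <- CSeriesZ_scal by apply (gdom_outer _ Hf). apply CSeriesZ_ext. intros m.
  rewrite <- CSeriesZ_scal by apply (gdom_inner _ m Hf). apply CSeriesZ_ext. apply H.
Qed.

(** On the rotated lattice the exponents of a product at tau separate into exponents at 2 tau:
    (a+b)^2 + (a-b)^2 = 2 (a^2 + b^2) and (a+b+1)^2 + (a-b)^2 = 2 (a^2 + a + b^2 + b) + 1. The
    factors r and r' carry the constants of the two parity classes. *)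
Lemma landen_gen (c1 c2 d1 d2 d1' d2' : Z -> C) (a1 a2 b1 b2 b1' b2' : Z -> R) (r r' : C) :
  (forall k, Cmod (c1 k) <= 1)%R -> (forall k, Cmod (c2 k) <= 1)%R -> quad_growth a1 -> quad_growth a2 ->
  poly_growth c1 -> poly_growth c2 ->
  (forall k, Cmod (d1 k) <= 1)%R -> (forall k, Cmod (d2 k) <= 1)%R -> quad_growth b1 -> quad_growth b2 ->
  poly_growth d1 -> poly_growth d2 ->
  (forall k, Cmod (d1' k) <= 1)%R -> (forall k, Cmod (d2' k) <= 1)%R -> quad_growth b1' -> quad_growth b2' ->
  poly_growth d1' -> poly_growth d2' ->
  (forall a b, (c1 (a + b)%Z * cexp (a1 (a + b)%Z * PI * Ci * tau)) * (c2 (a - b)%Z * cexp (a2 (a - b)%Z * PI * Ci * tau)) =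
     r * ((d1 a * cexp (b1 a * PI * Ci * (2 * tau))) * (d2 b * cexp (b2 b * PI * Ci * (2 * tau))))) ->
  (forall a b, (c1 (a + b + 1)%Z * cexp (a1 (a + b + 1)%Z * PI * Ci * tau)) * (c2 (a - b)%Z * cexp (a2 (a - b)%Z * PI * Ci * tau)) =
     r' * ((d1' a * cexp (b1' a * PI * Ci * (2 * tau))) * (d2' b * cexp (b2' b * PI * Ci * (2 * tau))))) ->
  exp_series c1 a1 tau * exp_series c2 a2 tau = r * (exp_series d1 b1 (2 * tau) * exp_series d2 b2 (2 * tau)) + r' * (exp_series d1' b1' (2 * tau) * exp_series d2' b2' (2 * tau)).
Proof.
  intros. assert (HI2 := Im2). rewrite <- !gs_prod by assumption.
  rewrite (rotate_sum (fun m n => (c1 m * cexp (a1 m * PI * Ci * tau)) * (c2 n * cexp (a2 n * PI * Ci * tau)))) by (apply gdom_gs; assumption).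
  f_equal.
  - apply (CSeriesZ2_scal r (fun a b => (d1 a * cexp (b1 a * PI * Ci * (2 * tau))) * (d2 b * cexp (b2 b * PI * Ci * (2 * tau))))); [apply gdom_gs; assumption|assumption].
  - apply (CSeriesZ2_scal r' (fun a b => (d1' a * cexp (b1' a * PI * Ci * (2 * tau))) * (d2' b * cexp (b2' b * PI * Ci * (2 * tau))))); [apply gdom_gs; assumption|assumption].
Qed.

Ltac side := first [apply quad_e3|apply quad_e2|apply one_le|apply alt_sign_le|apply poly_one|apply poly_alt_sign].
Ltac fold_E := unfold e3, e2; rewrite !qexpo_def, <- ?qexpo_double.

Lemma landen_33 : exp_series one e3 tau * exp_series one e3 tau =
  exp_series one e3 (2 * tau) * exp_series one e3 (2 * tau) + E 1 tau * (phi2 (2 * tau) * phi2 (2 * tau)).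
Proof.
  rewrite (landen_gen one one one one one one e3 e3 e3 e3 e2 e2 1 (E 1 tau)); try side.
  - unfold phi2. ring.
  - intros a b. fold_E. unfold one. rewrite !Cmult_1_l, <- !qexpo_plus. f_equal. ring.
  - intros a b. fold_E. unfold one. rewrite !Cmult_1_l, <- !qexpo_plus. f_equal. ring.
Qed.

Lemma landen_44 : theta4 tau * theta4 tau =
  exp_series one e3 (2 * tau) * exp_series one e3 (2 * tau) - E 1 tau * (phi2 (2 * tau) * phi2 (2 * tau)).
Proof.
  unfold theta4. rewrite (landen_gen alt_sign alt_sign one one one one e3 e3 e3 e3 e2 e2 1 (- E 1 tau)); try side.
  - unfold phi2. ring.
  - intros a b. fold_E. unfold one. replace (a - b)%Z with (a + - b)%Z by ring. rewrite !alt_sign_plus, alt_sign_opp.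
    transitivity ((alt_sign a * alt_sign a) * (alt_sign b * alt_sign b) * (E ((a + b) * (a + b)) tau * E ((a + - b) * (a + - b)) tau)); [ring|].
    rewrite !alt_sign_sq, !Cmult_1_l, <- !qexpo_plus. f_equal. ring.
  - intros a b. fold_E. unfold one. replace (a - b)%Z with (a + - b)%Z by ring. rewrite !alt_sign_plus, alt_sign_opp. change (alt_sign 1) with (- (1)).
    transitivity (- ((alt_sign a * alt_sign a) * (alt_sign b * alt_sign b) * (E ((a + b + 1) * (a + b + 1)) tau * E ((a + - b) * (a + - b)) tau))); [ring|].
    rewrite !alt_sign_sq, !Cmult_1_l. transitivity (- (E 1 tau * (E (2 * (a * a + a)) tau * E (2 * (b * b + b)) tau))); [|ring].
    rewrite <- !qexpo_plus. f_equal. f_equal. ring.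
Qed.

(** The map k -> -k-1 fixes k^2 + k and reverses (-1)^k. This removes the odd class from the product
    of [theta3] and [theta4]. *)
Lemma exp_series_alt_sign_e2 (t : C) : (0 < Im t)%R -> exp_series alt_sign e2 t = 0.
Proof.
  intros Ht. assert (HA := gs_absZ alt_sign e2 t quad_e2 poly_alt_sign Ht).
  destruct (CSeriesZ_flip _ HA) as [_ J]. fold (exp_series alt_sign e2 t) in J.
  assert (EQ : exp_series alt_sign e2 t = - exp_series alt_sign e2 t).
  { rewrite <- J at 1. replace (- exp_series alt_sign e2 t) with (- (1) * exp_series alt_sign e2 t) by ring. unfold exp_series. rewrite <- CSeriesZ_scal by exact HA.
    apply CSeriesZ_ext. intros k. replace (- k - 1)%Z with (- k + -1)%Z by ring. rewrite alt_sign_plus, alt_sign_opp. change (alt_sign (-1)) with (- (1)).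
    replace (e2 (- k + -1)) with (e2 k) by (unfold e2; f_equal; ring). ring. }
  assert (H2 : 2 * exp_series alt_sign e2 t = 0). { replace (2 * exp_series alt_sign e2 t) with (exp_series alt_sign e2 t + exp_series alt_sign e2 t) by ring. rewrite EQ at 1. ring. }
  replace (exp_series alt_sign e2 t) with (/ 2 * (2 * exp_series alt_sign e2 t)) by field. rewrite H2. ring.
Qed.

Lemma landen_34 : exp_series one e3 tau * theta4 tau = theta4 (2 * tau) * theta4 (2 * tau).
Proof.
  unfold theta4. rewrite (landen_gen one alt_sign alt_sign alt_sign alt_sign alt_sign e3 e3 e3 e3 e2 e2 1 (E 1 tau)); try side.
  - rewrite (exp_series_alt_sign_e2 (2 * tau) Im2). ring.
  - intros a b. fold_E. unfold one. replace (a - b)%Z with (a + - b)%Z by ring. rewrite !alt_sign_plus, alt_sign_opp.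
    transitivity (alt_sign a * alt_sign b * (E ((a + b) * (a + b)) tau * E ((a + - b) * (a + - b)) tau)); [ring|].
    transitivity (alt_sign a * alt_sign b * (E (2 * (a * a)) tau * E (2 * (b * b)) tau)); [|ring].
    rewrite <- !qexpo_plus. f_equal. f_equal. ring.
  - intros a b. fold_E. unfold one. replace (a - b)%Z with (a + - b)%Z by ring. rewrite !alt_sign_plus, alt_sign_opp.
    transitivity (alt_sign a * alt_sign b * (E ((a + b + 1) * (a + b + 1)) tau * E ((a + - b) * (a + - b)) tau)); [ring|].
    transitivity (alt_sign a * alt_sign b * (E 1 tau * (E (2 * (a * a + a)) tau * E (2 * (b * b + b)) tau))); [|ring].
    rewrite <- !qexpo_plus. f_equal. f_equal. ring.
Qed.

Lemma gs_shift_e3 (t : C) : (0 < Im t)%R -> exp_series one (fun k => e3 (k + 1)) t = exp_series one e3 t.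
Proof.
  intros Ht. apply (CSeriesZ_shift (fun k => one k * cexp (e3 k * PI * Ci * t)) 1). apply gs_absZ; [apply quad_e3|apply poly_one|exact Ht].
Qed.

Lemma landen_22 : phi2 tau * phi2 tau = 2 * (phi2 (2 * tau) * exp_series one e3 (2 * tau)).
Proof.
  (* In the odd class the exponent is 2 ((a+1)^2 + b^2 + b), hence the shifted squares; after the
     shift both classes give the same product, whence the factor 2. *)
  unfold phi2. assert (Q : quad_growth (fun k => e3 (k + 1))).
  { intros k. unfold e3, sq. rewrite mult_IZR, plus_IZR. set (x := IZR k).
    generalize (Rle_0_sqr (x - 1)) (Rle_0_sqr (3 * x + 4)) (Rle_0_sqr (x + 1)). unfold Rsqr. intros. split; [lra|split; lra]. }
  rewrite (landen_gen one one one one one one e2 e2 e2 e3 (fun k => e3 (k + 1)) e2 1 1); try side; try exact Q.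
  - rewrite gs_shift_e3 by apply Im2. ring.
  - intros a b. fold_E. unfold one. rewrite !Cmult_1_l, <- !qexpo_plus. f_equal. ring.
  - intros a b. fold_E. unfold one. rewrite !Cmult_1_l, <- !qexpo_plus. f_equal. ring.
Qed.
End Landen.

(** * Limits and the doubling map *)

Definition flim (F : (C -> Prop) -> Prop) (f : C -> C) (l : C) : Prop :=
  forall eps, (0 < eps)%R -> F (fun t => (Cmod (f t - l) < eps)%R).

(** Neighbourhoods are whole half-planes: a limit is uniform in Re tau and can be used along every
    orbit tau, 2 tau, 4 tau. *)
Definition at_ioo (P : C -> Prop) : Prop := exists Y : R, forall tau, (Y <= Im tau)%R -> P tau.
Definition at_0 (P : C -> Prop) : Prop := exists d : R, (0 < d)%R /\ forall s : C, (0 < Cmod s < d)%R -> P s.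

Global Instance at_ioo_filter : Filter at_ioo.
Proof.
  constructor.
  - exists 0%R. auto.
  - intros P Q [Y1 H1] [Y2 H2]. exists (Rmax Y1 Y2). intros t Ht. assert (M1 := Rmax_l Y1 Y2). assert (M2 := Rmax_r Y1 Y2).
    split; [apply H1|apply H2]; lra.
  - intros P Q H [Y HY]. exists Y. auto.
Qed.
Global Instance at_0_filter : Filter at_0.
Proof.
  constructor.
  - exists 1%R. split; [lra|auto].
  - intros P Q [Y1 [P1 H1]] [Y2 [P2 H2]]. exists (Rmin Y1 Y2). split; [apply Rmin_glb_lt; assumption|]. intros t Ht.
    assert (M1 := Rmin_l Y1 Y2). assert (M2 := Rmin_r Y1 Y2). split; [apply H1|apply H2]; lra.
  - intros P Q H [Y [HY1 HY]]. exists Y. auto.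
Qed.
Notation tends := (flim at_ioo).

Section Flim.
Context {F : (C -> Prop) -> Prop} {FF : Filter F}.

Lemma flim_ext (f g : C -> C) (l : C) : F (fun t => f t = g t) -> flim F f l -> flim F g l.
Proof.
  intros H Hf eps He. generalize (filter_and (F := F) _ _ H (Hf eps He)). apply filter_imp. intros t [<- Ht]. exact Ht.
Qed.
Lemma flim_const (c : C) : flim F (fun _ => c) c.
Proof. intros eps He. generalize (filter_true (F := F)). apply filter_imp. intros _ _. replace (c - c) with (RtoC 0) by ring. rewrite Cmod_0. exact He. Qed.
Lemma flim_plus (f g : C -> C) (a b : C) : flim F f a -> flim F g b -> flim F (fun t => f t + g t) (a + b).
Proof.
  intros Hf Hg eps He. generalize (filter_and (F := F) _ _ (Hf (eps / 2)%R ltac:(lra)) (Hg (eps / 2)%R ltac:(lra))). apply filter_imp.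
  intros t [H1 H2]. replace (f t + g t - (a + b)) with ((f t - a) + (g t - b)) by ring.
  eapply Rle_lt_trans; [apply Cmod_triangle|]. lra.
Qed.
Lemma flim_ccont (h f : C -> C) (a : C) : ccont h a -> flim F f a -> flim F (fun t => h (f t)) (h a).
Proof. intros Hh Hf eps He. destruct (Hh eps He) as [d [Hd H]]. generalize (Hf d Hd). apply filter_imp. intros t Ht. apply H, Ht. Qed.
Lemma flim_scal (c : C) (f : C -> C) (a : C) : flim F f a -> flim F (fun t => c * f t) (c * a).
Proof.
  intros H. apply (flim_ccont (fun x => c * x) f a); [|exact H].
  apply (cderiv_ccont _ _ (c * 1)), cderiv_scal, cderiv_id.
Qed.
Lemma flim_sq (f : C -> C) (a : C) : flim F f a -> flim F (fun t => f t * f t) (a * a).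
Proof.
  intros H. apply (flim_ccont (fun x => x * x) f a); [|exact H].
  apply (cderiv_ccont _ _ (1 * a + a * 1)). apply (cderiv_mult (fun x => x) (fun x => x)); apply cderiv_id.
Qed.
(** By polarization, which reduces the product to sums and squares, that is to continuous functions
    of one variable. *)
Lemma flim_mult (f g : C -> C) (a b : C) : flim F f a -> flim F g b -> flim F (fun t => f t * g t) (a * b).
Proof.
  intros Hf Hg.
  replace (a * b) with (/ 4 * ((a + b) * (a + b)) + - (/ 4) * ((a + - (1) * b) * (a + - (1) * b))) by field.
  apply (flim_ext (fun t => / 4 * ((f t + g t) * (f t + g t)) + - (/ 4) * ((f t + - (1) * g t) * (f t + - (1) * g t)))).
  { generalize (filter_true (F := F)). apply filter_imp. intros; field. }
  apply flim_plus; apply flim_scal.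
  - apply (flim_sq (fun t => f t + g t)), flim_plus; assumption.
  - apply (flim_sq (fun t => f t + - (1) * g t)), flim_plus; [assumption|]. apply flim_scal, Hg.
Qed.
Lemma flim_inv (f : C -> C) (a : C) : a <> 0 -> flim F f a -> flim F (fun t => / f t) (/ a).
Proof.
  intros Ha Hf. apply (flim_ccont (fun x => / x) f a); [|exact Hf]. apply (cderiv_ccont _ _ _ (cderiv_inv_id a Ha)).
Qed.
Lemma flim_eq (f : C -> C) (a b : C) : flim F f a -> a = b -> flim F f b.
Proof. intros H <-. exact H. Qed.
Lemma flim_pow (f : C -> C) (a : C) (n : nat) : flim F f a -> flim F (fun t => f t ^ n) (a ^ n).
Proof.
  intros H. induction n as [|n IH].
  - apply (flim_const 1).
  - apply (flim_ext (fun t => f t * f t ^ n)). { generalize (filter_true (F := F)). apply filter_imp. intros. rewrite Cpow_S. reflexivity. }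
    rewrite Cpow_S. apply flim_mult; assumption.
Qed.
Lemma flim_bounded_mult (f g : C -> C) (K : R) : flim F f 0 -> F (fun t => (Cmod (g t) <= K)%R) -> flim F (fun t => f t * g t) 0.
Proof.
  intros Hf Hg eps He. assert (HK := Rabs_pos K).
  generalize (filter_and (F := F) _ _ (Hf (eps / (Rabs K + 1))%R ltac:(apply Rdiv_lt_0_compat; lra)) Hg). apply filter_imp. intros t [H1 H2].
  replace (f t - 0) with (f t) in H1 by ring. replace (f t * g t - 0) with (f t * g t) by ring. rewrite Cmod_mult.
  apply Rlt_div_r in H1; [|lra]. assert (H3 := Cmod_ge_0 (f t)). generalize (Rle_abs K). intros. nra.
Qed.
Lemma flim_neq_0 (f : C -> C) (a : C) : a <> 0 -> flim F f a -> F (fun t => f t <> 0).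
Proof.
  intros Ha H. generalize (H (Cmod a) (proj1 (Cmod_gt_0 a) Ha)). apply filter_imp. intros t HY E0.
  rewrite E0 in HY. replace (0 - a) with (- a) in HY by ring. rewrite Cmod_opp in HY. lra.
Qed.
End Flim.

Lemma tends_ext (f g : C -> C) (l : C) : (forall tau, (0 < Im tau)%R -> f tau = g tau) -> tends f l -> tends g l.
Proof. intros H. apply flim_ext. exists 1%R. intros t Ht. apply H. lra. Qed.

Lemma doubling_descent (P : C -> Prop) : (exists Y, forall tau, (Y <= Im tau)%R -> P tau) ->
  (forall tau, (0 < Im tau)%R -> P (2 * tau) -> P tau) -> forall tau, (0 < Im tau)%R -> P tau.
Proof.
  intros [Y HY] Hd tau Ht.
  (* The induction carries the linear bound Y <= (n + 1) Im t, weaker than the true growth 2^n but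
     enough to reach height Y. *)
  assert (Hn : forall n t, (0 < Im t)%R -> (Y <= INR n * Im t + Im t)%R -> P t).
  { induction n as [|n IH]; intros t H0 H1.
    - apply HY. simpl in H1. lra.
    - apply Hd; [exact H0|]. apply IH; rewrite Im_double; [lra|]. rewrite S_INR in H1. assert (Hn := pos_INR n). nra. }
  destruct (nfloor_ex (Rmax 0 (Y / Im tau))) as [n [_ Hn2]]; [apply Rmax_l|].
  apply (Hn n tau Ht). assert (H := Rle_lt_trans _ _ _ (Rmax_r 0 (Y / Im tau)) Hn2). apply Rlt_div_l in H; [|exact Ht]. lra.
Qed.

(** f is constant along tau, 2 tau, 4 tau and so on, an orbit that climbs to i infinity. *)
Lemma doubling_invariant (f : C -> C) (l : C) : tends f l -> (forall tau, (0 < Im tau)%R -> f tau = f (2 * tau)) ->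
  forall tau, (0 < Im tau)%R -> f tau = l.
Proof.
  intros Hf Hi tau Ht. apply Ceq_minus. apply small_eq_0 with 1%R. intros eps He. rewrite Rmult_1_l. left.
  revert tau Ht. apply doubling_descent.
  - destruct (Hf eps He) as [Y HY]. exists Y. exact HY.
  - intros tau Ht H. rewrite (Hi tau Ht). exact H.
Qed.

(* A nonzero value f t would make f (2^n t) grow without bound, although f tends to 0. *)
Lemma doubling_contract (f al : C -> C) : tends f 0 -> tends al 0 -> (forall tau, (0 < Im tau)%R -> f tau = al tau * f (2 * tau)) ->
  forall tau, (0 < Im tau)%R -> f tau = 0.
Proof.
  intros Hf Ha Hr. apply doubling_descent.
  2: { intros tau Ht H. rewrite (Hr tau Ht), H. ring. }
  destruct (Hf 1%R Rlt_0_1) as [Y1 H1]. destruct (Ha (/ 2)%R ltac:(lra)) as [Y2 H2].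
  exists (Rmax 1 (Rmax Y1 Y2)).
  assert (Hn : forall n tau, (Rmax 1 (Rmax Y1 Y2) <= Im tau)%R -> (Cmod (f tau) <= (/ 2) ^ n)%R).
  { induction n as [|n IH]; intros tau Ht; assert (M0 := Rmax_l 1 (Rmax Y1 Y2)); assert (M := Rmax_r 1 (Rmax Y1 Y2)); assert (M1 := Rmax_l Y1 Y2); assert (M2 := Rmax_r Y1 Y2).
    - simpl. specialize (H1 tau ltac:(lra)). replace (f tau - 0) with (f tau) in H1 by ring. lra.
    - rewrite (Hr tau ltac:(lra)), Cmod_mult. simpl. specialize (H2 tau ltac:(lra)). replace (al tau - 0) with (al tau) in H2 by ring.
      apply Rmult_le_compat; try apply Cmod_ge_0; [lra|]. apply IH. rewrite Im_double. lra. }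
  intros tau Ht. apply small_eq_0 with 1%R. intros eps He. rewrite Rmult_1_l.
  destruct (pow_lt_1_zero (/ 2) ltac:(rewrite Rabs_pos_eq; lra) eps He) as [N HN]. specialize (HN N (Nat.le_refl N)).
  rewrite Rabs_pos_eq in HN by (apply pow_le; lra). specialize (Hn N tau Ht). lra.
Qed.

(** Used to remove the terms of exponent 0, the constant part of a theta series; what remains is
    exponentially small. *)
Definition drop_coef (j : Z) (c : Z -> C) (k : Z) : C := if (k =? j)%Z then 0 else c k.
Lemma poly_drop (j : Z) (c : Z -> C) : poly_growth c -> poly_growth (drop_coef j c).
Proof.
  intros [M [p [HM H]]]. exists M, p. split; [exact HM|]. intros k. unfold drop_coef. destruct (k =? j)%Z; [|apply H].
  rewrite Cmod_0. apply Rmult_le_pos; [exact HM|]. apply pow_le. generalize (sq_nonneg k). lra.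
Qed.
Lemma gs_drop (j : Z) (c : Z -> C) (a : Z -> R) (tau : C) : quad_growth a -> poly_growth c -> (0 < Im tau)%R -> a j = 0%R ->
  exp_series c a tau = c j + exp_series (drop_coef j c) a tau.
Proof.
  intros Ha Hc Ht Hj. unfold exp_series. rewrite <- (proj2 (CSeriesZ_delta j (c j))) at 1.
  rewrite <- CSeriesZ_plus.
  - apply CSeriesZ_ext. intros k. unfold deltaZ, drop_coef. destruct (Z.eqb_spec k j) as [->|_]; [|ring].
    rewrite Hj. replace (0 * PI * Ci * tau) with (RtoC 0) by ring. rewrite cexp_0. ring.
  - apply CSeriesZ_delta.
  - apply gs_absZ; [exact Ha|apply poly_drop, Hc|exact Ht].
Qed.

(* The weight (Im t)^2 is what makes the defect of [halphen_defect_double], multiplied by 4 under doubling, invariant. *)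
Lemma exp_poly_small (K : R) (f : C -> C) : (forall tau, (1 <= Im tau)%R -> (Cmod (f tau) <= K * exp (- (PI * Im tau)))%R) ->
  tends (fun t => (Im t * Im t)%R * f t) 0.
Proof.
  (* Two powers of Im t for the weight, and a third one that makes the product decay. *)
  intros H eps He. destruct (pow_exp_bound 3 1 Rlt_0_1) as [B [HB HE]].
  assert (HK := Rabs_pos K).
  exists (1 + Rabs K * B / eps)%R. assert (H0 : (0 <= Rabs K * B / eps)%R) by (apply Rmult_le_pos; [nra|left; apply Rinv_0_lt_compat; lra]).
  intros tau Ht. set (y := Im tau) in *. replace ((y * y)%R * f tau - 0) with ((y * y)%R * f tau) by ring.
  rewrite Cmod_mult, Cmod_R, Rabs_pos_eq by nra.
  assert (Hy : (1 <= y)%R) by lra.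
  assert (E1 : (exp (- (PI * y)) <= exp (- 1 * y))%R). { apply exp_le_compat. generalize PI2_3_2. unfold PI2. nra. }
  specialize (HE y ltac:(lra)). specialize (H tau Hy). fold y in H.
  assert (E2 : ((y * y * y) * exp (- 1 * y) <= B)%R).
  { eapply Rle_trans; [|exact HE]. apply Rmult_le_compat_r; [left; apply exp_pos|]. simpl. nra. }
  assert (E3 : (y * y * Cmod (f tau) * y <= Rabs K * B)%R).
  { apply Rle_trans with (Rabs K * ((y * y * y) * exp (- 1 * y)))%R; [|apply Rmult_le_compat_l; lra].
    replace (y * y * Cmod (f tau) * y)%R with ((y * y * y) * Cmod (f tau))%R by ring.
    replace (Rabs K * (y * y * y * exp (- 1 * y)))%R with ((y * y * y) * (Rabs K * exp (- 1 * y)))%R by ring.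
    apply Rmult_le_compat_l; [nra|]. eapply Rle_trans; [exact H|].
    apply Rle_trans with (Rabs K * exp (- (PI * y)))%R.
    - apply Rmult_le_compat_r; [left; apply exp_pos|apply Rle_abs].
    - apply Rmult_le_compat_l; lra. }
  assert (E4 : (Rabs K * B < eps * y)%R).
  { assert (E5 : (Rabs K * B / eps < y)%R) by lra. apply Rlt_div_l in E5; lra. }
  apply Rmult_lt_reg_r with y; lra.
Qed.

Lemma exp_small (K : R) (f : C -> C) : (forall tau, (1 <= Im tau)%R -> (Cmod (f tau) <= K * exp (- (PI * Im tau)))%R) ->
  tends f 0.
Proof.
  intros H. apply exp_poly_small in H. intros eps He. destruct (H eps He) as [Y HY]. exists (Rmax 1 Y). intros tau Ht.
  assert (M1 := Rmax_l 1 Y). assert (M2 := Rmax_r 1 Y). specialize (HY tau ltac:(lra)).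
  replace ((Im tau * Im tau)%R * f tau - 0) with ((Im tau * Im tau)%R * f tau) in HY by ring. replace (f tau - 0) with (f tau) by ring.
  rewrite Cmod_mult, Cmod_R, Rabs_pos_eq in HY by nra. generalize (Cmod_ge_0 (f tau)). intros.
  assert (1 <= Im tau * Im tau)%R by nra. nra.
Qed.

(** * Theta constants *)

Definition mulexp (a : Z -> R) (c : Z -> C) (k : Z) : C := a k * PI * Ci * c k.
Definition dtheta3 (tau : C) : C := exp_series (mulexp e3 one) e3 tau.
Definition dtheta4 (tau : C) : C := exp_series (mulexp e3 alt_sign) e3 tau.
Definition ddtheta4 (tau : C) : C := exp_series (mulexp e3 (mulexp e3 alt_sign)) e3 tau.
Definition dphi2 (tau : C) : C := exp_series (mulexp e2 one) e2 tau.
Definition ipi : C := PI * Ci.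
Definition dtheta2 (tau : C) : C := ipi / 4 * theta2 tau + cexp (1 / 4 * PI * Ci * tau) * dphi2 tau.

Notation upper t := (0 < Im t)%R.

Lemma ipi_neq_0 : ipi <> 0.
Proof. unfold ipi. apply Cmult_neq_0; [|apply Ci_nz]. intros H. apply RtoC_inj in H. generalize PI_RGT_0. lra. Qed.

Lemma poly_mulexp (a : Z -> R) (c : Z -> C) : quad_growth a -> poly_growth c -> poly_growth (mulexp a c).
Proof. intros. apply poly_growth_mult; assumption. Qed.
Local Hint Resolve quad_e3 quad_e2 poly_one poly_alt_sign poly_mulexp poly_drop : th.

Lemma cderiv_theta3 (tau : C) : upper tau -> cderiv theta3 tau (dtheta3 tau).
Proof. intros H. apply (cderiv_ext (exp_series one e3)); [intros; symmetry; apply theta3_gs|]. apply gs_cderiv; auto with th. Qed.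
Lemma cderiv_theta4 (tau : C) : upper tau -> cderiv theta4 tau (dtheta4 tau).
Proof. intros H. apply gs_cderiv; auto with th. Qed.
Lemma cderiv_dtheta4 (tau : C) : upper tau -> cderiv dtheta4 tau (ddtheta4 tau).
Proof. intros H. apply gs_cderiv; auto with th. Qed.
Lemma cderiv_phi2 (tau : C) : upper tau -> cderiv phi2 tau (dphi2 tau).
Proof. intros H. apply gs_cderiv; auto with th. Qed.
Lemma cderiv_theta2 (tau : C) : upper tau -> cderiv theta2 tau (dtheta2 tau).
Proof.
  intros H. apply (cderiv_ext (fun t => cexp (1 / 4 * PI * Ci * t) * phi2 t)); [intros; symmetry; apply theta2_phi2|].
  eapply cderiv_eq; [apply (cderiv_mult (fun t => cexp (1 / 4 * PI * Ci * t)) phi2); [apply cderiv_cexp_lin|apply cderiv_phi2, H]|].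
  unfold dtheta2. rewrite theta2_phi2. unfold ipi. field.
Qed.

Lemma e3_ge_1 (k : Z) : k <> 0%Z -> (1 <= e3 k)%R.
Proof. intros H. unfold e3. apply IZR_le. nia. Qed.
Lemma e2_ge_1 (k : Z) : k <> 0%Z -> k <> (-1)%Z -> (1 <= e2 k)%R.
Proof. intros H H1. unfold e2. apply IZR_le. nia. Qed.

Definition expsmall (f : C -> C) : Prop := exists K, (0 <= K)%R /\ forall tau, (1 <= Im tau)%R -> (Cmod (f tau) <= K * exp (- (PI * Im tau)))%R.

Lemma expsmall_tends (f : C -> C) : expsmall f -> tends f 0.
Proof. intros [K [_ H]]. exact (exp_small K f H). Qed.
Lemma expsmall_tends2 (f : C -> C) : expsmall f -> tends (fun t => (Im t * Im t)%R * f t) 0.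
Proof. intros [K [_ H]]. exact (exp_poly_small K f H). Qed.

Lemma expsmall_drop_e3 (c : Z -> C) : poly_growth c -> expsmall (exp_series (drop_coef 0 c) e3).
Proof.
  intros H. apply gs_decay; auto with th. intros k. unfold drop_coef. destruct (Z.eqb_spec k 0); [left; reflexivity|right; apply e3_ge_1; assumption].
Qed.
Lemma expsmall_e3 (c : Z -> C) : poly_growth c -> expsmall (exp_series (mulexp e3 c) e3).
Proof.
  intros H. apply gs_decay; auto with th. intros k. destruct (Z.eq_dec k 0) as [->|N]; [left; unfold mulexp, e3; simpl; ring|right; apply e3_ge_1; assumption].
Qed.
Lemma expsmall_e2 (c : Z -> C) : poly_growth c -> expsmall (exp_series (mulexp e2 c) e2).
Proof.
  intros H. apply gs_decay; auto with th. intros k. destruct (Z.eq_dec k 0) as [->|N]; [left; unfold mulexp, e2; simpl; ring|].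
  destruct (Z.eq_dec k (-1)) as [->|N']; [left; unfold mulexp, e2; simpl; ring|right; apply e2_ge_1; assumption].
Qed.

Lemma tends_theta3 : tends theta3 1.
Proof.
  apply (tends_ext (fun t => 1 + exp_series (drop_coef 0 one) e3 t)).
  { intros t Ht. rewrite theta3_gs. symmetry. apply (gs_drop 0 one); auto with th. }
  eapply flim_eq; [apply flim_plus; [apply flim_const|apply expsmall_tends, expsmall_drop_e3; auto with th]|]. ring.
Qed.
Lemma tends_theta4 : tends theta4 1.
Proof.
  apply (tends_ext (fun t => 1 + exp_series (drop_coef 0 alt_sign) e3 t)).
  { intros t Ht. symmetry. apply (gs_drop 0 alt_sign); auto with th. }
  eapply flim_eq; [apply flim_plus; [apply flim_const|apply expsmall_tends, expsmall_drop_e3; auto with th]|]. ring.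
Qed.
Lemma tends_phi2 : tends phi2 2.
Proof.
  apply (tends_ext (fun t => 1 + (1 + exp_series (drop_coef (-1) (drop_coef 0 one)) e2 t))).
  { intros t Ht. unfold phi2. rewrite (gs_drop 0 one), (gs_drop (-1) (drop_coef 0 one)); auto with th. }
  eapply flim_eq.
  { apply flim_plus; [apply flim_const|]. apply flim_plus; [apply flim_const|]. apply expsmall_tends.
    apply gs_decay; auto with th. intros k. unfold drop_coef. destruct (Z.eqb_spec k (-1)); [left; reflexivity|].
    destruct (Z.eqb_spec k 0); [left; reflexivity|right; apply e2_ge_1; assumption]. }
  rewrite Cplus_0_r. unfold RtoC, Cplus. simpl. f_equal; ring.
Qed.
Lemma tends_dtheta3 : tends dtheta3 0. Proof. apply expsmall_tends, expsmall_e3. auto with th. Qed.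
Lemma tends_dphi2 : tends dphi2 0. Proof. apply expsmall_tends, expsmall_e2. auto with th. Qed.

Lemma theta2_sq (t : C) : theta2 t * theta2 t = cexp (1 / 2 * PI * Ci * t) * (phi2 t * phi2 t).
Proof.
  rewrite theta2_phi2. replace (1 / 2 * PI * Ci * t) with (1 / 4 * PI * Ci * t + 1 / 4 * PI * Ci * t) by field. rewrite cexp_plus. ring.
Qed.
Lemma theta2_double_sq (t : C) : theta2 (2 * t) * theta2 (2 * t) = E 1 t * (phi2 (2 * t) * phi2 (2 * t)).
Proof. rewrite theta2_sq. f_equal. unfold E. f_equal. field. Qed.

Lemma landen_theta3_sq (t : C) : upper t -> theta3 t * theta3 t = theta3 (2 * t) * theta3 (2 * t) + theta2 (2 * t) * theta2 (2 * t).
Proof. intros H. rewrite theta2_double_sq, !theta3_gs. apply landen_33, H. Qed.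
Lemma landen_theta4_sq (t : C) : upper t -> theta4 t * theta4 t = theta3 (2 * t) * theta3 (2 * t) - theta2 (2 * t) * theta2 (2 * t).
Proof. intros H. rewrite theta2_double_sq, !theta3_gs. apply landen_44, H. Qed.
Lemma landen_theta3_theta4 (t : C) : upper t -> theta3 t * theta4 t = theta4 (2 * t) * theta4 (2 * t).
Proof. intros H. rewrite !theta3_gs. apply landen_34, H. Qed.
Lemma landen_theta2_sq (t : C) : upper t -> theta2 t * theta2 t = 2 * (theta2 (2 * t) * theta3 (2 * t)).
Proof.
  intros H. rewrite theta2_sq, landen_22 by exact H. rewrite (theta2_phi2 (2 * t)), !theta3_gs.
  replace (1 / 4 * PI * Ci * (2 * t)) with (1 / 2 * PI * Ci * t) by field. ring.
Qed.

Lemma theta_neq_0 (t : C) : upper t -> theta2 t <> 0 /\ theta3 t <> 0 /\ theta4 t <> 0.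
Proof.
  revert t. apply doubling_descent.
  - destruct (flim_neq_0 _ _ C1_nz tends_theta3) as [Y1 H1]. destruct (flim_neq_0 _ _ C1_nz tends_theta4) as [Y2 H2].
    assert (C2_nz : RtoC 2 <> 0) by (intros H; apply RtoC_inj in H; lra). destruct (flim_neq_0 _ _ C2_nz tends_phi2) as [Y3 H3].
    exists (Rmax Y1 (Rmax Y2 Y3)). intros t Ht. assert (M1 := Rmax_l Y1 (Rmax Y2 Y3)). assert (M2 := Rmax_r Y1 (Rmax Y2 Y3)).
    assert (M3 := Rmax_l Y2 Y3). assert (M4 := Rmax_r Y2 Y3). split; [|split; [apply H1; lra|apply H2; lra]].
    rewrite theta2_phi2. apply Cmult_neq_0; [apply cexp_neq_0|apply H3; lra].
  - intros t Ht [N2 [N3 N4]]. assert (H34 := landen_theta3_theta4 t Ht). assert (H22 := landen_theta2_sq t Ht). repeat split; intros E0.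
    + rewrite E0 in H22. assert (H0 : 2 * (theta2 (2 * t) * theta3 (2 * t)) <> 0).
      { apply Cmult_neq_0; [intros H; apply RtoC_inj in H; lra|apply Cmult_neq_0; assumption]. }
      apply H0. rewrite <- H22. ring.
    + rewrite E0 in H34. apply (Cmult_neq_0 _ _ N4 N4). rewrite <- H34. ring.
    + rewrite E0 in H34. apply (Cmult_neq_0 _ _ N4 N4). rewrite <- H34. ring.
Qed.

(** With T2 and T3 the values at 2 tau, Landen's relations reduce it to (T3^2 + T2^2)^2 - (T3^2 -
    T2^2)^2 = 4 T2^2 T3^2. *)
Lemma jacobi_quartic (t : C) : upper t -> theta3 t ^ 4 = theta2 t ^ 4 + theta4 t ^ 4.
Proof.
  intros H. assert (H33 := landen_theta3_sq t H). assert (H44 := landen_theta4_sq t H). assert (H22 := landen_theta2_sq t H).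
  replace (theta3 t ^ 4) with ((theta3 t * theta3 t) * (theta3 t * theta3 t)) by ring.
  replace (theta2 t ^ 4) with ((theta2 t * theta2 t) * (theta2 t * theta2 t)) by ring.
  replace (theta4 t ^ 4) with ((theta4 t * theta4 t) * (theta4 t * theta4 t)) by ring.
  rewrite H33, H44, H22. ring.
Qed.

Lemma cderiv_double (f : C -> C) (t a : C) : cderiv f (2 * t) a -> cderiv (fun t => f (2 * t)) t (2 * a).
Proof.
  intros H. eapply cderiv_eq; [apply (cderiv_comp f (fun t => 2 * t)); [exact H|apply cderiv_scal, cderiv_id]|]. ring.
Qed.

Lemma cderiv_eq_on_H (f g : C -> C) (t a b : C) : upper t -> (forall s, upper s -> f s = g s) -> cderiv f t a -> cderiv g t b -> a = b.
Proof.
  intros Ht H Hf Hg. apply (cderiv_unique g t); [|exact Hg]. apply (cderiv_ext_loc f); [|exact Hf].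
  exists (Im t). split; [exact Ht|]. intros w Hw. apply H.
  assert (HI := Im_le_Cmod (w - t)). unfold Cminus in HI at 1. rewrite im_plus, im_opp in HI. apply Rabs_le_between in HI. lra.
Qed.

Lemma half_eq (x y : C) : 2 * x = 2 * y -> x = y.
Proof. intros H. replace x with (/ 2 * (2 * x)) by field. rewrite H. field. Qed.

Lemma Hp2 (t : C) : upper t -> upper (2 * t).
Proof. rewrite Im_double. lra. Qed.

(** * Landen's relations for the derivatives *)

Section DL.
Variable t : C.
Hypothesis Ht : upper t.
Let t2 := theta2 t. Let t3 := theta3 t. Let t4 := theta4 t.
Let d2 := dtheta2 t. Let d3 := dtheta3 t. Let d4 := dtheta4 t.
Let T2 := theta2 (2 * t). Let T3 := theta3 (2 * t). Let T4 := theta4 (2 * t).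
Let D2 := dtheta2 (2 * t). Let D3 := dtheta3 (2 * t). Let D4 := dtheta4 (2 * t).

Lemma landen_theta3_sq_deriv : t3 * d3 = 2 * (T3 * D3 + T2 * D2).
Proof.
  apply half_eq. apply (cderiv_eq_on_H _ _ t) with (1 := Ht) (2 := landen_theta3_sq).
  - eapply cderiv_eq; [apply (cderiv_mult theta3 theta3); apply cderiv_theta3, Ht|]. unfold t3, d3. ring.
  - assert (H2 := Hp2 t Ht). eapply cderiv_eq; [apply cderiv_plus|].
    + apply (cderiv_mult (fun t => theta3 (2 * t)) (fun t => theta3 (2 * t))); apply cderiv_double, cderiv_theta3, H2.
    + apply (cderiv_mult (fun t => theta2 (2 * t)) (fun t => theta2 (2 * t))); apply cderiv_double, cderiv_theta2, H2.
    + unfold T2, T3, D2, D3. ring.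
Qed.
Lemma landen_theta4_sq_deriv : t4 * d4 = 2 * (T3 * D3 - T2 * D2).
Proof.
  apply half_eq. apply (cderiv_eq_on_H _ _ t) with (1 := Ht) (2 := landen_theta4_sq).
  - eapply cderiv_eq; [apply (cderiv_mult theta4 theta4); apply cderiv_theta4, Ht|]. unfold t4, d4. ring.
  - assert (H2 := Hp2 t Ht). eapply cderiv_eq; [apply cderiv_minus|].
    + apply (cderiv_mult (fun t => theta3 (2 * t)) (fun t => theta3 (2 * t))); apply cderiv_double, cderiv_theta3, H2.
    + apply (cderiv_mult (fun t => theta2 (2 * t)) (fun t => theta2 (2 * t))); apply cderiv_double, cderiv_theta2, H2.
    + unfold T2, T3, D2, D3. ring.
Qed.
Lemma landen_theta3_theta4_deriv : d3 * t4 + t3 * d4 = 4 * (T4 * D4).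
Proof.
  apply (cderiv_eq_on_H _ _ t) with (1 := Ht) (2 := landen_theta3_theta4).
  - apply (cderiv_mult theta3 theta4); [apply cderiv_theta3, Ht|apply cderiv_theta4, Ht].
  - assert (H2 := Hp2 t Ht). eapply cderiv_eq.
    + apply (cderiv_mult (fun t => theta4 (2 * t)) (fun t => theta4 (2 * t))); apply cderiv_double, cderiv_theta4, H2.
    + unfold T4, D4. ring.
Qed.
Lemma landen_theta2_sq_deriv : t2 * d2 = 2 * (D2 * T3 + T2 * D3).
Proof.
  apply half_eq. apply (cderiv_eq_on_H _ _ t) with (1 := Ht) (2 := landen_theta2_sq).
  - eapply cderiv_eq; [apply (cderiv_mult theta2 theta2); apply cderiv_theta2, Ht|]. unfold t2, d2. ring.
  - assert (H2 := Hp2 t Ht). eapply cderiv_eq.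
    + apply cderiv_scal, (cderiv_mult (fun t => theta2 (2 * t)) (fun t => theta3 (2 * t))); apply cderiv_double; [apply cderiv_theta2, H2|apply cderiv_theta3, H2].
    + unfold T2, T3, D2, D3. ring.
Qed.
End DL.

(** * Rational identities between logarithmic derivatives at tau and at 2 tau *)

Section Alg.
Variables t2 t3 t4 d2 d3 d4 T2 T3 T4 D2 D3 D4 : C.
Hypotheses (n2 : t2 <> 0) (n3 : t3 <> 0) (n4 : t4 <> 0) (N2 : T2 <> 0) (N3 : T3 <> 0) (N4 : T4 <> 0).
Hypothesis H33 : t3 * t3 = T3 * T3 + T2 * T2.
Hypothesis H44 : t4 * t4 = T3 * T3 - T2 * T2.
Hypothesis H34 : t3 * t4 = T4 * T4.
Hypothesis H22 : t2 * t2 = 2 * (T2 * T3).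
Hypothesis D33 : t3 * d3 = 2 * (T3 * D3 + T2 * D2).
Hypothesis D44 : t4 * d4 = 2 * (T3 * D3 - T2 * D2).
Hypothesis D34 : d3 * t4 + t3 * d4 = 4 * (T4 * D4).
Hypothesis D22 : t2 * d2 = 2 * (D2 * T3 + T2 * D3).

Lemma alg_P : T3 * T3 + T2 * T2 <> 0. Proof. rewrite <- H33. apply Cmult_neq_0; assumption. Qed.
Lemma alg_Q : T3 * T3 - T2 * T2 <> 0. Proof. rewrite <- H44. apply Cmult_neq_0; assumption. Qed.
Lemma alg_l3 : d3 / t3 = 2 * (T3 * D3 + T2 * D2) / (T3 * T3 + T2 * T2).
Proof. rewrite <- D33, <- H33. field. exact n3. Qed.
Lemma alg_l4 : d4 / t4 = 2 * (T3 * D3 - T2 * D2) / (T3 * T3 - T2 * T2).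
Proof. rewrite <- D44, <- H44. field. exact n4. Qed.
Lemma alg_l2 : d2 / t2 = D2 / T2 + D3 / T3.
Proof. transitivity ((t2 * d2) / (t2 * t2)); [field; exact n2|]. rewrite D22, H22. field. split; assumption. Qed.
Lemma alg_L4 : 4 * (D4 / T4) = d3 / t3 + d4 / t4.
Proof. transitivity (4 * (T4 * D4) / (T4 * T4)); [field; exact N4|]. rewrite <- D34, <- H34. field. split; assumption. Qed.
Lemma alg_T4 : T4 ^ 4 = (T3 * T3 + T2 * T2) * (T3 * T3 - T2 * T2).
Proof. replace (T4 ^ 4) with ((T4 * T4) * (T4 * T4)) by ring. rewrite <- H34, <- H33, <- H44. ring. Qed.
Lemma alg_t2 : t2 ^ 4 = 4 * (T2 * T2) * (T3 * T3).
Proof. replace (t2 ^ 4) with ((t2 * t2) * (t2 * t2)) by ring. rewrite H22. ring. Qed.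
Lemma alg_t4 : t4 ^ 4 = (T3 * T3 - T2 * T2) * (T3 * T3 - T2 * T2).
Proof. replace (t4 ^ 4) with ((t4 * t4) * (t4 * t4)) by ring. rewrite H44. ring. Qed.

Lemma alg_X : (d3 / t3 - d4 / t4) / t2 ^ 4 = (D2 / T2 - D3 / T3) / T4 ^ 4.
Proof.
  assert (HP := alg_P). assert (HQ := alg_Q).
  rewrite alg_l3, alg_l4, alg_T4, alg_t2. field. repeat split; assumption.
Qed.

(** The logarithmic derivatives at tau are rational in the data at 2 tau, and D4/T4 is eliminated
    through [alg_L4]; there remains an identity of rational functions in T2, T3, D2, D3. *)
Lemma alg_Y : (d2 / t2 - d3 / t3) / t4 ^ 4 - (D2 / T2 - D3 / T3) / T4 ^ 4 =
  (2 * T2 ^ 4 / t4 ^ 4) * ((D3 / T3 - D4 / T4) / T2 ^ 4 - (D2 / T2 - D3 / T3) / T4 ^ 4).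
Proof.
  assert (HP := alg_P). assert (HQ := alg_Q).
  replace (D4 / T4) with (/ 4 * (4 * (D4 / T4))) by (field; exact N4). rewrite alg_L4.
  rewrite alg_l2, alg_l3, alg_l4, alg_T4, alg_t4. field. repeat split; assumption.
Qed.
End Alg.

(** To be shown constant, equal to pi i / 4. The analogous quotient for [theta3] and [theta4] needs
    no separate treatment: its value at tau is that of [ratio23] at 2 tau. *)
Definition ratio23 (t : C) : C := (dtheta2 t / theta2 t - dtheta3 t / theta3 t) / theta4 t ^ 4.

Lemma ratio34_double (t : C) : upper t -> (dtheta3 t / theta3 t - dtheta4 t / theta4 t) / theta2 t ^ 4 = ratio23 (2 * t).
Proof.
  intros Ht. destruct (theta_neq_0 t Ht) as [n2 [n3 n4]]. destruct (theta_neq_0 (2 * t) (Hp2 t Ht)) as [N2 [N3 N4]].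
  apply alg_X; auto using landen_theta3_sq, landen_theta4_sq, landen_theta3_theta4, landen_theta2_sq, landen_theta3_sq_deriv, landen_theta4_sq_deriv.
Qed.

(** The right side of [alg_Y] contains the quotient for [theta3] and [theta4] at 2 tau, which is
    [ratio23] at 4 tau. So the failure of invariance reproduces itself, with a factor that tends to
    0 like theta2^4. *)
Lemma ratio23_double (t : C) : upper t -> ratio23 t - ratio23 (2 * t) = - (2 * theta2 (2 * t) ^ 4 / theta4 t ^ 4) * (ratio23 (2 * t) - ratio23 (2 * (2 * t))).
Proof.
  intros Ht. destruct (theta_neq_0 t Ht) as [n2 [n3 n4]]. destruct (theta_neq_0 (2 * t) (Hp2 t Ht)) as [N2 [N3 N4]].
  rewrite <- (ratio34_double (2 * t) (Hp2 t Ht)). unfold ratio23 at 1 2.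
  rewrite (alg_Y (theta2 t) (theta3 t) (theta4 t) (dtheta2 t) (dtheta3 t) (dtheta4 t) (theta2 (2 * t)) (theta3 (2 * t)) (theta4 (2 * t)) (dtheta2 (2 * t)) (dtheta3 (2 * t)) (dtheta4 (2 * t)));
    auto using landen_theta3_sq, landen_theta4_sq, landen_theta3_theta4, landen_theta2_sq, landen_theta3_sq_deriv, landen_theta4_sq_deriv, landen_theta3_theta4_deriv, landen_theta2_sq_deriv.
  unfold ratio23. ring.
Qed.

Lemma tends_double (f : C -> C) (a : C) : tends f a -> tends (fun t => f (2 * t)) a.
Proof.
  intros H eps He. destruct (H eps He) as [Y HY]. exists (Rmax 0 Y). intros t Ht. assert (M1 := Rmax_l 0 Y). assert (M2 := Rmax_r 0 Y).
  apply HY. rewrite Im_double. lra.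
Qed.

(** The factor exp (pi i tau / 4) of [theta2] supplies the limit; the rest of the numerator
    decays. *)
Lemma tends_ratio23 : tends ratio23 (ipi / 4).
Proof.
  apply (tends_ext (fun t => (ipi / 4 + dphi2 t * / phi2 t + - (1) * (dtheta3 t * / theta3 t)) * / (theta4 t ^ 4))).
  { intros t Ht. destruct (theta_neq_0 t Ht) as [N2 [N3 N4]]. unfold ratio23, dtheta2. assert (HE := theta2_phi2 t). rewrite HE in *.
    assert (Hc : cexp (1 / 4 * PI * Ci * t) <> 0) by apply cexp_neq_0.
    assert (Hph : phi2 t <> 0). { intros H0. apply N2. rewrite H0. ring. }
    set (cc := cexp (1 / 4 * PI * Ci * t)) in *. field. repeat split; assumption. }
  assert (H2 : RtoC 2 <> 0) by (intros H; apply RtoC_inj in H; lra).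
  eapply flim_eq.
  - apply flim_mult.
    + apply flim_plus; [apply flim_plus; [apply flim_const|]|].
      * apply flim_mult; [apply tends_dphi2|apply (flim_inv _ _ H2 tends_phi2)].
      * apply flim_scal, flim_mult; [apply tends_dtheta3|apply (flim_inv _ _ C1_nz tends_theta3)].
    + apply (flim_inv (fun t => theta4 t ^ 4)); [|apply flim_pow, tends_theta4]. rewrite Cpow_1_l. apply C1_nz.
  - rewrite Cpow_1_l. field.
Qed.

Lemma tends_theta2_4 : tends (fun t => theta2 t ^ 4) 0 /\ tends (fun t => (Im t * Im t)%R * theta2 t ^ 4) 0.
Proof.
  assert (HE : expsmall (fun t => cexp (1 * PI * Ci * t))).
  { exists 1%R. split; [lra|]. intros t Ht. rewrite Cmod_cexp, (Re_arg 1 t).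
    right. rewrite Rmult_1_l, Rmult_1_r. reflexivity. }
  assert (Heq : forall t, theta2 t ^ 4 = cexp (1 * PI * Ci * t) * phi2 t ^ 4).
  { intros t. replace (theta2 t ^ 4) with ((theta2 t * theta2 t) * (theta2 t * theta2 t)) by ring. rewrite theta2_sq.
    replace (1 * PI * Ci * t) with (1 / 2 * PI * Ci * t + 1 / 2 * PI * Ci * t) by field. rewrite cexp_plus. ring. }
  split.
  - apply (tends_ext (fun t => cexp (1 * PI * Ci * t) * phi2 t ^ 4)); [intros; symmetry; apply Heq|].
    eapply flim_eq; [apply flim_mult; [apply expsmall_tends, HE|apply flim_pow, tends_phi2]|ring].
  - apply (tends_ext (fun t => ((Im t * Im t)%R * cexp (1 * PI * Ci * t)) * phi2 t ^ 4)); [intros; rewrite Heq; ring|].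
    eapply flim_eq; [apply flim_mult; [apply expsmall_tends2, HE|apply flim_pow, tends_phi2]|ring].
Qed.

(** Doubling is used twice: contraction yields invariance under tau -> 2 tau, and invariance
    transports the limit at i infinity to every point. *)
Lemma ratio23_const (t : C) : upper t -> ratio23 t = ipi / 4.
Proof.
  revert t. apply doubling_invariant; [apply tends_ratio23|]. intros t Ht. apply Ceq_minus. revert t Ht.
  apply (doubling_contract (fun t => ratio23 t - ratio23 (2 * t)) (fun t => - (2 * theta2 (2 * t) ^ 4 / theta4 t ^ 4))).
  - apply (tends_ext (fun t => ratio23 t + - (1) * ratio23 (2 * t))); [intros; ring|].
    eapply flim_eq; [apply flim_plus; [apply tends_ratio23|apply flim_scal, tends_double, tends_ratio23]|ring].
  - apply (tends_ext (fun t => - (2) * (theta2 (2 * t) ^ 4 * / theta4 t ^ 4))).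
    { intros t Ht. destruct (theta_neq_0 t Ht) as [N2 [N3 N4]]. field. exact N4. }
    eapply flim_eq.
    + apply flim_scal, flim_mult; [apply (tends_double (fun t => theta2 t ^ 4)), tends_theta2_4|].
      apply (flim_inv (fun t => theta4 t ^ 4)); [|apply flim_pow, tends_theta4]. rewrite Cpow_1_l. apply C1_nz.
    + ring.
  - apply ratio23_double.
Qed.

Lemma log_deriv_23 (t : C) : upper t -> dtheta2 t / theta2 t - dtheta3 t / theta3 t = ipi / 4 * theta4 t ^ 4.
Proof.
  intros Ht. destruct (theta_neq_0 t Ht) as [N2 [N3 N4]]. rewrite <- (ratio23_const t Ht). unfold ratio23. field. repeat split; assumption.
Qed.
Lemma log_deriv_34 (t : C) : upper t -> dtheta3 t / theta3 t - dtheta4 t / theta4 t = ipi / 4 * theta2 t ^ 4.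
Proof.
  intros Ht. destruct (theta_neq_0 t Ht) as [N2 [N3 N4]]. rewrite <- (ratio23_const (2 * t) (Hp2 t Ht)), <- ratio34_double by exact Ht. field. repeat split; assumption.
Qed.

(** * Halphen's differential equation *)

Definition ell4 (t : C) : C := dtheta4 t / theta4 t.
Definition dell4 (t : C) : C := ddtheta4 t / theta4 t - ell4 t * ell4 t.
(** Halphen's system contains ell4' = 2 (ell4 ell2 + ell4 ell3 - ell2 ell3) = 2 (ell4^2 - (ell2 -
    ell4) (ell3 - ell4)). The two differences are pi i / 4 times theta3^4 and theta2^4, whence the
    coefficient (pi i)^2 / 8. *)
Definition halphen_defect (t : C) : C := dell4 t - 2 * (ell4 t * ell4 t) + ipi * ipi / 8 * (theta2 t ^ 4 * theta3 t ^ 4).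

Lemma cderiv_ell4 (t : C) : upper t -> cderiv ell4 t (dell4 t).
Proof.
  intros Ht. destruct (theta_neq_0 t Ht) as [N2 [N3 N4]].
  eapply cderiv_eq; [apply (cderiv_div dtheta4 theta4); [apply cderiv_dtheta4, Ht|apply cderiv_theta4, Ht|exact N4]|].
  unfold dell4, ell4. field. exact N4.
Qed.

Lemma ell4_double (t : C) : upper t -> ell4 t = 2 * ell4 (2 * t) - ipi / 8 * theta2 t ^ 4.
Proof.
  intros Ht. destruct (theta_neq_0 t Ht) as [n2 [n3 n4]]. destruct (theta_neq_0 (2 * t) (Hp2 t Ht)) as [N2 [N3 N4]].
  assert (H1 := log_deriv_34 t Ht).
  assert (H2 := alg_L4 (theta3 t) (theta4 t) (dtheta3 t) (dtheta4 t) (theta4 (2 * t)) (dtheta4 (2 * t)) n3 n4 N4 (landen_theta3_theta4 t Ht) (landen_theta3_theta4_deriv t Ht)).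
  unfold ell4.
  replace (2 * (dtheta4 (2 * t) / theta4 (2 * t))) with (/ 2 * (4 * (dtheta4 (2 * t) / theta4 (2 * t)))) by (field; exact N4). rewrite H2.
  replace (dtheta3 t / theta3 t) with (ipi / 4 * theta2 t ^ 4 + dtheta4 t / theta4 t) by (rewrite <- H1; ring). field. exact n4.
Qed.

Lemma dtheta2_ell4 (t : C) : upper t -> dtheta2 t = theta2 t * (ell4 t + ipi / 4 * theta3 t ^ 4).
Proof.
  intros Ht. destruct (theta_neq_0 t Ht) as [n2 [n3 n4]]. rewrite (jacobi_quartic t Ht).
  replace (ell4 t + ipi / 4 * (theta2 t ^ 4 + theta4 t ^ 4)) with (ell4 t + ipi / 4 * theta2 t ^ 4 + ipi / 4 * theta4 t ^ 4) by field.
  rewrite <- (log_deriv_34 t Ht), <- (log_deriv_23 t Ht). unfold ell4. field. repeat split; assumption.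
Qed.
Lemma dtheta3_ell4 (t : C) : upper t -> dtheta3 t = theta3 t * (ell4 t + ipi / 4 * theta2 t ^ 4).
Proof.
  intros Ht. destruct (theta_neq_0 t Ht) as [n2 [n3 n4]].
  rewrite <- (log_deriv_34 t Ht). unfold ell4. field. split; assumption.
Qed.

Lemma dell4_double (t : C) : upper t -> dell4 t = 4 * dell4 (2 * t) - ipi / 2 * (theta2 t ^ 4 * (ell4 t + ipi / 4 * theta3 t ^ 4)).
Proof.
  intros Ht. apply (cderiv_eq_on_H _ _ t) with (1 := Ht) (2 := ell4_double).
  - apply cderiv_ell4, Ht.
  - eapply cderiv_eq.
    + apply cderiv_minus; [apply cderiv_scal, cderiv_double, cderiv_ell4, Hp2, Ht|]. apply cderiv_scal, (cderiv_pow theta2), cderiv_theta2, Ht.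
    + rewrite (dtheta2_ell4 t Ht). simpl INR. simpl pred. replace (RtoC (1 + 1 + 1 + 1)) with (RtoC 4) by (f_equal; ring). field.
Qed.

(** The doubling rules of [ell4] and [dell4] have correction terms that cancel in the defect;
    theta2^4 theta3^4 at 2 tau equals theta2^8 / 16 at tau. *)
Lemma halphen_defect_double (t : C) : upper t -> halphen_defect t = 4 * halphen_defect (2 * t).
Proof.
  intros Ht. unfold halphen_defect. rewrite (dell4_double t Ht), (ell4_double t Ht). assert (H := landen_theta2_sq t Ht).
  replace (theta2 (2 * t) ^ 4 * theta3 (2 * t) ^ 4) with (/ 16 * (theta2 t ^ 4 * theta2 t ^ 4)).
  2: { replace (theta2 t ^ 4 * theta2 t ^ 4) with ((theta2 t * theta2 t) ^ 4) by ring. rewrite H. field. }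
  field.
Qed.

Lemma tends_ell4 : tends ell4 0 /\ tends (fun t => (Im t * Im t)%R * ell4 t) 0.
Proof.
  assert (HE : expsmall dtheta4) by (apply expsmall_e3; apply poly_alt_sign).
  split.
  - eapply flim_eq; [apply (flim_mult dtheta4 (fun t => / theta4 t)); [apply expsmall_tends, HE|apply (flim_inv _ _ C1_nz tends_theta4)]|ring].
  - apply (tends_ext (fun t => ((Im t * Im t)%R * dtheta4 t) * / theta4 t)).
    { intros t Ht. unfold ell4. unfold Cdiv. ring. }
    eapply flim_eq; [apply flim_mult; [apply expsmall_tends2, HE|apply (flim_inv _ _ C1_nz tends_theta4)]|ring].
Qed.

Lemma halphen_defect_zero (t : C) : upper t -> halphen_defect t = 0.
Proof.
  (* The factor 4 accumulates along the orbit, so the limit 0 of the defect is not by itself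
     conclusive; the weight makes the product invariant and exponential decay still wins. *)
  intros Ht. assert (H : (Im t * Im t)%R * halphen_defect t = 0).
  { revert t Ht. apply (doubling_invariant (fun t => (Im t * Im t)%R * halphen_defect t)).
    - assert (HE : expsmall ddtheta4) by (apply expsmall_e3, poly_mulexp; [apply quad_e3|apply poly_alt_sign]).
      apply (tends_ext (fun t => ((Im t * Im t)%R * ddtheta4 t) * / theta4 t + (- (3) * (((Im t * Im t)%R * ell4 t) * ell4 t) + ipi * ipi / 8 * (((Im t * Im t)%R * theta2 t ^ 4) * theta3 t ^ 4)))).
      { intros t Ht. destruct (theta_neq_0 t Ht) as [n2 [n3 n4]]. unfold halphen_defect, dell4. field. exact n4. }
      eapply flim_eq.
      + apply flim_plus; [|apply flim_plus].
        * apply flim_mult; [apply expsmall_tends2, HE|apply (flim_inv _ _ C1_nz tends_theta4)].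
        * apply flim_scal, flim_mult; apply tends_ell4.
        * apply flim_scal, flim_mult; [apply tends_theta2_4|apply flim_pow, tends_theta3].
      + ring.
    - intros t Ht. rewrite (halphen_defect_double t Ht), Im_double. rewrite !RtoC_mult. ring. }
  destruct (classic (halphen_defect t = 0)) as [E0|N]; [exact E0|]. exfalso. apply (Cmult_neq_0 (Im t * Im t)%R (halphen_defect t)); [|exact N|exact H].
  intros H0. apply RtoC_inj in H0. nra.
Qed.

Lemma halphen (t : C) : upper t -> dell4 t = 2 * (ell4 t * ell4 t) - ipi * ipi / 8 * (theta2 t ^ 4 * theta3 t ^ 4).
Proof. intros Ht. assert (H := halphen_defect_zero t Ht). unfold halphen_defect in H. replace (dell4 t) with (dell4 t - 0) by ring. rewrite <- H. ring. Qed.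

(** * The Weierstrass function *)

Definition zn (m : Z) : R := (1 + Rabs (IZR m))%R.
Lemma zn_ge_1 (m : Z) : (1 <= zn m)%R.
Proof. unfold zn. generalize (Rabs_pos (IZR m)). lra. Qed.

(** The exponent 3/2 is half of 3: the inverse cube of a lattice norm is bounded by a product of two
    such weights, each still summable over Z. Iterated lattice sums thus reduce to one-dimensional
    ones. *)
Definition a32 (m : Z) : R := (/ (zn m * sqrt (zn m)))%R.

(** After a shift, comparison with the telescoping series of 2/sqrt(n+1) - 2/sqrt(n+2). *)
Lemma ex_series_inv_32 : ex_series (fun n => / ((INR n + 1) * sqrt (INR n + 1)))%R.
Proof.
  apply (ex_series_incr_1 (K := R_AbsRing) (V := R_NormedModule)).
  set (b := fun n : nat => (2 * (/ sqrt (INR n + 1) - / sqrt (INR n + 2)))%R).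
  assert (Hs : forall n : nat, (0 < sqrt (INR n + 1) <= sqrt (INR n + 2))%R).
  { intros n. assert (Hn := pos_INR n). split; [apply sqrt_lt_R0; lra|apply sqrt_le_1; lra]. }
  assert (Hb : forall n, (/ ((INR (S n) + 1) * sqrt (INR (S n) + 1)) <= b n)%R).
  { intros n. rewrite S_INR. replace (INR n + 1 + 1)%R with (INR n + 2)%R by ring. unfold b. assert (Hn := pos_INR n).
    destruct (Hs n) as [H1 H2].
    assert (E1 : (sqrt (INR n + 1) * sqrt (INR n + 1) = INR n + 1)%R) by (apply sqrt_sqrt; lra).
    assert (E2 : (sqrt (INR n + 2) * sqrt (INR n + 2) = INR n + 2)%R) by (apply sqrt_sqrt; lra).
    set (p := sqrt (INR n + 1)) in *. set (q := sqrt (INR n + 2)) in *. rewrite <- E2.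
    replace (2 * (/ p - / q))%R with (2 * (q - p) / (p * q))%R by (field; lra).
    assert (Epq : ((q - p) * (q + p) = 1)%R) by nra.
    apply Rmult_le_reg_r with (q * q * q * p)%R; [repeat apply Rmult_lt_0_compat; lra|].
    replace (/ (q * q * q) * (q * q * q * p))%R with p by (field; lra).
    replace (2 * (q - p) / (p * q) * (q * q * q * p))%R with (2 * (q - p) * q * q)%R by (field; lra).
    assert (1 <= 2 * (q - p) * q)%R by nra. nra. }
  apply ex_series_Rle with b.
  { intros n. rewrite Rabs_pos_eq; [apply Hb|]. left. apply Rinv_0_lt_compat. rewrite S_INR. assert (Hn := pos_INR n).
    apply Rmult_lt_0_compat; [lra|]. apply sqrt_lt_R0. lra. }
  assert (Hsum : forall n, sum_n b n = (2 * (1 - / sqrt (INR n + 2)))%R).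
  { induction n as [|n IH].
    - rewrite sum_O. unfold b. simpl. rewrite Rplus_0_l, sqrt_1. replace (0 + 2)%R with 2%R by ring. field. apply Rgt_not_eq, sqrt_lt_R0. lra.
    - rewrite sum_Sn, IH. unfold b. rewrite S_INR. change plus with Rplus. replace (INR n + 1 + 1)%R with (INR n + 2)%R by ring.
      replace (INR n + 1 + 2)%R with (INR n + 3)%R by ring.
      match goal with |- ?a = ?b => change (@eq R a b) end. ring. }
  assert (Hlim : ex_finite_lim_seq (sum_n b)).
  { apply ex_finite_lim_seq_incr with 2%R.
    - intros n. rewrite sum_Sn. change plus with Rplus. specialize (Hb (S n)).
      assert (0 < / ((INR (S (S n)) + 1) * sqrt (INR (S (S n)) + 1)))%R.
      { apply Rinv_0_lt_compat. assert (Hn := pos_INR (S (S n))). apply Rmult_lt_0_compat; [lra|]. apply sqrt_lt_R0. lra. }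
      lra.
    - intros n. rewrite Hsum. assert (0 < / sqrt (INR n + 2))%R. { apply Rinv_0_lt_compat. destruct (Hs n). lra. } lra. }
  destruct Hlim as [l Hl]. exists l. exact Hl.
Qed.

Lemma exZ_a32 : exZ a32.
Proof.
  split.
  - apply (ex_series_ext (fun n => / ((INR n + 1) * sqrt (INR n + 1)))%R); [|apply ex_series_inv_32].
    intros n. unfold a32, zn. rewrite <- INR_IZR_INZ, Rabs_pos_eq by apply pos_INR. rewrite (Rplus_comm 1). reflexivity.
  - apply (ex_series_Rle _ (fun n => / ((INR n + 1) * sqrt (INR n + 1)))%R); [|apply ex_series_inv_32].
    intros n. unfold a32, zn, zneg. rewrite minus_IZR, opp_IZR, <- INR_IZR_INZ. assert (Hn := pos_INR n).
    rewrite (Rabs_left1 (- INR n - 1)) by lra. replace (1 + - (- INR n - 1))%R with (INR n + 2)%R by ring.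
    assert (H1 : (0 < sqrt (INR n + 1))%R) by (apply sqrt_lt_R0; lra).
    assert (H2 : (sqrt (INR n + 1) <= sqrt (INR n + 2))%R) by (apply sqrt_le_1; lra).
    rewrite Rabs_pos_eq.
    + apply Rinv_le_contravar; [apply Rmult_lt_0_compat; lra|]. apply Rmult_le_compat; lra.
    + left. apply Rinv_0_lt_compat. apply Rmult_lt_0_compat; lra.
Qed.

Definition norm1 (m n : Z) : R := (1 + Rabs (IZR m) + Rabs (IZR n))%R.
Lemma norm1_ge_1 (m n : Z) : (1 <= norm1 m n)%R.
Proof. unfold norm1. generalize (Rabs_pos (IZR m)) (Rabs_pos (IZR n)). lra. Qed.

Lemma a32_pos (m : Z) : (0 < a32 m)%R.
Proof.
  unfold a32. apply Rinv_0_lt_compat. assert (H := zn_ge_1 m). apply Rmult_lt_0_compat; [lra|apply sqrt_lt_R0; lra].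
Qed.

(** The inequality (1 + |m|) (1 + |n|) <= (1 + |m| + |n|)^2, raised to the power 3/2. *)
Lemma norm1_cube (m n : Z) : (/ (norm1 m n * norm1 m n * norm1 m n) <= a32 m * a32 n)%R.
Proof.
  assert (H := norm1_ge_1 m n). unfold a32. assert (Hm := zn_ge_1 m). assert (Hn := zn_ge_1 n).
  assert (Sm : (0 < sqrt (zn m))%R) by (apply sqrt_lt_R0; lra). assert (Sn : (0 < sqrt (zn n))%R) by (apply sqrt_lt_R0; lra).
  rewrite <- Rinv_mult.
  assert (Hmn : (zn m * zn n <= norm1 m n * norm1 m n)%R).
  { unfold zn, norm1. generalize (Rabs_pos (IZR m)) (Rabs_pos (IZR n)). nra. }
  assert (Hs : (sqrt (zn m) * sqrt (zn n) <= norm1 m n)%R).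
  { rewrite <- sqrt_mult by lra. rewrite <- (sqrt_square (norm1 m n)) by lra. apply sqrt_le_1; nra. }
  apply Rinv_le_contravar.
  - repeat apply Rmult_lt_0_compat; lra.
  - replace (zn m * sqrt (zn m) * (zn n * sqrt (zn n)))%R with ((zn m * zn n) * (sqrt (zn m) * sqrt (zn n)))%R by ring.
    apply Rmult_le_compat; try lra; apply Rmult_le_pos; lra.
Qed.

Section Lattice.
Variables w1 w2 : C.

(** The Boolean [e] marks the lattice points left out: the origin, or the origin together with one
    point whose pole is to be isolated. *)
Definition lattice_term (e : Z -> Z -> bool) (m n : Z) (z : C) : C :=
  if e m n then 0 else 1 / (z - lattice_point w1 w2 m n) ^ 2 - 1 / lattice_point w1 w2 m n ^ 2.
Definition lattice_term' (e : Z -> Z -> bool) (z : C) (m n : Z) : C :=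
  if e m n then 0 else - (2) / (z - lattice_point w1 w2 m n) ^ 3.
Definition lattice_sum (e : Z -> Z -> bool) (z : C) : C := CSeriesZ (fun m => CSeriesZ (fun n => lattice_term e m n z)).
Definition lattice_sum' (e : Z -> Z -> bool) (z : C) : C := CSeriesZ (fun m => CSeriesZ (fun n => lattice_term' e z m n)).

(** A single constant bounds both z - w and w from below by the size of the index, for every lattice
    point w that is kept; the estimates of the lattice sums depend on z only through k and |z|. *)
Definition sep (e : Z -> Z -> bool) (z : C) (k : R) : Prop := forall m n, e m n = false ->
  (k * norm1 m n <= Cmod (z - lattice_point w1 w2 m n))%R /\ (k * norm1 m n <= Cmod (lattice_point w1 w2 m n))%R.

Definition A32 : R := SeriesZ a32.
Lemma A32_pos : (0 <= A32)%R.
Proof. apply SeriesZ_nonneg; [|apply exZ_a32]. intros m. left. apply a32_pos. Qed.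

Lemma double_dom (f : Z -> Z -> C) (K : R) : (0 <= K)%R -> (forall m n, (Cmod (f m n) <= K * / (norm1 m n * norm1 m n * norm1 m n))%R) ->
  (forall m, absZ (f m)) /\ absZ (fun m => CSeriesZ (f m)) /\ (Cmod (CSeriesZ (fun m => CSeriesZ (f m))) <= K * (A32 * A32))%R.
Proof.
  intros HK H.
  assert (H' : forall m n, (Cmod (f m n) <= K * a32 m * a32 n)%R).
  { intros m n. eapply Rle_trans; [apply H|]. rewrite (Rmult_assoc K (a32 m)). apply Rmult_le_compat_l; [exact HK|apply norm1_cube]. }
  assert (H1 : forall m, (Cmod (CSeriesZ (f m)) <= K * A32 * a32 m)%R).
  { intros m. replace (K * A32 * a32 m)%R with ((K * a32 m) * A32)%R by ring. unfold A32. rewrite <- SeriesZ_scal.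
    apply CSeriesZ_bound; [apply H'|apply exZ_scal, exZ_a32]. }
  repeat split.
  - apply (absZ_le (f m) (fun n => K * a32 m * a32 n)%R); [apply H'|apply exZ_scal, exZ_a32].
  - apply (absZ_le (f m) (fun n => K * a32 m * a32 n)%R); [apply H'|apply exZ_scal, exZ_a32].
  - apply (absZ_le _ _ H1). apply exZ_scal, exZ_a32.
  - apply (absZ_le _ _ H1). apply exZ_scal, exZ_a32.
  - rewrite <- Rmult_assoc. unfold A32 at 2. rewrite <- SeriesZ_scal. apply CSeriesZ_bound; [exact H1|apply exZ_scal, exZ_a32].
Qed.

Lemma sep_cube (k N x : R) : (0 < k)%R -> (1 <= N)%R -> (k * N <= x)%R -> (/ (x * x * x) <= / (k * k * k) * / (N * N * N))%R.
Proof.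
  intros Hk HN Hx. rewrite <- Rinv_mult. assert (H0 : (0 < k * N)%R) by (apply Rmult_lt_0_compat; lra).
  apply Rinv_le_contravar; [repeat apply Rmult_lt_0_compat; lra|].
  replace (k * k * k * (N * N * N))%R with ((k * N) * (k * N) * (k * N))%R by ring.
  apply Rmult_le_compat; try lra; [nra|]. apply Rmult_le_compat; lra.
Qed.

Lemma lattice_term'_bound (e : Z -> Z -> bool) (z : C) (k : R) : (0 < k)%R -> sep e z k -> forall m n,
  (Cmod (lattice_term' e z m n) <= (2 * / (k * k * k)) * / (norm1 m n * norm1 m n * norm1 m n))%R.
Proof.
  intros Hk Hs m n. unfold lattice_term'. assert (HN := norm1_ge_1 m n).
  assert (Hp : (0 < / (k * k * k) * / (norm1 m n * norm1 m n * norm1 m n))%R).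
  { apply Rmult_lt_0_compat; apply Rinv_0_lt_compat; repeat apply Rmult_lt_0_compat; lra. }
  destruct (e m n) eqn:Ee; [rewrite Cmod_0; lra|]. destruct (Hs m n Ee) as [H1 _].
  set (u := z - lattice_point w1 w2 m n) in *. assert (Hkn : (0 < k * norm1 m n)%R) by (apply Rmult_lt_0_compat; lra).
  assert (Hu : u <> 0) by (apply Cmod_gt_0; lra).
  rewrite Cmod_div, Cmod_opp, Cmod_R, Rabs_pos_eq, Cmod_pow by (lra || (apply Cpow_nz, Hu)).
  unfold Rdiv. rewrite Rmult_assoc. apply Rmult_le_compat_l; [lra|].
  simpl. rewrite Rmult_1_r, <- Rmult_assoc. apply sep_cube; assumption.
Qed.

Lemma lattice_term_bound (e : Z -> Z -> bool) (z : C) (k : R) : (0 < k)%R -> sep e z k -> forall m n,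
  (Cmod (lattice_term e m n z) <= (2 * Cmod z * / (k * k * k)) * / (norm1 m n * norm1 m n * norm1 m n))%R.
Proof.
  intros Hk Hs m n. unfold lattice_term. assert (HN := norm1_ge_1 m n). assert (Hz := Cmod_ge_0 z).
  assert (Hp : (0 < / (k * k * k) * / (norm1 m n * norm1 m n * norm1 m n))%R).
  { apply Rmult_lt_0_compat; apply Rinv_0_lt_compat; repeat apply Rmult_lt_0_compat; lra. }
  destruct (e m n) eqn:Ee; [rewrite Cmod_0; nra|]. destruct (Hs m n Ee) as [H1 H2].
  set (w := lattice_point w1 w2 m n) in *. assert (Hkn : (0 < k * norm1 m n)%R) by (apply Rmult_lt_0_compat; lra).
  assert (Hu : z - w <> 0) by (apply Cmod_gt_0; lra). assert (Hw : w <> 0) by (apply Cmod_gt_0; lra).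
  replace (1 / (z - w) ^ 2 - 1 / w ^ 2) with (z * (w + - (z - w)) * / ((z - w) ^ 2 * w ^ 2)) by (field; split; assumption).
  rewrite !Cmod_mult, Cmod_inv, Cmod_mult, !Cmod_pow by (apply Cmult_neq_0; apply Cpow_nz; assumption).
  set (p := Cmod (z - w)) in *. set (q := Cmod w) in *. set (N := norm1 m n) in *. set (B := (k * N)%R) in *.
  assert (Htri : (Cmod (w + - (z - w)) <= q + p)%R).
  { eapply Rle_trans; [apply Cmod_triangle|]. rewrite Cmod_opp. apply Rle_refl. }
  apply Rle_trans with (Cmod z * (q + p) * / (p ^ 2 * q ^ 2))%R.
  { apply Rmult_le_compat_r; [left; apply Rinv_0_lt_compat; apply Rmult_lt_0_compat; apply pow_lt; lra|]. apply Rmult_le_compat_l; lra. }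
  replace (Cmod z * (q + p) * / (p ^ 2 * q ^ 2))%R with (Cmod z * (/ (p * p * q) + / (p * q * q)))%R by (field; lra).
  replace (2 * Cmod z * / (k * k * k) * / (N * N * N))%R with (Cmod z * (/ (B * B * B) + / (B * B * B)))%R by (unfold B; field; lra).
  apply Rmult_le_compat_l; [lra|].
  apply Rplus_le_compat; (apply Rinv_le_contravar; [repeat apply Rmult_lt_0_compat; lra|]);
  (apply Rmult_le_compat; try lra; [nra|apply Rmult_le_compat; lra]).
Qed.

Lemma lattice_term_qexp (e : Z -> Z -> bool) (z : C) (k : R) : (0 < k)%R -> sep e z k -> forall m n,
  qexp (lattice_term e m n) z (lattice_term' e z m n) (k / 2) ((16 * / (k * k * k * k)) * / (norm1 m n * norm1 m n * norm1 m n))%R.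
Proof.
  intros Hk Hs m n h Hh. unfold lattice_term, lattice_term'. assert (HN := norm1_ge_1 m n). assert (Hh0 := Cmod_ge_0 h).
  assert (Hp : (0 < / (k * k * k * k) * / (norm1 m n * norm1 m n * norm1 m n))%R).
  { apply Rmult_lt_0_compat; apply Rinv_0_lt_compat; repeat apply Rmult_lt_0_compat; lra. }
  destruct (e m n) eqn:Ee. { replace (0 - 0 - 0 * h) with (RtoC 0) by ring. rewrite Cmod_0. apply Rmult_le_pos; [rewrite Rmult_assoc; lra|nra]. }
  destruct (Hs m n Ee) as [H1 H2].
  set (w := lattice_point w1 w2 m n) in *. assert (Hkn : (k <= k * norm1 m n)%R) by nra.
  assert (Hu : z - w <> 0) by (apply Cmod_gt_0; lra). assert (Hw : w <> 0) by (apply Cmod_gt_0; lra).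
  set (N := norm1 m n) in *. set (u := z - w) in *.
  assert (Hlow : (Cmod u / 2 <= Cmod (u + h))%R).
  { assert (H3 := Cmod_triangle_rev u (- h)). rewrite Cmod_opp in H3. replace (u - - h) with (u + h) in H3 by ring. lra. }
  assert (Huh : u + h <> 0) by (apply Cmod_gt_0; lra).
  replace (z + h - w) with (u + h) by (unfold u; ring).
  replace (1 / (u + h) ^ 2 - 1 / w ^ 2 - (1 / u ^ 2 - 1 / w ^ 2) - - (2) / u ^ 3 * h) with ((h * h) * (3 * u + 2 * h) * / (u ^ 3 * (u + h) ^ 2))
    by (field; repeat split; assumption).
  rewrite !Cmod_mult, Cmod_inv, Cmod_mult, !Cmod_pow by (apply Cmult_neq_0; apply Cpow_nz; assumption).
  set (p := Cmod u) in *.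
  assert (Hpn : (k * N <= p)%R) by exact H1.
  (* With |h| < k/2 <= |u|/2, the factor 3 u + 2 h is at most 4 |u| and |u + h| >= |u|/2, which
     gives 16/|u|^4; one factor 1/|u| is then spent as 1/k. *)
  apply Rle_trans with (Cmod h * Cmod h * (4 * p) * / (p ^ 3 * (p / 2) ^ 2))%R.
  - apply Rmult_le_compat.
    + apply Rmult_le_pos; [nra|apply Cmod_ge_0].
    + left. apply Rinv_0_lt_compat, Rmult_lt_0_compat; apply pow_lt; lra.
    + apply Rmult_le_compat_l; [nra|]. eapply Rle_trans; [apply Cmod_triangle|]. rewrite !Cmod_mult, !Cmod_R, !Rabs_pos_eq by lra. fold p. lra.
    + apply Rinv_le_contravar; [apply Rmult_lt_0_compat; apply pow_lt; lra|]. apply Rmult_le_compat_l; [apply pow_le; lra|]. apply pow_incr. lra.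
  - replace (Cmod h * Cmod h * (4 * p) * / (p ^ 3 * (p / 2) ^ 2))%R with ((16 * (/ (p * p * p) * / p)) * (Cmod h * Cmod h))%R by (field; lra).
    apply Rmult_le_compat_r; [nra|]. rewrite (Rmult_assoc 16). apply Rmult_le_compat_l; [lra|].
    replace (/ (k * k * k * k) * / (N * N * N))%R with ((/ (k * k * k) * / (N * N * N)) * / k)%R by (field; lra).
    apply Rmult_le_compat.
    + left. apply Rinv_0_lt_compat. repeat apply Rmult_lt_0_compat; lra.
    + left. apply Rinv_0_lt_compat. lra.
    + apply sep_cube; assumption.
    + apply Rinv_le_contravar; lra.
Qed.

Lemma lattice_sum_cderiv (e : Z -> Z -> bool) (z : C) (k : R) : (0 < k)%R -> sep e z k -> cderiv (lattice_sum e) z (lattice_sum' e z).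
Proof.
  intros Hk Hs.
  assert (Hz := Cmod_ge_0 z).
  assert (Hk3 : (0 < / (k * k * k))%R) by (apply Rinv_0_lt_compat; repeat apply Rmult_lt_0_compat; lra).
  assert (HK1 : (0 <= 2 * Cmod z * / (k * k * k))%R) by (apply Rmult_le_pos; lra).
  assert (HK2 : (0 <= 2 * / (k * k * k))%R) by lra.
  destruct (double_dom (fun m n => lattice_term e m n z) _ HK1 (lattice_term_bound e z k Hk Hs)) as [B1 [B2 _]].
  destruct (double_dom (fun m n => lattice_term' e z m n) _ HK2 (lattice_term'_bound e z k Hk Hs)) as [B3 [B4 _]].
  set (K := (16 * / (k * k * k * k))%R).
  assert (HK : (0 <= K)%R). { unfold K. apply Rmult_le_pos; [lra|]. left. apply Rinv_0_lt_compat. repeat apply Rmult_lt_0_compat; lra. }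
  apply (qexp_cderiv _ _ _ (k / 2)%R (SeriesZ (fun m => SeriesZ (fun n => K * / (norm1 m n * norm1 m n * norm1 m n))))%R); [lra|].
  assert (Ep : forall m n, (0 <= K * / (norm1 m n * norm1 m n * norm1 m n) <= K * a32 m * a32 n)%R).
  { intros m n. split.
    - apply Rmult_le_pos; [exact HK|]. left. apply Rinv_0_lt_compat. assert (HN := norm1_ge_1 m n). repeat apply Rmult_lt_0_compat; lra.
    - rewrite (Rmult_assoc K (a32 m)). apply Rmult_le_compat_l; [exact HK|apply norm1_cube]. }
  assert (EI : forall m, exZ (fun n => K * / (norm1 m n * norm1 m n * norm1 m n))%R).
  { intros m. apply (exZ_le _ (fun n => K * a32 m * a32 n)%R); [apply Ep|]. apply exZ_scal, exZ_a32. }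
  apply (CSeriesZ_qexp (fun m z => CSeriesZ (fun n => lattice_term e m n z)) z (fun m => CSeriesZ (fun n => lattice_term' e z m n))).
  - intros m. apply (CSeriesZ_qexp (fun n => lattice_term e m n)); [intros n; apply lattice_term_qexp; assumption|apply EI|apply B1|apply B3].
  - apply (exZ_le _ (fun m => K * A32 * a32 m)%R); [|apply exZ_scal, exZ_a32]. intros m. split.
    + apply SeriesZ_nonneg; [apply Ep|apply EI].
    + replace (K * A32 * a32 m)%R with ((K * a32 m) * A32)%R by ring. unfold A32. rewrite <- SeriesZ_scal.
      destruct (EI m) as [I1 I2]. destruct (exZ_scal (K * a32 m) a32 exZ_a32) as [J1 J2].
      apply Rplus_le_compat; apply Series_le; try assumption; intros n; apply Ep.
  - exact B2.
  - exact B4.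
Qed.

Lemma lattice_sum_bound (e : Z -> Z -> bool) (z : C) (k : R) : (0 < k)%R -> sep e z k ->
  (Cmod (lattice_sum e z) <= 2 * Cmod z * / (k * k * k) * (A32 * A32))%R /\ (Cmod (lattice_sum' e z) <= 2 * / (k * k * k) * (A32 * A32))%R.
Proof.
  intros Hk Hs. assert (Hz := Cmod_ge_0 z).
  assert (Hk3 : (0 < / (k * k * k))%R) by (apply Rinv_0_lt_compat; repeat apply Rmult_lt_0_compat; lra). split.
  - apply (double_dom (fun m n => lattice_term e m n z)); [apply Rmult_le_pos; lra|apply lattice_term_bound; assumption].
  - apply (double_dom (fun m n => lattice_term' e z m n)); [lra|apply lattice_term'_bound; assumption].
Qed.
End Lattice.

(** * Separation from the lattice, and poles *)

Definition is_origin (m n : Z) : bool := ((m =? 0) && (n =? 0))%Z%bool.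
Definition is_origin_or (m0 n0 m n : Z) : bool := (is_origin m n || ((m =? m0) && (n =? n0))%Z)%bool.

Lemma is_origin_false (m n : Z) : is_origin m n = false -> m <> 0%Z \/ n <> 0%Z.
Proof. unfold is_origin. intros H. apply Bool.andb_false_iff in H. rewrite !Z.eqb_neq in H. exact H. Qed.
Lemma is_origin_or_false (m0 n0 m n : Z) : is_origin_or m0 n0 m n = false -> is_origin m n = false /\ (m <> m0 \/ n <> n0).
Proof.
  unfold is_origin_or. intros H. apply Bool.orb_false_iff in H. destruct H as [H1 H2]. split; [exact H1|].
  apply Bool.andb_false_iff in H2. rewrite !Z.eqb_neq in H2. exact H2.
Qed.
Lemma Rabs_IZR_ge_1 (m : Z) : m <> 0%Z -> (1 <= Rabs (IZR m))%R.
Proof. intros H. rewrite <- abs_IZR. apply IZR_le. lia. Qed.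

Lemma non_integer_gap (x : R) : (forall m : Z, x <> IZR m) -> exists d, (0 < d)%R /\ forall m : Z, (d <= Rabs (x - IZR m))%R.
Proof.
  intros H. destruct (archimed x) as [H1 H2].
  assert (H3 := H (up x)). assert (H4 := H (up x - 1)%Z). rewrite minus_IZR in H4.
  exists (Rmin (IZR (up x) - x) (x - (IZR (up x) - 1)))%R. split.
  { apply Rmin_glb_lt; [lra|]. destruct (Rle_lt_or_eq_dec (IZR (up x) - 1) x); [lra|lra|]. exfalso. apply H4. symmetry. assumption. }
  intros m. destruct (Z_le_gt_dec (up x) m) as [L|L].
  - eapply Rle_trans; [apply Rmin_l|]. apply IZR_le in L. rewrite Rabs_minus_sym. eapply Rle_trans; [|apply Rle_abs]. lra.
  - eapply Rle_trans; [apply Rmin_r|]. assert (L' : (m <= up x - 1)%Z) by lia. apply IZR_le in L'. rewrite minus_IZR in L'.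
    eapply Rle_trans; [|apply Rle_abs]. lra.
Qed.

Section Lattice.
Variables w1 w2 : C.
Hypothesis Him : Im (w2 * Cconj w1) <> 0%R.

Let J := Im (w2 * Cconj w1).

(** For z = x w1 + y w2 the coordinates are y = Im (z conj w1) / J and x = - Im (z conj w2) / J, so
    both are bounded by |z| times a constant. *)
Lemma lattice_lower : exists c, (0 < c)%R /\ forall x y : R, (c * (Rabs x + Rabs y) <= Cmod (x * w1 + y * w2))%R.
Proof.
  assert (HJ : (0 < Rabs J)%R) by (apply Rabs_pos_lt, Him).
  assert (Hs : (0 < Cmod w1 + Cmod w2)%R).
  { assert (H1 := Cmod_ge_0 w1). assert (H2 := Cmod_ge_0 w2). destruct (Req_dec (Cmod w1) 0) as [E0|N]; [|lra].
    exfalso. apply Cmod_eq_0 in E0. apply Him. rewrite E0. simpl. ring. }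
  exists (Rabs J / (Cmod w1 + Cmod w2))%R. split; [apply Rdiv_lt_0_compat; lra|]. intros x y. set (z := x * w1 + y * w2).
  assert (E1 : (Im (z * Cconj w1) = y * J)%R) by (unfold z, J; destruct w1, w2; simpl; ring).
  assert (E2 : (Im (z * Cconj w2) = - (x * J))%R) by (unfold z, J; destruct w1, w2; simpl; ring).
  assert (B1 : (Rabs y * Rabs J <= Cmod z * Cmod w1)%R).
  { rewrite <- Rabs_mult, <- E1, <- (Cmod_conj w1), <- Cmod_mult. apply Im_le_Cmod. }
  assert (B2 : (Rabs x * Rabs J <= Cmod z * Cmod w2)%R).
  { rewrite <- Rabs_mult, <- Rabs_Ropp, <- E2, <- (Cmod_conj w2), <- Cmod_mult. apply Im_le_Cmod. }
  apply Rmult_le_reg_r with (Cmod w1 + Cmod w2)%R; [exact Hs|].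
  replace (Rabs J / (Cmod w1 + Cmod w2) * (Rabs x + Rabs y) * (Cmod w1 + Cmod w2))%R with (Rabs J * (Rabs x + Rabs y))%R by (field; lra). lra.
Qed.

Lemma lattice_coords (z : C) : exists x y : R, z = x * w1 + y * w2.
Proof.
  exists (- Im (z * Cconj w2) / J)%R, (Im (z * Cconj w1) / J)%R.
  unfold J in *. destruct z as [a b], w1 as [p q], w2 as [r s]. simpl in *.
  unfold RtoC, Cmult, Cplus. simpl. f_equal; field; intros H; apply Him; lra.
Qed.

(** The first entry serves nonzero lattice points, where |m| + |n| >= 1 is at least half of [norm1].
    The second serves their differences with z: at coordinate distance D >= d, [norm1] is at most B
    + D <= (B/d + 1) D. *)
Definition lat_k (c B d : R) : R := Rmin (c / 2) (c / (B / d + 1)).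

Lemma lat_k_pos (c B d : R) : (0 < c)%R -> (0 < B)%R -> (0 < d)%R -> (0 < lat_k c B d)%R.
Proof.
  intros Hc HB Hd. assert (0 < B / d)%R by (apply Rdiv_lt_0_compat; lra). apply Rmin_glb_lt; [lra|apply Rdiv_lt_0_compat; lra].
Qed.

Lemma sep_intro (c B d x y : R) (e : Z -> Z -> bool) :
  (0 < c)%R -> (forall x y : R, (c * (Rabs x + Rabs y) <= Cmod (x * w1 + y * w2))%R) ->
  (0 < d)%R -> (1 + Rabs x + Rabs y <= B)%R -> (forall m n, e m n = false -> is_origin m n = false) ->
  (forall m n, e m n = false -> (d <= Rabs (x - IZR m) + Rabs (y - IZR n))%R) ->
  sep w1 w2 e (x * w1 + y * w2) (lat_k c B d).
Proof.
  intros Hc Hlow Hd HB He Hdist m n Hmn. assert (HN := norm1_ge_1 m n).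
  assert (HB0 : (0 < B)%R) by (generalize (Rabs_pos x) (Rabs_pos y); lra).
  assert (HBd : (0 < B / d)%R) by (apply Rdiv_lt_0_compat; lra).
  split.
  - set (D := (Rabs (x - IZR m) + Rabs (y - IZR n))%R). assert (HD : (d <= D)%R) by (apply Hdist, Hmn).
    replace (x * w1 + y * w2 - lattice_point w1 w2 m n) with ((x - IZR m)%R * w1 + (y - IZR n)%R * w2)
      by (unfold lattice_point; rewrite !RtoC_minus; ring).
    apply Rle_trans with (c * D)%R; [|apply Hlow].
    apply Rle_trans with (c / (B / d + 1) * norm1 m n)%R; [apply Rmult_le_compat_r; [lra|apply Rmin_r]|].
    assert (Hn1 : (norm1 m n <= B + D)%R).
    { unfold norm1, D. assert (H1 := Rabs_triang x (- (x - IZR m))). assert (H2 := Rabs_triang y (- (y - IZR n))).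
      rewrite Rabs_Ropp in H1, H2. replace (x + - (x - IZR m))%R with (IZR m) in H1 by ring. replace (y + - (y - IZR n))%R with (IZR n) in H2 by ring. lra. }
    assert (HB2 : (B <= B / d * D)%R).
    { replace B with (B / d * d)%R at 1 by (field; lra). apply Rmult_le_compat_l; lra. }
    apply Rle_trans with (c / (B / d + 1) * ((B / d + 1) * D))%R.
    + apply Rmult_le_compat_l; [left; apply Rdiv_lt_0_compat; lra|lra].
    + right. field. lra.
  - apply Rle_trans with (c / 2 * norm1 m n)%R; [apply Rmult_le_compat_r; [lra|apply Rmin_l]|].
    eapply Rle_trans; [|apply (Hlow (IZR m) (IZR n))].
    assert (H1 : (1 <= Rabs (IZR m) + Rabs (IZR n))%R).
    { destruct (is_origin_false m n (He m n Hmn)) as [H|H]; apply Rabs_IZR_ge_1 in H; generalize (Rabs_pos (IZR m)) (Rabs_pos (IZR n)); lra. }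
    unfold norm1. nra.
Qed.

Lemma sep_off_lattice (z : C) : ~ in_lattice w1 w2 z -> exists k, (0 < k)%R /\ sep w1 w2 is_origin z k.
Proof.
  intros Hz. destruct lattice_lower as [c [Hc Hlow]]. destruct (lattice_coords z) as [x [y ->]].
  assert (Hd : exists d, (0 < d)%R /\ forall m n : Z, (d <= Rabs (x - IZR m) + Rabs (y - IZR n))%R).
  { destruct (classic (forall m : Z, x <> IZR m)) as [H|H].
    - destruct (non_integer_gap x H) as [d [Hd H1]]. exists d. split; [exact Hd|]. intros m n. specialize (H1 m).
      generalize (Rabs_pos (y - IZR n)). lra.
    - destruct (classic (forall n : Z, y <> IZR n)) as [H'|H'].
      + destruct (non_integer_gap y H') as [d [Hd H1]]. exists d. split; [exact Hd|]. intros m n. specialize (H1 n).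
        generalize (Rabs_pos (x - IZR m)). lra.
      + exfalso. apply not_all_ex_not in H. destruct H as [m Hm]. apply NNPP in Hm.
        apply not_all_ex_not in H'. destruct H' as [n Hn]. apply NNPP in Hn. apply Hz. exists m, n. rewrite Hm, Hn. reflexivity. }
  destruct Hd as [d [Hd H]]. set (B := (1 + Rabs x + Rabs y)%R).
  exists (lat_k c B d). split.
  - apply lat_k_pos; auto. unfold B. generalize (Rabs_pos x) (Rabs_pos y). lra.
  - apply sep_intro; auto. unfold B. lra.
Qed.

Lemma wp_lattice_sum (z : C) : weierstrass_p w1 w2 z = 1 / z ^ 2 + lattice_sum w1 w2 is_origin z.
Proof. reflexivity. Qed.

Lemma in_lattice_0 : in_lattice w1 w2 0.
Proof. exists 0%Z, 0%Z. unfold lattice_point. ring. Qed.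

Lemma wp_cderiv (z : C) : ~ in_lattice w1 w2 z -> cderiv (weierstrass_p w1 w2) z (- (2) / z ^ 3 + lattice_sum' w1 w2 is_origin z).
Proof.
  intros Hz. destruct (sep_off_lattice z Hz) as [k [Hk Hs]].
  assert (Hz0 : z <> 0). { intros ->. apply Hz, in_lattice_0. }
  apply (cderiv_ext (fun z => 1 / z ^ 2 + lattice_sum w1 w2 is_origin z)); [intros; reflexivity|].
  apply cderiv_plus; [|apply (lattice_sum_cderiv w1 w2 is_origin z k Hk Hs)].
  eapply cderiv_eq.
  - apply (cderiv_div (fun _ => 1) (fun z => z ^ 2)); [apply cderiv_const|apply (cderiv_pow (fun z => z) z 1 2), cderiv_id|apply Cpow_nz, Hz0].
  - simpl. replace (RtoC (1 + 1)) with (RtoC 2) by (f_equal; ring). field. exact Hz0.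
Qed.

Lemma off_lattice_open (z : C) : ~ in_lattice w1 w2 z ->
  exists d, (0 < d)%R /\ forall w, (Cmod (w - z) < d)%R -> ~ in_lattice w1 w2 w.
Proof.
  intros Hz. destruct (sep_off_lattice z Hz) as [k [Hk Hs]].
  assert (Hz0 : z <> 0). { intros ->. apply Hz, in_lattice_0. } apply Cmod_gt_0 in Hz0.
  exists (Rmin k (Cmod z)). split; [apply Rmin_glb_lt; assumption|]. intros w Hw [m [n E]].
  assert (H1 := Rlt_le_trans _ _ _ Hw (Rmin_l _ _)). assert (H2 := Rlt_le_trans _ _ _ Hw (Rmin_r _ _)).
  destruct (is_origin m n) eqn:Ee.
  - unfold is_origin in Ee. apply andb_prop in Ee. rewrite !Z.eqb_eq in Ee. destruct Ee as [-> ->].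
    replace w with (RtoC 0) in H2. { replace (0 - z) with (- z) in H2 by ring. rewrite Cmod_opp in H2. lra. }
    rewrite E. unfold lattice_point. ring.
  - destruct (Hs m n Ee) as [H3 _]. rewrite <- E, Cmod_minus_sym in H3. assert (HN := norm1_ge_1 m n). nra.
Qed.

Lemma sep_near (m0 n0 : Z) (e : Z -> Z -> bool) : (forall m n, e m n = false -> is_origin m n = false /\ (m <> m0 \/ n <> n0)) ->
  exists r k, (0 < r)%R /\ (0 < k)%R /\ forall z, (Cmod (z - lattice_point w1 w2 m0 n0) < r)%R -> sep w1 w2 e z k.
Proof.
  intros He. destruct lattice_lower as [c [Hc Hlow]].
  (* Within c/2 the coordinates differ from (m0, n0) by at most 1/2 in sum, so every other lattice
     point stays at coordinate distance at least 1/2. *)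
  exists (c / 2)%R, (lat_k c (3 + Rabs (IZR m0) + Rabs (IZR n0)) (/ 2)). split; [lra|]. split.
  { apply lat_k_pos; auto; [|lra]. generalize (Rabs_pos (IZR m0)) (Rabs_pos (IZR n0)). lra. }
  intros z Hz. destruct (lattice_coords z) as [x [y ->]].
  assert (Hxy : (Rabs (x - IZR m0) + Rabs (y - IZR n0) <= / 2)%R).
  { replace (x * w1 + y * w2 - lattice_point w1 w2 m0 n0) with ((x - IZR m0)%R * w1 + (y - IZR n0)%R * w2) in Hz
      by (unfold lattice_point; rewrite !RtoC_minus; ring).
    assert (H := Hlow (x - IZR m0)%R (y - IZR n0)%R). apply Rmult_le_reg_l with c; lra. }
  assert (P1 := Rabs_pos (x - IZR m0)). assert (P2 := Rabs_pos (y - IZR n0)).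
  apply sep_intro; auto; [lra| |intros m n H; apply He, H|].
  - assert (H1 := Rabs_triang (x - IZR m0) (IZR m0)). assert (H2 := Rabs_triang (y - IZR n0) (IZR n0)).
    replace (x - IZR m0 + IZR m0)%R with x in H1 by ring. replace (y - IZR n0 + IZR n0)%R with y in H2 by ring. lra.
  - intros m n Hmn. destruct (He m n Hmn) as [_ [H|H]].
    + assert (H1 : (1 <= Rabs (IZR (m - m0)))%R) by (apply Rabs_IZR_ge_1; lia). rewrite minus_IZR in H1.
      assert (H2 := Rabs_triang (x - IZR m0) (- (x - IZR m))). rewrite Rabs_Ropp in H2.
      replace (x - IZR m0 + - (x - IZR m))%R with (IZR m - IZR m0)%R in H2 by ring. generalize (Rabs_pos (y - IZR n)). lra.
    + assert (H1 : (1 <= Rabs (IZR (n - n0)))%R) by (apply Rabs_IZR_ge_1; lia). rewrite minus_IZR in H1.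
      assert (H2 := Rabs_triang (y - IZR n0) (- (y - IZR n))). rewrite Rabs_Ropp in H2.
      replace (y - IZR n0 + - (y - IZR n))%R with (IZR n - IZR n0)%R in H2 by ring. generalize (Rabs_pos (x - IZR m)). lra.
Qed.

Lemma wp_near_0 : exists d K, (0 < d)%R /\ (0 <= K)%R /\ forall z, (Cmod z < d)%R ->
  (z <> 0 -> ~ in_lattice w1 w2 z) /\ (Cmod (lattice_sum w1 w2 is_origin z) <= K)%R /\ (Cmod (lattice_sum' w1 w2 is_origin z) <= K)%R.
Proof.
  destruct (sep_near 0 0 is_origin) as [r [k [Hr [Hk Hs]]]].
  { intros m n H. split; [exact H|apply is_origin_false, H]. }
  assert (Hz0 : lattice_point w1 w2 0 0 = 0) by (unfold lattice_point; ring).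
  set (T := (/ (k * k * k) * (A32 * A32))%R).
  assert (HT : (0 <= T)%R). { apply Rmult_le_pos; [left; apply Rinv_0_lt_compat; repeat apply Rmult_lt_0_compat; lra|]. assert (H := A32_pos). nra. }
  exists r, (2 * (r + 1) * T)%R. split; [exact Hr|]. split; [nra|]. intros z Hz.
  assert (Hs' : sep w1 w2 is_origin z k). { apply Hs. rewrite Hz0. replace (z - 0) with z by ring. exact Hz. }
  destruct (lattice_sum_bound w1 w2 is_origin z k Hk Hs') as [B1 B2]. assert (Hz' := Cmod_ge_0 z). split; [|split].
  - intros Hnz [m [n E]]. destruct (is_origin m n) eqn:Ee.
    + unfold is_origin in Ee. apply andb_prop in Ee. rewrite !Z.eqb_eq in Ee. destruct Ee as [-> ->]. apply Hnz. rewrite E. exact Hz0.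
    + destruct (Hs' m n Ee) as [H3 _]. rewrite <- E in H3. replace (z - z) with (RtoC 0) in H3 by ring. rewrite Cmod_0 in H3.
      assert (HN := norm1_ge_1 m n). nra.
  - eapply Rle_trans; [exact B1|]. replace (2 * Cmod z * / (k * k * k) * (A32 * A32))%R with (2 * Cmod z * T)%R by (unfold T; ring).
    apply Rmult_le_compat_r; lra.
  - eapply Rle_trans; [exact B2|]. replace (2 * / (k * k * k) * (A32 * A32))%R with (2 * T)%R by (unfold T; ring).
    apply Rmult_le_compat_r; lra.
Qed.

(** Makes the pole at one nonzero lattice point explicit; the other terms form a sum that stays
    bounded near that point. *)
Lemma lattice_sum_remove (m0 n0 : Z) (z : C) (k : R) : (0 < k)%R -> sep w1 w2 (is_origin_or m0 n0) z k -> is_origin m0 n0 = false ->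
  lattice_sum w1 w2 is_origin z = lattice_sum w1 w2 (is_origin_or m0 n0) z + (1 / (z - lattice_point w1 w2 m0 n0) ^ 2 - 1 / lattice_point w1 w2 m0 n0 ^ 2).
Proof.
  intros Hk Hs He. set (v := 1 / (z - lattice_point w1 w2 m0 n0) ^ 2 - 1 / lattice_point w1 w2 m0 n0 ^ 2).
  assert (HK1 : (0 <= 2 * Cmod z * / (k * k * k))%R).
  { assert (Hz := Cmod_ge_0 z). apply Rmult_le_pos; [lra|]. left. apply Rinv_0_lt_compat. repeat apply Rmult_lt_0_compat; lra. }
  destruct (double_dom (fun m n => lattice_term w1 w2 (is_origin_or m0 n0) m n z) _ HK1 (lattice_term_bound w1 w2 _ z k Hk Hs)) as [B1 [B2 _]].
  unfold lattice_sum. rewrite (CSeriesZ_ext _ (fun m => CSeriesZ (fun n => lattice_term w1 w2 (is_origin_or m0 n0) m n z) + deltaZ m0 v m)).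
  - rewrite CSeriesZ_plus by (exact B2 || apply CSeriesZ_delta). rewrite (proj2 (CSeriesZ_delta m0 v)). reflexivity.
  - intros m. unfold deltaZ at 1. destruct (Z.eqb_spec m m0) as [->|Hm].
    + rewrite <- (proj2 (CSeriesZ_delta n0 v)). rewrite <- CSeriesZ_plus by (exact (B1 m0) || apply CSeriesZ_delta).
      apply CSeriesZ_ext. intros n. unfold lattice_term, is_origin_or, deltaZ. rewrite Z.eqb_refl, Bool.andb_true_l.
      destruct (Z.eqb_spec n n0) as [->|Hn].
      * rewrite He, Bool.orb_true_r. fold v. ring.
      * rewrite Bool.orb_false_r. ring.
    + rewrite Cplus_0_r. apply CSeriesZ_ext. intros n. unfold lattice_term, is_origin_or.
      destruct (Z.eqb_spec m m0) as [H|_]; [contradiction|]. simpl. rewrite Bool.orb_false_r. reflexivity.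
Qed.

Lemma pole_large (w : C) (B M : R) : exists r, (0 < r)%R /\ forall z g : C, (0 < Cmod (z - w) < r)%R -> (Cmod g <= B)%R ->
  (M <= Cmod (1 / (z - w) ^ 2 + g))%R.
Proof.
  set (P := (Rabs M + Rabs B + 1)%R). assert (HP : (1 <= P)%R) by (unfold P; generalize (Rabs_pos M) (Rabs_pos B); lra).
  exists (/ P)%R. split; [apply Rinv_0_lt_compat; lra|]. intros z g [H1 H2] Hg.
  assert (Hn : z - w <> 0) by (apply Cmod_gt_0; exact H1).
  assert (HL : (P <= Cmod (1 / (z - w) ^ 2))%R).
  { rewrite Cmod_div, Cmod_1, Cmod_pow by (apply Cpow_nz, Hn). apply Rle_div_r; [apply Rlt_gt, pow_lt, H1|].
    set (q := Cmod (z - w)) in *. assert (HPq : (P * q <= 1)%R). { apply Rmult_lt_compat_l with (r := P) in H2; [|lra]. rewrite Rinv_r in H2; lra. }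
    assert (q <= 1)%R by nra. simpl. nra. }
  assert (HT := Cmod_triangle_rev (1 / (z - w) ^ 2) (- g)). rewrite Cmod_opp in HT. replace (1 / (z - w) ^ 2 - - g) with (1 / (z - w) ^ 2 + g) in HT by ring.
  unfold P in HL. generalize (Rle_abs M) (Rle_abs B). lra.
Qed.

(** At the origin 1/z^2 dominates a bounded lattice sum; at another lattice point w its own term is
    singled out and 1/z^2 joins the bounded part. The blow-up is what keeps 2u off the lattice. *)
Lemma wp_pole (w : C) (M : R) : in_lattice w1 w2 w -> exists r, (0 < r)%R /\ forall z, (0 < Cmod (z - w) < r)%R -> (M <= Cmod (weierstrass_p w1 w2 z))%R.
Proof.
  intros [m0 [n0 ->]]. set (w := lattice_point w1 w2 m0 n0). destruct (is_origin m0 n0) eqn:Ee.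
  - assert (Hw : w = 0). { unfold is_origin in Ee. apply andb_prop in Ee. rewrite !Z.eqb_eq in Ee. destruct Ee as [-> ->]. unfold w, lattice_point. ring. }
    destruct wp_near_0 as [d [K [Hd [HK H]]]]. destruct (pole_large w K M) as [r [Hr Hp]].
    exists (Rmin d r). split; [apply Rmin_glb_lt; assumption|]. intros z [Hz1 Hz2].
    assert (H1 := Rlt_le_trans _ _ _ Hz2 (Rmin_l _ _)). assert (H2 := Rlt_le_trans _ _ _ Hz2 (Rmin_r _ _)).
    specialize (Hp z (lattice_sum w1 w2 is_origin z) (conj Hz1 H2)). rewrite Hw in Hp, H1. replace (z - 0) with z in Hp, H1 by ring.
    rewrite wp_lattice_sum. apply Hp. exact (proj1 (proj2 (H z H1))).
  - destruct (sep_near m0 n0 (is_origin_or m0 n0) (is_origin_or_false m0 n0)) as [r1 [k [Hr1 [Hk Hs]]]]. fold w in Hs.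
    assert (Hw0 : w <> 0).
    { destruct lattice_lower as [c [Hc Hlow]]. specialize (Hlow (IZR m0) (IZR n0)). fold (lattice_point w1 w2 m0 n0) in Hlow. fold w in Hlow.
      apply Cmod_gt_0. assert (H1 : (1 <= Rabs (IZR m0) + Rabs (IZR n0))%R).
      { destruct (is_origin_false m0 n0 Ee) as [H|H]; apply Rabs_IZR_ge_1 in H; generalize (Rabs_pos (IZR m0)) (Rabs_pos (IZR n0)); lra. } nra. }
    assert (Hwp : (0 < Cmod w)%R) by (apply Cmod_gt_0, Hw0).
    set (T := (/ (k * k * k) * (A32 * A32))%R).
    assert (HT : (0 <= T)%R). { apply Rmult_le_pos; [left; apply Rinv_0_lt_compat; repeat apply Rmult_lt_0_compat; lra|]. assert (H := A32_pos). nra. }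
    set (Q := Cmod w) in *.
    (* For Q/2 <= |z| <= 2 Q these bound 1/z^2, the remaining lattice sum and 1/w^2. *)
    destruct (pole_large w (4 / (Q * Q) + (2 * (2 * Q) * T + / (Q * Q))) M) as [r2 [Hr2 Hp]].
    exists (Rmin (Q / 2) (Rmin r1 r2)). split; [repeat apply Rmin_glb_lt; lra|]. intros z [Hz1 Hz2].
    assert (H0 := Rlt_le_trans _ _ _ Hz2 (Rmin_l _ _)). assert (H1 := Rlt_le_trans _ _ _ Hz2 (Rle_trans _ _ _ (Rmin_r _ _) (Rmin_l _ _))).
    assert (H2 := Rlt_le_trans _ _ _ Hz2 (Rle_trans _ _ _ (Rmin_r _ _) (Rmin_r _ _))).
    specialize (Hs z H1). destruct (lattice_sum_bound w1 w2 _ z k Hk Hs) as [B1 _].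
    assert (Hz3 : (Q / 2 <= Cmod z <= 2 * Q)%R).
    { assert (A1 := Cmod_triangle_rev w z). rewrite Cmod_minus_sym in A1. assert (A2 := Cmod_triangle_rev z w). fold Q in A1, A2. lra. }
    assert (Hz0 : z <> 0) by (apply Cmod_gt_0; lra).
    rewrite wp_lattice_sum, (lattice_sum_remove m0 n0 z k Hk Hs Ee). fold w.
    replace (1 / z ^ 2 + (lattice_sum w1 w2 (is_origin_or m0 n0) z + (1 / (z - w) ^ 2 - 1 / w ^ 2))) with (1 / (z - w) ^ 2 + (1 / z ^ 2 + (lattice_sum w1 w2 (is_origin_or m0 n0) z + - (1 / w ^ 2)))).
    2: { assert (Hzw : z - w <> 0) by (apply Cmod_gt_0; exact Hz1). field. repeat split; assumption. }
    apply Hp; [split; assumption|]. eapply Rle_trans; [apply Cmod_triangle|]. apply Rplus_le_compat.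
    + rewrite Cmod_div, Cmod_1, Cmod_pow by (apply Cpow_nz, Hz0). replace (4 / (Q * Q))%R with (1 / (Q / 2) ^ 2)%R by (field; lra).
      unfold Rdiv at 1 2. apply Rmult_le_compat_l; [lra|]. apply Rinv_le_contravar; [apply pow_lt; lra|]. apply pow_incr. lra.
    + eapply Rle_trans; [apply Cmod_triangle|]. rewrite Cmod_opp. apply Rplus_le_compat.
      * eapply Rle_trans; [exact B1|]. replace (2 * Cmod z * / (k * k * k) * (A32 * A32))%R with (2 * Cmod z * T)%R by (unfold T; ring).
        apply Rmult_le_compat_r; lra.
      * rewrite Cmod_div, Cmod_1, Cmod_pow by (apply Cpow_nz, Hw0). fold Q. right. field. lra.
Qed.
End Lattice.

(** * The hypergeometric function *)

(** Since r^n = exp (n ln r), the exponential bound with two spare powers compares it with the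
    inverse squares. *)
Lemma ex_series_poly_geom (p : nat) (r : R) : (0 < r < 1)%R -> ex_series (fun n => (1 + INR n) ^ p * r ^ n)%R.
Proof.
  intros Hr. assert (Hs : (0 < - ln r)%R) by (assert (ln r < 0)%R by (rewrite <- ln_1; apply ln_increasing; lra); lra).
  destruct (pow_exp_bound (S (S p)) (- ln r) Hs) as [K [HK H]].
  apply ex_series_Rle with (fun n => K * / (1 + INR n * INR n))%R; [|apply ex_Rscal, ex_series_inv_sq].
  intros n. assert (Hn := pos_INR n). assert (Hp : (0 <= (1 + INR n) ^ p)%R) by (apply pow_le; lra).
  assert (Hrn : (0 < r ^ n)%R) by (apply pow_lt; lra).
  rewrite Rabs_pos_eq by (apply Rmult_le_pos; lra).
  specialize (H (INR n) Hn). replace (exp (- - ln r * INR n)) with (r ^ n)%R in H.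
  2: { rewrite <- Rpower_pow by lra. unfold Rpower. f_equal. ring. }
  apply Rmult_le_reg_r with (1 + INR n * INR n)%R; [nra|].
  rewrite (Rmult_assoc K), Rinv_l, Rmult_1_r by nra. eapply Rle_trans; [|exact H]. simpl.
  replace ((1 + INR n) * ((1 + INR n) * (1 + INR n) ^ p) * r ^ n)%R with ((1 + INR n) ^ p * r ^ n * ((1 + INR n) * (1 + INR n)))%R by ring.
  apply Rmult_le_compat_l; [apply Rmult_le_pos; lra|nra].
Qed.

(** The remainders obey R(n+1) = (x + h) R(n) + n x^(n-1) h^2, and the quadratic factor n^2 absorbs
    the accumulated terms. *)
Lemma Cpow_remainder (x h : C) (r : R) (n : nat) : (0 < r)%R -> (Cmod x <= r)%R -> (Cmod (x + h) <= r)%R ->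
  (Cmod ((x + h) ^ n - x ^ n - INR n * x ^ (pred n) * h) <= INR n * INR n * (r ^ n / (r * r)) * (Cmod h * Cmod h))%R.
Proof.
  intros Hr Hx Hxh. induction n as [|n IH].
  - simpl. replace (1 - 1 - 0 * 1 * h) with (RtoC 0) by ring. rewrite Cmod_0. lra.
  - change (pred (S n)) with n. set (Rn := (x + h) ^ n - x ^ n - INR n * x ^ (pred n) * h) in *.
    replace ((x + h) ^ S n - x ^ S n - INR (S n) * x ^ n * h) with ((x + h) * Rn + INR n * x ^ (pred n) * (h * h)).
    2: { unfold Rn. rewrite S_INR, RtoC_plus, !Cpow_S. destruct n as [|n]; [simpl; ring|]. change (pred (S n)) with n. rewrite !Cpow_S. ring. }
    eapply Rle_trans; [apply Cmod_triangle|]. rewrite !Cmod_mult, Cmod_R, Cmod_pow, Rabs_pos_eq by apply pos_INR.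
    assert (Hn := pos_INR n). assert (Hh := Cmod_ge_0 h). assert (Hrn : (0 < r ^ n)%R) by (apply pow_lt; lra).
    set (g := (r ^ n / (r * r))%R) in *. assert (Hg : (0 < g)%R) by (apply Rdiv_lt_0_compat; [lra|nra]).
    assert (B1 : (Cmod (x + h) * Cmod Rn <= r * (INR n * INR n * g * (Cmod h * Cmod h)))%R).
    { apply Rmult_le_compat; try apply Cmod_ge_0; assumption. }
    assert (B2 : (INR n * Cmod x ^ (pred n) <= INR n * (r * g))%R).
    { destruct n as [|n]; [simpl; lra|]. apply Rmult_le_compat_l; [lra|]. change (pred (S n)) with n.
      replace (r * g)%R with (r ^ n)%R by (unfold g; simpl; field; lra). apply pow_incr. split; [apply Cmod_ge_0|exact Hx]. }
    replace (r ^ S n / (r * r))%R with (r * g)%R by (unfold g; simpl; field; lra). rewrite S_INR.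
    assert (B3 : (INR n * Cmod x ^ (pred n) * (Cmod h * Cmod h) <= INR n * (r * g) * (Cmod h * Cmod h))%R).
    { apply Rmult_le_compat_r; [nra|exact B2]. }
    assert (0 <= r * g * (Cmod h * Cmod h))%R by (apply Rmult_le_pos; nra). nra.
Qed.

Definition power_series (c : nat -> R) (x : C) : C := CSeries (fun n => c n * x ^ n).
Definition power_series' (c : nat -> R) (x : C) : C := CSeries (fun n => c n * (INR n * x ^ (pred n))).

Section PS.
Variable c : nat -> R.
Hypothesis Hc : forall n, (Rabs (c n) <= 1)%R.

Lemma power_series_abs (x : C) : (Cmod x < 1)%R -> abssum (fun n => c n * x ^ n) /\ abssum (fun n => c n * (INR n * x ^ (pred n))) /\ abssum (fun n => INR n * c n * x ^ n).
Proof.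
  intros Hx. set (r := ((1 + Cmod x) / 2)%R). assert (Hx0 := Cmod_ge_0 x). assert (Hr : (Cmod x <= r /\ 0 < r < 1)%R) by (unfold r; lra).
  assert (Hr2 : (/ 2 <= r)%R) by (unfold r; lra).
  assert (Hcp : forall n, (0 <= Cmod (c n) <= 1)%R). { intros n. rewrite Cmod_R. split; [apply Rabs_pos|apply Hc]. }
  assert (Hxn : forall n, (0 <= Cmod x ^ n <= r ^ n)%R). { intros n. split; [apply pow_le; lra|apply pow_incr; lra]. }
  repeat split.
  - apply abssum_le with (2 := ex_series_poly_geom 0 r (proj2 Hr)). intros n. rewrite Cmod_mult, Cmod_pow. simpl.
    specialize (Hcp n). specialize (Hxn n). nra.
  - apply abssum_le with (fun n => 2 * ((1 + INR n) ^ 1 * r ^ n))%R; [|apply ex_Rscal, ex_series_poly_geom, Hr]. intros n.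
    rewrite !Cmod_mult, Cmod_pow, (Cmod_R (INR n)), Rabs_pos_eq by apply pos_INR. specialize (Hcp n). assert (Hn := pos_INR n).
    destruct n as [|n].
    + simpl. lra.
    + change (pred (S n)) with n. specialize (Hxn n). rewrite pow_1. set (N := INR (S n)) in *. simpl pow.
      assert (0 <= N * Cmod x ^ n <= N * r ^ n)%R by (split; [apply Rmult_le_pos; lra|apply Rmult_le_compat_l; lra]).
      assert (Cmod (c (S n)) * (N * Cmod x ^ n) <= N * r ^ n)%R by nra. nra.
  - apply abssum_le with (2 := ex_series_poly_geom 1 r (proj2 Hr)). intros n.
    rewrite !Cmod_mult, Cmod_pow, (Cmod_R (INR n)), Rabs_pos_eq by apply pos_INR. specialize (Hcp n). specialize (Hxn n). assert (Hn := pos_INR n).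
    rewrite pow_1. assert (INR n * Cmod (c n) <= INR n)%R by nra. apply Rmult_le_compat; try lra. apply Rmult_le_pos; lra.
Qed.

Lemma power_series_cderiv (x : C) : (Cmod x < 1)%R -> cderiv (power_series c) x (power_series' c x).
Proof.
  intros Hx. set (r := ((1 + Cmod x) / 2)%R). assert (Hx0 := Cmod_ge_0 x). assert (Hr : (Cmod x <= r /\ 0 < r < 1)%R) by (unfold r; lra).
  destruct (power_series_abs x Hx) as [A1 [A2 _]].
  assert (Q : qexp (fun z => CSeries (fun n => c n * z ^ n)) x (CSeries (fun n => c n * (INR n * x ^ (pred n)))) (r - Cmod x)
     (Series (fun n => / (r * r) * ((1 + INR n) ^ 2 * r ^ n))%R)).
  { apply (CSeries_qexp (fun n z => c n * z ^ n) x (fun n => c n * (INR n * x ^ (pred n)))).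
    - intros n h Hh.
      replace (c n * (x + h) ^ n - c n * x ^ n - c n * (INR n * x ^ pred n) * h) with (c n * ((x + h) ^ n - x ^ n - INR n * x ^ pred n * h)) by ring.
      rewrite Cmod_mult, Cmod_R. assert (H := Cpow_remainder x h r n (proj1 (proj2 Hr)) (proj1 Hr)).
      assert (Hxh : (Cmod (x + h) <= r)%R) by (eapply Rle_trans; [apply Cmod_triangle|lra]). specialize (H Hxh).
      apply Rle_trans with (1 * (INR n * INR n * (r ^ n / (r * r)) * (Cmod h * Cmod h)))%R.
      { apply Rmult_le_compat; try apply Rabs_pos; try apply Cmod_ge_0; [apply Hc|exact H]. }
      rewrite Rmult_1_l. assert (Hh0 := Cmod_ge_0 h). apply Rmult_le_compat_r; [nra|].
      unfold Rdiv. assert (Hrn : (0 < r ^ n)%R) by (apply pow_lt; lra). assert (Hi : (0 < / (r * r))%R) by (apply Rinv_0_lt_compat; nra).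
      replace (INR n * INR n * (r ^ n * / (r * r)))%R with (/ (r * r) * (INR n * INR n * r ^ n))%R by ring.
      apply Rmult_le_compat_l; [lra|]. apply Rmult_le_compat_r; [lra|]. assert (Hn := pos_INR n). simpl. nra.
    - apply ex_Rscal, ex_series_poly_geom, Hr.
    - exact A1.
    - exact A2. }
  apply (qexp_cderiv _ _ _ (r - Cmod x)%R) with (2 := Q). unfold r. lra.
Qed.

Lemma power_series'_mult (x : C) : (Cmod x < 1)%R -> x * power_series' c x = CSeries (fun n => INR n * c n * x ^ n).
Proof.
  intros Hx. destruct (power_series_abs x Hx) as [A1 [A2 _]]. unfold power_series'. rewrite <- CSeries_scal by exact A2.
  apply CSeries_ext. intros [|n]; [simpl; ring|]. change (pred (S n)) with n. rewrite Cpow_S. ring.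
Qed.
End PS.

(** The numbers (1/2)_n / n!, Taylor coefficients of (1 - x)^(-1/2). *)
Fixpoint binom_coef (n : nat) : R := match n with O => 1%R | S m => (binom_coef m * ((1 / 2 + INR m) / (INR m + 1)))%R end.
Lemma binom_coef_bound (n : nat) : (0 <= binom_coef n <= 1)%R.
Proof.
  induction n as [|n IH]; [simpl; lra|]. simpl binom_coef. assert (Hn := pos_INR n).
  assert (H1 : (0 <= (1 / 2 + INR n) / (INR n + 1))%R) by (apply Rle_div_r; lra).
  assert (H2 : ((1 / 2 + INR n) / (INR n + 1) <= 1)%R) by (apply Rle_div_l; lra). nra.
Qed.
(** Since (1/4)_n / (5/4)_n = 1 / (4 n + 1), these are the coefficients of the hypergeometric series
    with parameters 1/2, 1/4, 5/4. *)
Definition hyp_coef (n : nat) : R := (binom_coef n / (4 * INR n + 1))%R.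
Lemma hyp_coef_bound (n : nat) : (Rabs (hyp_coef n) <= 1)%R.
Proof.
  unfold hyp_coef. assert (Hb := binom_coef_bound n). assert (Hn := pos_INR n). rewrite Rabs_pos_eq.
  - apply Rle_div_l; lra. - apply Rle_div_r; lra.
Qed.
Lemma binom_coef_abs (n : nat) : (Rabs (binom_coef n) <= 1)%R.
Proof. assert (H := binom_coef_bound n). rewrite Rabs_pos_eq; lra. Qed.

Lemma RtoC_neq_0 (x : R) : x <> 0%R -> RtoC x <> 0.
Proof. intros H E. apply H. apply RtoC_inj, E. Qed.

Lemma poch_half (n : nat) : pochhammer (1 / 2) n = binom_coef n * INR (fact n).
Proof.
  induction n as [|n IH]; [simpl; ring|]. simpl pochhammer. rewrite IH. simpl binom_coef.
  change (fact (S n)) with ((S n) * fact n)%nat. rewrite mult_INR, S_INR.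
  assert (Hn : (INR n + 1 <> 0)%R) by (generalize (pos_INR n); lra).
  assert (Hn' : INR n + 1 <> 0) by (rewrite <- RtoC_plus; apply RtoC_neq_0, Hn).
  rewrite !RtoC_mult, RtoC_div, !RtoC_plus, RtoC_div by (assumption || lra).
  field. exact Hn'.
Qed.
Lemma poch_quarter (n : nat) : pochhammer (5 / 4) n = pochhammer (1 / 4) n * (4 * INR n + 1) /\ pochhammer (5 / 4) n <> 0.
Proof.
  induction n as [|n [IH IH']].
  - simpl. split; [ring|apply C1_nz].
  - simpl pochhammer. split.
    + rewrite IH, S_INR, RtoC_plus. field.
    + apply Cmult_neq_0; [exact IH'|]. replace (5 / 4 + INR n) with (RtoC (5 / 4 + INR n)) by (rewrite RtoC_plus, RtoC_div by lra; reflexivity).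
      apply RtoC_neq_0. generalize (pos_INR n). lra.
Qed.

Lemma hyp2F1_power_series (z : C) : hyp2F1_series (1 / 2) (1 / 4) (5 / 4) z = power_series hyp_coef z.
Proof.
  apply CSeries_ext. intros n. f_equal. rewrite poch_half. destruct (poch_quarter n) as [E N]. rewrite E in *.
  assert (Hf : RtoC (INR (fact n)) <> 0) by (apply RtoC_neq_0, INR_fact_neq_0).
  assert (H4 : (4 * INR n + 1 <> 0)%R) by (generalize (pos_INR n); lra).
  assert (H4' : 4 * INR n + 1 <> 0) by (rewrite <- RtoC_mult, <- RtoC_plus; apply RtoC_neq_0, H4).
  assert (Hp : pochhammer (1 / 4) n <> 0). { intros H0. apply N. rewrite H0. ring. }
  unfold hyp_coef. rewrite RtoC_div, RtoC_plus, RtoC_mult by exact H4. field. repeat split; assumption.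
Qed.

(** Coefficientwise, (n + 1) b(n+1) = (n + 1/2) b(n). *)
Lemma binom_series_ode (x : C) : (Cmod x < 1)%R -> power_series' binom_coef x * (1 - x) = / 2 * power_series binom_coef x.
Proof.
  intros Hx. destruct (power_series_abs binom_coef binom_coef_abs x Hx) as [A1 [A2 A3]].
  replace (power_series' binom_coef x * (1 - x)) with (power_series' binom_coef x - x * power_series' binom_coef x) by ring.
  rewrite (power_series'_mult binom_coef binom_coef_abs x Hx). unfold power_series' at 1. rewrite CSeries_incr_1 by exact A2.
  assert (A4 : abssum (fun n => binom_coef (S n) * (INR (S n) * x ^ pred (S n)))) by (apply (abssum_shift _ 1 A2)).
  unfold power_series. rewrite <- CSeries_scal by exact A1.
  replace (binom_coef 0 * (INR 0 * x ^ pred 0)) with (RtoC 0) by (simpl; ring). rewrite Cplus_0_l.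
  replace (CSeries (fun n => binom_coef (S n) * (INR (S n) * x ^ pred (S n)))) with (CSeries (fun n => / 2 * (binom_coef n * x ^ n) + INR n * binom_coef n * x ^ n)).
  - rewrite CSeries_plus by (auto using abssum_scal). ring.
  - apply CSeries_ext. intros n. change (pred (S n)) with n. simpl binom_coef. rewrite S_INR.
    assert (Hn : (INR n + 1 <> 0)%R) by (generalize (pos_INR n); lra).
    assert (Hn' : INR n + 1 <> 0) by (rewrite <- RtoC_plus; apply RtoC_neq_0, Hn).
    rewrite !RtoC_mult, RtoC_div, !RtoC_plus, RtoC_div by (assumption || lra).
    field. exact Hn'.
Qed.

Lemma power_series_0 (c : nat -> R) : (forall n, (Rabs (c n) <= 1)%R) -> power_series c 0 = c 0%nat.
Proof.
  intros Hc. unfold power_series. rewrite CSeries_incr_1.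
  - rewrite CSeries_zero; [simpl; ring|]. intros n. rewrite Cpow_S. ring.
  - destruct (power_series_abs c Hc 0) as [A _]; [rewrite Cmod_0; lra|exact A].
Qed.

(** By the differential equation the derivative of B^2 (1 - x) vanishes. The squared form
    characterizes (1 - x)^(-1/2) without a choice of complex root. *)
Lemma binom_series_sq (x : C) : (Cmod x < 1)%R -> power_series binom_coef x * power_series binom_coef x * (1 - x) = 1.
Proof.
  intros Hx. set (g := fun x => power_series binom_coef x * power_series binom_coef x * (1 - x)).
  assert (Hd : forall y, (Cmod y < 1)%R -> cderiv g y 0).
  { intros y Hy. eapply cderiv_eq.
    - apply (cderiv_mult (fun x => power_series binom_coef x * power_series binom_coef x) (fun x => 1 - x)).
      + apply (cderiv_mult (power_series binom_coef) (power_series binom_coef)); apply power_series_cderiv; auto using binom_coef_abs.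
      + apply cderiv_minus; [apply cderiv_const|apply cderiv_id].
    - cbv beta. assert (H := binom_series_ode y Hy).
      replace ((power_series' binom_coef y * power_series binom_coef y + power_series binom_coef y * power_series' binom_coef y) * (1 - y) + power_series binom_coef y * power_series binom_coef y * (0 - 1))
        with (2 * power_series binom_coef y * (power_series' binom_coef y * (1 - y)) - power_series binom_coef y * power_series binom_coef y) by ring. rewrite H. field. }
  assert (H0 : g 0 = 1). { unfold g. rewrite power_series_0 by apply binom_coef_abs. simpl. ring. }
  transitivity (g 0); [|exact H0]. change (g x = g 0). apply Ceq_minus, Cmod_eq_0. apply Rle_antisym; [|apply Cmod_ge_0].
  eapply Rle_trans; [apply (mean_value_ineq g (fun _ => 0) 0 x 0)|rewrite Rmult_0_l; lra].
  - intros t Ht. apply Hd. replace (0 + t * (x - 0)) with (t * x) by ring. rewrite Cmod_mult, Cmod_R, Rabs_pos_eq by lra.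
    generalize (Cmod_ge_0 x). nra.
  - intros t Ht. rewrite Cmod_0. lra.
Qed.

(** The lemniscatic integral from 0 to s; [lemn_int'] is the branch of (1 - s^4)^(-1/2) with value 1
    at 0. *)
Definition lemn_int (s : C) : C := s * power_series hyp_coef (s ^ 4).
Definition lemn_int' (s : C) : C := power_series binom_coef (s ^ 4).

Lemma Cmod_pow4_lt (s : C) : (Cmod s < 1)%R -> (Cmod (s ^ 4) < 1)%R.
Proof. intros H. rewrite Cmod_pow. assert (H0 := Cmod_ge_0 s). apply pow_lt_1_compat; [lra|lia]. Qed.

Lemma lemn_int_cderiv (s : C) : (Cmod s < 1)%R -> cderiv lemn_int s (lemn_int' s).
Proof.
  intros Hs. assert (H4 := Cmod_pow4_lt s Hs). assert (Hg := hyp_coef_bound).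
  eapply cderiv_eq.
  - apply (cderiv_mult (fun s => s) (fun s => power_series hyp_coef (s ^ 4))); [apply cderiv_id|].
    apply (cderiv_comp (power_series hyp_coef) (fun s => s ^ 4)); [apply power_series_cderiv; assumption|]. apply (cderiv_pow (fun s => s) s 1 4), cderiv_id.
  - cbv beta. unfold lemn_int'. simpl INR. simpl pred. replace (RtoC (1 + 1 + 1 + 1)) with (RtoC 4) by (f_equal; ring).
    transitivity (power_series hyp_coef (s ^ 4) + 4 * (s ^ 4 * power_series' hyp_coef (s ^ 4))); [ring|]. rewrite power_series'_mult by assumption.
    destruct (power_series_abs hyp_coef Hg (s ^ 4) H4) as [A1 [A2 A3]]. unfold power_series.
    rewrite <- CSeries_scal, <- CSeries_plus by (auto using abssum_scal). apply CSeries_ext. intros n.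
    assert (H5 : (4 * INR n + 1 <> 0)%R) by (generalize (pos_INR n); lra).
    replace (binom_coef n) with (hyp_coef n * (4 * INR n + 1))%R by (unfold hyp_coef; field; exact H5).
    rewrite RtoC_mult, RtoC_plus, RtoC_mult. ring.
Qed.

Lemma lemn_int'_sq (s : C) : (Cmod s < 1)%R -> lemn_int' s * lemn_int' s * (1 - s ^ 4) = 1.
Proof. intros Hs. apply binom_series_sq, Cmod_pow4_lt, Hs. Qed.
Lemma lemn_int'_cderiv (s : C) : (Cmod s < 1)%R -> exists l, cderiv lemn_int' s l.
Proof.
  intros Hs. eexists. apply (cderiv_comp (power_series binom_coef) (fun s => s ^ 4)); [apply power_series_cderiv; [apply binom_coef_abs|apply Cmod_pow4_lt, Hs]|].
  apply (cderiv_pow (fun s => s) s 1 4), cderiv_id.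
Qed.
Lemma lemn_int'_0 : lemn_int' 0 = 1.
Proof. unfold lemn_int'. replace (0 ^ 4) with (RtoC 0) by ring. apply (power_series_0 binom_coef binom_coef_abs). Qed.

(** * Matching near the origin *)

(* With [h = d / s] one has [h' = (s d' - d) / s^2], so a bound [|h| <= m |s|] improves itself to [|h| <= (m / 2) |s|]. *)
Lemma fuchs_vanish (d d' : C -> C) (r : R) :
  (forall s, (0 < Cmod s < r)%R -> cderiv d s (d' s)) ->
  (forall s, (0 < Cmod s < r)%R -> (Cmod (d s) <= Cmod s * Cmod s)%R) ->
  (forall s, (0 < Cmod s < r)%R -> (Cmod (s * d' s - d s) <= / 2 * Cmod (d s))%R) ->
  forall s, (0 < Cmod s < r)%R -> d s = 0.
Proof.
  intros Hd Hb Hs.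
  assert (Hn : forall n s, (0 < Cmod s < r)%R -> (Cmod (d s / s) <= (/ 2) ^ n * Cmod s)%R).
  { induction n as [|n IH]; intros s Hr; assert (Hs0 : s <> 0) by (apply Cmod_gt_0; lra).
    - rewrite Cmod_div by exact Hs0. simpl. rewrite Rmult_1_l. apply Rle_div_l; [lra|]. apply Hb, Hr.
    - set (m := ((/ 2) ^ n)%R) in *. assert (Hm : (0 < m)%R) by (apply pow_lt; lra).
      (* The hypotheses say nothing at 0, so the mean value inequality runs over the segment from t
         s to s; t tends to 0 at the end. *)
      assert (Hstep : forall t : R, (0 < t < 1)%R -> (Cmod (d s / s) <= m / 2 * Cmod s + t * (m * Cmod s))%R).
      { intros t Ht.
        assert (Hseg : forall u : R, (0 <= u <= 1)%R -> (0 < Cmod (t * s + u * (s - t * s)) < r)%R).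
        { intros u Hu. replace (t * s + u * (s - t * s)) with ((t + u * (1 - t))%R * s) by (rewrite RtoC_plus, RtoC_mult, RtoC_minus; ring).
          assert (0 < t + u * (1 - t) <= 1)%R by nra. rewrite Cmod_mult, Cmod_R, Rabs_pos_eq by lra. nra. }
        assert (HM : (Cmod (d s / s - d (t * s)%C / (t * s)) <= m / 2 * Cmod (s - t * s))%R).
        { apply (mean_value_ineq (fun x => d x / x) (fun x => (d' x * x - d x * 1) / x ^ 2)).
          - intros u Hu. specialize (Hseg u Hu). apply (cderiv_div d (fun x => x)); [apply Hd, Hseg|apply cderiv_id|apply Cmod_gt_0; lra].
          - intros u Hu. specialize (Hseg u Hu). set (x := t * s + u * (s - t * s)) in *. assert (Hx : x <> 0) by (apply Cmod_gt_0; lra).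
            replace (d' x * x - d x * 1) with (x * d' x - d x) by ring.
            rewrite Cmod_div, Cmod_pow by (apply Cpow_nz, Hx). apply Rle_div_l; [apply Rlt_gt, pow_lt; lra|].
            eapply Rle_trans; [apply Hs, Hseg|]. specialize (IH x Hseg). rewrite Cmod_div in IH by exact Hx.
            apply (fun H => proj1 (Rle_div_l _ _ _ H)) in IH; [|lra]. simpl. lra. }
        replace (d s / s) with ((d s / s - d (t * s)%C / (t * s)) + d (t * s)%C / (t * s)) by ring.
        eapply Rle_trans; [apply Cmod_triangle|].
        assert (Hts : (Cmod (t * s)%C = t * Cmod s)%R) by (rewrite Cmod_mult, Cmod_R, Rabs_pos_eq; lra).
        assert (H1 : (Cmod (d (t * s)%C / (t * s)) <= m * (t * Cmod s))%R).
        { rewrite <- Hts. apply IH. rewrite Hts. nra. }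
        assert (H2 : (Cmod (s - t * s) <= Cmod s)%R).
        { replace (s - t * s) with ((1 - t)%R * s) by (rewrite RtoC_minus; ring). rewrite Cmod_mult, Cmod_R, Rabs_pos_eq by lra. nra. }
        apply Rplus_le_compat.
        - eapply Rle_trans; [exact HM|]. apply Rmult_le_compat_l; lra.
        - lra. }
      replace ((/ 2) ^ S n)%R with (m / 2)%R by (unfold m; simpl; field).
      apply le_epsilon. intros eps He. set (t := Rmin (/ 2) (eps / (m * Cmod s + 1))).
      assert (Hms : (0 < m * Cmod s)%R) by (apply Rmult_lt_0_compat; lra).
      assert (Ht : (0 < t)%R) by (apply Rmin_glb_lt; [lra|apply Rdiv_lt_0_compat; lra]).
      assert (Ht1 : (t <= / 2)%R) by apply Rmin_l. assert (Ht2 : (t <= eps / (m * Cmod s + 1))%R) by apply Rmin_r.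
      apply Rle_div_r in Ht2; [|lra]. specialize (Hstep t ltac:(lra)). nra. }
  intros s Hr. assert (Hs0 : s <> 0) by (apply Cmod_gt_0; lra).
  replace (d s) with (s * (d s / s)) by (field; exact Hs0).
  replace (d s / s) with (RtoC 0); [ring|]. symmetry. apply small_eq_0 with (Cmod s). intros eps He.
  destruct (pow_lt_1_zero (/ 2) ltac:(rewrite Rabs_pos_eq; lra) eps He) as [N HN]. specialize (HN N (Nat.le_refl N)).
  rewrite Rabs_pos_eq in HN by (apply pow_le; lra). eapply Rle_trans; [apply (Hn N s Hr)|]. nra.
Qed.

Lemma flim_at_0_ccont (f : C -> C) : ccont f 0 -> flim at_0 f (f 0).
Proof.
  intros H eps He. destruct (H eps He) as [d [Hd W]]. exists d. split; [exact Hd|]. intros s Hs. apply W. replace (s - 0) with s by ring. apply Hs.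
Qed.
Lemma flim_id_0 : flim at_0 (fun s => s) 0.
Proof. apply (flim_at_0_ccont (fun s => s)). apply (cderiv_ccont _ _ 1), cderiv_id. Qed.

(** If v = [lemn_int] s, then s is the lemniscate sine of v and wp(v) = 1/s^2; this is the
    duplication formula wp(2v) = (wp^2 + 1)^2 / (4 wp^3 - 4 wp). *)
Definition wp_lemn (s : C) : C := (1 + s ^ 4) ^ 2 / (4 * s ^ 2 * (1 - s ^ 4)).

Section Near.
Variables w1 w2 : C.
Hypothesis Him : Im (w2 * Cconj w1) <> 0%R.
Hypothesis Hode : forall z : C, ~ in_lattice w1 w2 z ->
    C_derive (weierstrass_p w1 w2) z ^ 2 = 4 * weierstrass_p w1 w2 z ^ 3 - 4 * weierstrass_p w1 w2 z - 0.

Let r := lattice_sum w1 w2 is_origin.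
Let r' := lattice_sum' w1 w2 is_origin.
Let P (s : C) := power_series hyp_coef (s ^ 4).
Let z (s : C) := 2 * lemn_int s.
(** The reciprocal of wp at z s, written so that it remains regular at s = 0; [b] is the reciprocal
    of [wp_lemn]. Of the lattice sums r and r' the limits below use only boundedness. *)
Let a (s : C) := z s ^ 2 / (1 + z s ^ 2 * r (z s)).
Let da (s : C) := (2 * z s - z s ^ 4 * r' (z s)) / (1 + z s ^ 2 * r (z s)) ^ 2 * (2 * lemn_int' s).
Let b (s : C) := 4 * s ^ 2 * (1 - s ^ 4) / (1 + s ^ 4) ^ 2.
Let db (s : C) := 8 * s * (1 - 6 * s ^ 4 + s ^ 8) / (1 + s ^ 4) ^ 3.

Lemma lim_P : flim at_0 P 1.
Proof.
  assert (H0 : P 0 = 1). { unfold P. replace (0 ^ 4) with (RtoC 0) by ring. rewrite (power_series_0 hyp_coef hyp_coef_bound). unfold hyp_coef. simpl. f_equal. field. }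
  rewrite <- H0. apply flim_at_0_ccont. eapply cderiv_ccont.
  apply (cderiv_comp (power_series hyp_coef) (fun s => s ^ 4)); [apply power_series_cderiv; [apply hyp_coef_bound|]|apply (cderiv_pow (fun s => s) 0 1 4), cderiv_id].
  apply Cmod_pow4_lt. rewrite Cmod_0. lra.
Qed.
Lemma lim_B : flim at_0 lemn_int' 1.
Proof.
  rewrite <- lemn_int'_0. apply flim_at_0_ccont. destruct (lemn_int'_cderiv 0) as [l Hl]; [rewrite Cmod_0; lra|]. apply (cderiv_ccont _ _ _ Hl).
Qed.
Lemma lim_pow0 (n : nat) : flim at_0 (fun s => s ^ (S n)) 0.
Proof. eapply flim_eq; [apply (flim_pow (fun s => s)), flim_id_0|]. rewrite Cpow_S. ring. Qed.
Lemma lim_z : flim at_0 z 0.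
Proof.
  apply (flim_ext (fun s => 2 * (s * P s))). { exists 1%R. split; [lra|]. intros s _. reflexivity. }
  eapply flim_eq; [apply flim_scal, flim_mult; [apply flim_id_0|apply lim_P]|ring].
Qed.

Lemma near_bounds : exists K, at_0 (fun s => (z s <> 0 -> ~ in_lattice w1 w2 (z s)) /\ (Cmod (r (z s)) <= K)%R /\ (Cmod (r' (z s)) <= K)%R).
Proof.
  destruct (wp_near_0 w1 w2 Him) as [d [K [Hd [HK H]]]]. exists K.
  generalize (lim_z d Hd). apply filter_imp. intros s Hs. apply H. replace (z s - 0) with (z s) in Hs by ring. exact Hs.
Qed.

Lemma lim_den : flim at_0 (fun s => 1 + z s ^ 2 * r (z s)) 1.
Proof.
  destruct near_bounds as [K HK].
  eapply flim_eq; [apply flim_plus; [apply flim_const|]|apply Cplus_0_r].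
  apply (flim_bounded_mult (fun s => z s ^ 2) (fun s => r (z s)) K).
  - eapply flim_eq; [apply flim_pow, lim_z|ring].
  - generalize HK. apply filter_imp. intros s Hs. apply Hs.
Qed.

Lemma lim_a : flim at_0 a 0.
Proof.
  eapply flim_eq; [apply (flim_mult (fun s => z s ^ 2)); [apply flim_pow, lim_z|apply flim_inv; [apply C1_nz|apply lim_den]]|]. ring.
Qed.

Lemma lim_1p4 : flim at_0 (fun s => 1 + s ^ 4) 1.
Proof. eapply flim_eq; [apply flim_plus; [apply flim_const|apply (lim_pow0 3)]|ring]. Qed.

Lemma lim_b : flim at_0 b 0.
Proof.
  apply (flim_ext (fun s => 4 * s ^ 2 * (1 + - (1) * s ^ 4) * / (1 + s ^ 4) ^ 2)).
  { exists 1%R. split; [lra|]. intros s _. unfold b, Cdiv. ring. }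
  eapply flim_eq.
  - apply flim_mult.
    + apply flim_mult; [apply flim_scal, (lim_pow0 1)|]. apply flim_plus; [apply flim_const|apply flim_scal, (lim_pow0 3)].
    + apply (flim_inv (fun s => (1 + s ^ 4) ^ 2)); [|apply flim_pow, lim_1p4]. rewrite Cpow_1_l. apply C1_nz.
  - ring.
Qed.

(** The quotient (da + db) / s with the division carried out; da and db both behave like 8 s, whence
    the limit 16. *)
Let sg1 (s : C) := (4 * P s - 16 * (s ^ 3 * P s ^ 4 * r' (z s))) * / (1 + z s ^ 2 * r (z s)) ^ 2 * (2 * lemn_int' s) + 8 * ((1 + - (6) * s ^ 4 + s ^ 8) * / (1 + s ^ 4) ^ 3).
(** The quotient (da^2 - db^2) / (a - b), taken from the common equation of a and b. Hence s (da -
    db) = (a - b) ka / sg1, with a factor tending to 1. *)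
Let ka (s : C) := 16 * (lemn_int' s * lemn_int' s) * (1 + - (1) * (a s * a s + a s * b s + b s * b s)).

Lemma lim_sg1 : flim at_0 sg1 16.
Proof.
  destruct near_bounds as [K HK].
  eapply flim_eq.
  - apply flim_plus.
    + apply flim_mult; [apply flim_mult|apply flim_scal, lim_B].
      * apply (flim_ext (fun s => 4 * P s + - (16) * (s ^ 3 * P s ^ 4 * r' (z s)))).
        { exists 1%R. split; [lra|]. intros s _. ring. }
        apply flim_plus; [apply flim_scal, lim_P|]. apply flim_scal.
        apply (flim_bounded_mult (fun s => s ^ 3 * P s ^ 4) (fun s => r' (z s)) K).
        -- eapply flim_eq; [apply flim_mult; [apply (lim_pow0 2)|apply flim_pow, lim_P]|ring].
        -- generalize HK. apply filter_imp. intros s Hs. apply Hs.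
      * apply (flim_inv (fun s => (1 + z s ^ 2 * r (z s)) ^ 2)); [|apply flim_pow, lim_den]. rewrite Cpow_1_l. apply C1_nz.
    + apply flim_scal, flim_mult.
      * apply flim_plus; [|apply (lim_pow0 7)]. apply flim_plus; [apply flim_const|apply flim_scal, (lim_pow0 3)].
      * apply (flim_inv (fun s => (1 + s ^ 4) ^ 3)); [|apply flim_pow, lim_1p4]. rewrite Cpow_1_l. apply C1_nz.
  - rewrite !Cpow_1_l. field.
Qed.
Lemma lim_ka : flim at_0 ka 16.
Proof.
  eapply flim_eq.
  - apply flim_mult.
    + apply flim_scal, flim_mult; apply lim_B.
    + apply flim_plus; [apply flim_const|]. apply flim_scal. apply flim_plus; [apply flim_plus|]; apply flim_mult; (apply lim_a || apply lim_b).
  - ring.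
Qed.

Lemma near_match : at_0 (fun s => ~ in_lattice w1 w2 (z s) /\ weierstrass_p w1 w2 (z s) = wp_lemn s).
Proof.
  assert (C16 : RtoC 16 <> 0) by (intros H; apply RtoC_inj in H; lra).
  assert (Hq : flim at_0 (fun s => ka s * / sg1 s) 1).
  { eapply flim_eq; [apply flim_mult; [apply lim_ka|apply (flim_inv _ _ C16 lim_sg1)]|field]. }
  (* This is (a - b) / s^2; it tends to 0 because the leading terms 4 s^2 agree. *)
  assert (Hsz : flim at_0 (fun s => 4 * (P s * P s) * / (1 + z s ^ 2 * r (z s)) + - (4) * ((1 + - (1) * s ^ 4) * / (1 + s ^ 4) ^ 2)) 0).
  { eapply flim_eq.
    - apply flim_plus.
      + apply flim_mult; [apply flim_scal, flim_mult; apply lim_P|apply (flim_inv _ _ C1_nz lim_den)].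
      + apply flim_scal, flim_mult.
        * apply flim_plus; [apply flim_const|apply flim_scal, (lim_pow0 3)].
        * apply (flim_inv (fun s => (1 + s ^ 4) ^ 2)); [|apply flim_pow, lim_1p4]. rewrite Cpow_1_l. apply C1_nz.
    - rewrite Cpow_1_l. field. }
  destruct near_bounds as [K HK].
  assert (Hall : at_0 (fun s => ((Cmod s < 1)%R /\ s <> 0) /\ (P s <> 0 /\ 1 + z s ^ 2 * r (z s) <> 0) /\ (1 + s ^ 4 <> 0 /\ sg1 s <> 0) /\
     (Cmod (ka s * / sg1 s - 1) < / 2)%R /\ (Cmod (4 * (P s * P s) * / (1 + z s ^ 2 * r (z s)) + - (4) * ((1 + - (1) * s ^ 4) * / (1 + s ^ 4) ^ 2) - 0) < 1)%R /\
     (z s <> 0 -> ~ in_lattice w1 w2 (z s)))).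
  { repeat apply filter_and.
    - exists 1%R. split; [lra|]. intros s Hs. apply Hs.
    - exists 1%R. split; [lra|]. intros s Hs. apply Cmod_gt_0. apply Hs.
    - apply (flim_neq_0 _ _ C1_nz lim_P).
    - apply (flim_neq_0 _ _ C1_nz lim_den).
    - apply (flim_neq_0 _ _ C1_nz lim_1p4).
    - apply (flim_neq_0 _ _ C16 lim_sg1).
    - apply Hq. lra.
    - apply Hsz. lra.
    - generalize HK. apply filter_imp. intros s Hs. apply Hs. }
  destruct Hall as [d [Hd Hall]].
  assert (Hlat : forall s, (0 < Cmod s < d)%R -> z s <> 0 /\ ~ in_lattice w1 w2 (z s)).
  { intros s Hs. destruct (Hall s Hs) as [[_ H0] [[H1 _] [_ [_ [_ H2]]]]].
    assert (Hz : z s <> 0). { unfold z, lemn_int. apply Cmult_neq_0; [intros H; apply RtoC_inj in H; lra|]. apply Cmult_neq_0; assumption. }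
    split; [exact Hz|]. apply H2, Hz. }
  assert (Hda : forall s, (0 < Cmod s < d)%R -> cderiv a s (da s)).
  { intros s Hs. destruct (Hall s Hs) as [[Hs1 H0] [[H1 H2] _]]. destruct (Hlat s Hs) as [Hz Hl].
    destruct (sep_off_lattice w1 w2 Him (z s) Hl) as [k [Hk Hsep]].
    apply (cderiv_comp (fun x => x ^ 2 / (1 + x ^ 2 * r x)) z).
    - eapply cderiv_eq.
      + apply (cderiv_div (fun x => x ^ 2) (fun x => 1 + x ^ 2 * r x)).
        * apply (cderiv_pow (fun x => x) _ 1 2), cderiv_id.
        * apply cderiv_plus; [apply cderiv_const|]. apply (cderiv_mult (fun x => x ^ 2) r); [apply (cderiv_pow (fun x => x) _ 1 2), cderiv_id|].
          apply (lattice_sum_cderiv w1 w2 is_origin (z s) k Hk Hsep).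
        * exact H2.
      + cbv beta. simpl INR. simpl pred. replace (RtoC (1 + 1)) with (RtoC 2) by (f_equal; ring). fold r r'. field. exact H2.
    - apply cderiv_scal, lemn_int_cderiv, Hs1. }
  assert (Hdb : forall s, (0 < Cmod s < d)%R -> cderiv b s (db s)).
  { intros s Hs. destruct (Hall s Hs) as [_ [_ [[H1 _] _]]]. eapply cderiv_eq.
    - apply (cderiv_div (fun s => 4 * s ^ 2 * (1 - s ^ 4)) (fun s => (1 + s ^ 4) ^ 2)).
      + apply (cderiv_mult (fun s => 4 * s ^ 2) (fun s => 1 - s ^ 4)).
        * apply cderiv_scal, (cderiv_pow (fun x => x) s 1 2), cderiv_id.
        * apply cderiv_minus; [apply cderiv_const|apply (cderiv_pow (fun x => x) s 1 4), cderiv_id].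
      + apply (cderiv_pow (fun s => 1 + s ^ 4) s (0 + INR 4 * s ^ pred 4 * 1) 2). apply cderiv_plus; [apply cderiv_const|apply (cderiv_pow (fun x => x) s 1 4), cderiv_id].
      + apply Cpow_nz, H1.
    - cbv beta. simpl INR. simpl pred. replace (RtoC (1 + 1 + 1 + 1)) with (RtoC 4) by (f_equal; ring). replace (RtoC (1 + 1)) with (RtoC 2) by (f_equal; ring).
      unfold db. field. exact H1. }
  assert (Hwp : forall s, (0 < Cmod s < d)%R -> weierstrass_p w1 w2 (z s) = / a s).
  { intros s Hs. destruct (Hall s Hs) as [_ [[_ H2] _]]. destruct (Hlat s Hs) as [Hz Hl].
    rewrite wp_lattice_sum. fold r. unfold a. field. split; assumption. }
  (* For y = 1/wp the equation of wp reads y'^2 = 4 y - 4 y^3; the factor 4 [lemn_int']^2 comes from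
     the chain rule. *)
  assert (Hasq : forall s, (0 < Cmod s < d)%R -> da s * da s = 4 * (lemn_int' s * lemn_int' s) * (4 * a s - 4 * a s ^ 3)).
  { intros s Hs. destruct (Hall s Hs) as [_ [[_ H2] _]]. destruct (Hlat s Hs) as [Hz Hl].
    assert (HO := Hode (z s) Hl). rewrite (cderiv_C_derive _ _ _ (wp_cderiv w1 w2 Him (z s) Hl)), (Hwp s Hs) in HO. fold r' in HO.
    assert (Ha0 : a s <> 0). { unfold a, Cdiv. apply Cmult_neq_0; [apply Cpow_nz, Hz|]. intros H0. apply H2. replace (1 + z s ^ 2 * r (z s)) with (/ / (1 + z s ^ 2 * r (z s))) by (field; exact H2). rewrite H0. unfold Cinv, RtoC. simpl. f_equal; unfold Rdiv; ring. }
    replace (da s) with (- (a s ^ 2) * (- (2) / z s ^ 3 + r' (z s)) * (2 * lemn_int' s)).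
    2: { unfold da, a. field. split; assumption. }
    transitivity (a s ^ 4 * (- (2) / z s ^ 3 + r' (z s)) ^ 2 * (4 * (lemn_int' s * lemn_int' s))); [ring|]. rewrite HO. field. exact Ha0. }
  (* An identity of rational functions once [lemn_int']^2 is replaced by 1 / (1 - s^4). *)
  assert (Hbsq : forall s, (0 < Cmod s < d)%R -> db s * db s = 4 * (lemn_int' s * lemn_int' s) * (4 * b s - 4 * b s ^ 3)).
  { intros s Hs. destruct (Hall s Hs) as [[Hs1 _] [_ [[H1 _] _]]]. assert (HB := lemn_int'_sq s Hs1).
    assert (Hx : 1 - s ^ 4 <> 0). { intros H0. rewrite H0 in HB. apply C1_nz. rewrite <- HB. ring. }
    replace (lemn_int' s * lemn_int' s) with (/ (1 - s ^ 4)).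
    2: { replace (lemn_int' s * lemn_int' s) with (lemn_int' s * lemn_int' s * (1 - s ^ 4) * / (1 - s ^ 4)) by (field; exact Hx). rewrite HB. ring. }
    unfold db, b. field. split; assumption. }
  assert (Hsum : forall s, (0 < Cmod s < d)%R -> da s + db s = s * sg1 s).
  { intros s Hs. destruct (Hall s Hs) as [_ [[_ H2] [[H1 _] _]]]. unfold da, db, sg1.
    replace (2 * z s - z s ^ 4 * r' (z s)) with (s * (4 * P s - 16 * (s ^ 3 * P s ^ 4 * r' (z s)))).
    - field. split; assumption.
    - unfold z, lemn_int. fold (P s). ring. }
  assert (Hab : forall s, (0 < Cmod s < d)%R -> a s - b s = 0).
  { apply (fuchs_vanish (fun s => a s - b s) (fun s => da s - db s)).
    - intros s Hs. apply cderiv_minus; auto.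
    - intros s Hs. destruct (Hall s Hs) as [_ [[_ H2] [[H1 _] [_ [Hsm _]]]]].
      replace (a s - b s) with (s * s * (4 * (P s * P s) * / (1 + z s ^ 2 * r (z s)) + - (4) * ((1 + - (1) * s ^ 4) * / (1 + s ^ 4) ^ 2) - 0)).
      + rewrite !Cmod_mult. assert (Hc := Cmod_ge_0 s). assert (0 <= Cmod s * Cmod s)%R by nra.
        set (q := Cmod (4 * (P s * P s) * / (1 + z s ^ 2 * r (z s)) + - (4) * ((1 + - (1) * s ^ 4) * / (1 + s ^ 4) ^ 2) - 0)) in *. nra.
      + unfold a, b. replace (z s ^ 2 / (1 + z s ^ 2 * r (z s))) with (4 * (s * s) * (P s * P s) / (1 + z s ^ 2 * r (z s))).
        * set (den := 1 + z s ^ 2 * r (z s)) in *. field. split; assumption.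
        * f_equal. unfold z, lemn_int. fold (P s). ring.
    - intros s Hs. destruct (Hall s Hs) as [[_ Hs0] [_ [[_ H1] [Hk _]]]].
      (* The difference of squares is divided by da + db, which is s [sg1]; this turns the nonlinear
         equation into one proportional to a - b. *)
      assert (E1 : s * (da s - db s) = (a s - b s) * (ka s * / sg1 s)).
      { transitivity ((da s - db s) * (da s + db s) * / sg1 s).
        - rewrite (Hsum s Hs). field. exact H1.
        - replace ((da s - db s) * (da s + db s)) with (da s * da s - db s * db s) by ring.
          rewrite (Hasq s Hs), (Hbsq s Hs). unfold ka. ring. }
      rewrite E1. replace ((a s - b s) * (ka s * / sg1 s) - (a s - b s)) with ((ka s * / sg1 s - 1) * (a s - b s)) by ring.
      rewrite Cmod_mult. apply Rmult_le_compat_r; [apply Cmod_ge_0|lra]. }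
  exists d. split; [exact Hd|]. intros s Hs. destruct (Hlat s Hs) as [Hz Hl]. split; [exact Hl|].
  rewrite (Hwp s Hs). replace (a s) with (b s) by (symmetry; apply Ceq_minus, Hab, Hs).
  destruct (Hall s Hs) as [[Hs1 Hs0] [_ [[H1 _] _]]]. assert (HB := lemn_int'_sq s Hs1).
  assert (Hx : 1 - s ^ 4 <> 0). { intros H0. rewrite H0 in HB. apply C1_nz. rewrite <- HB. ring. }
  unfold b, wp_lemn. field. repeat split; assumption.
Qed.
End Near.

(** * Analytic continuation *)

Definition near (c : C) (P : C -> Prop) : Prop := exists d, (0 < d)%R /\ forall w, (Cmod (w - c) < d)%R -> P w.

Lemma near_self (c : C) (P : C -> Prop) : near c P -> P c.
Proof. intros [d [Hd H]]. apply H. replace (c - c) with (RtoC 0) by ring. rewrite Cmod_0. exact Hd. Qed.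
Lemma near_and (c : C) (P Q : C -> Prop) : near c P -> near c Q -> near c (fun w => P w /\ Q w).
Proof.
  intros [d [Hd H]] [d' [Hd' H']]. exists (Rmin d d'). split; [apply Rmin_glb_lt; assumption|]. intros w Hw.
  split; [apply H|apply H']; (eapply Rlt_le_trans; [exact Hw|]); [apply Rmin_l|apply Rmin_r].
Qed.
Lemma near_imp (c : C) (P Q : C -> Prop) : (forall w, P w -> Q w) -> near c P -> near c Q.
Proof. intros HPQ [d [Hd H]]. exists d. auto. Qed.
Lemma near_open (c : C) (P : C -> Prop) : near c P -> near c (fun w => near w P).
Proof.
  intros [d [Hd H]]. exists d. split; [exact Hd|]. intros w Hw. exists (d - Cmod (w - c))%R. split; [lra|].
  intros x Hx. apply H. eapply Rle_lt_trans; [apply (Cmod_triangle_dist x w c)|]. lra.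
Qed.
Lemma near_ccont (f : C -> C) (c : C) (P : C -> Prop) : ccont f c -> near (f c) P -> near c (fun w => P (f w)).
Proof. intros Hf [d [Hd H]]. destruct (Hf d Hd) as [d' [Hd' H']]. exists d'. split; [exact Hd'|]. intros w Hw. apply H, H', Hw. Qed.

Lemma line_0 (p q : C) : p + 0%R * (q - p) = p. Proof. ring. Qed.
Lemma line_1 (p q : C) : p + 1%R * (q - p) = q. Proof. ring. Qed.

Section Continuation.
Variables w1 w2 : C.
Hypothesis Him : Im (w2 * Cconj w1) <> 0%R.

(** Real induction carries two claims that support each other: while phi avoids the lattice, wp of
    phi is holomorphic and the identity theorem applies; equality with the finite psi keeps phi off
    the lattice at the next point. *)
Lemma wp_continuation (D : C -> Prop) (phi psi : C -> C) (p q : C) :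
  copen D -> holo D phi -> holo D psi -> (forall t : R, (0 <= t <= 1)%R -> D (p + t * (q - p))) ->
  near p (fun w => ~ in_lattice w1 w2 (phi w) /\ weierstrass_p w1 w2 (phi w) = psi w) ->
  near q (fun w => ~ in_lattice w1 w2 (phi w) /\ weierstrass_p w1 w2 (phi w) = psi w).
Proof.
  intros HO Hphi HR HD Hst0. set (P := fun w => ~ in_lattice w1 w2 (phi w) /\ weierstrass_p w1 w2 (phi w) = psi w) in *.
  assert (Hcphi : forall z, D z -> ccont phi z). { intros z Hz. destruct (Hphi z Hz) as [l Hl]. apply (cderiv_ccont _ _ _ Hl). }
  assert (HcR : forall z, D z -> ccont psi z). { intros z Hz. destruct (HR z Hz) as [l Hl]. apply (cderiv_ccont _ _ _ Hl). }
  set (D' := fun z => D z /\ ~ in_lattice w1 w2 (phi z)).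
  assert (HO' : copen D').
  { intros z [Hz1 Hz2]. apply near_and; [apply HO, Hz1|]. apply (near_ccont phi z (fun x => ~ in_lattice w1 w2 x)); [apply Hcphi, Hz1|].
    apply off_lattice_open; assumption. }
  assert (Hf : holo D' (fun z => weierstrass_p w1 w2 (phi z) - psi z)).
  { intros z [Hz1 Hz2]. destruct (Hphi z Hz1) as [l1 H1]. destruct (HR z Hz1) as [l2 H2]. eexists.
    apply cderiv_minus; [|exact H2]. apply (cderiv_comp (weierstrass_p w1 w2) phi); [apply wp_cderiv; assumption|exact H1]. }
  assert (Hall : forall t : R, (0 <= t <= 1)%R -> near (p + t * (q - p)) P).
  { apply real_induction.
    - rewrite line_0. exact Hst0.
    - intros t Ht Hn. destruct (near_open _ _ Hn) as [d [Hd W]]. destruct (line_near p q t d Hd) as [d' [Hd' W']].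
      exists d'. split; [exact Hd'|]. intros s _ Hs. apply W, W', Hs.
    - intros t Ht Hs. set (z := p + t * (q - p)). assert (Hz : D z) by (apply HD; lra).
      (* If phi z were a lattice point, wp would exceed |psi z| + 1 at nearby earlier points, where
         it equals psi. *)
      assert (Hoff : ~ in_lattice w1 w2 (phi z)).
      { intros Hin. destruct (wp_pole w1 w2 Him (phi z) (Cmod (psi z) + 1) Hin) as [r [Hr Hpole]].
        destruct (near_and z _ _ (Hcphi z Hz r Hr) (HcR z Hz 1%R Rlt_0_1)) as [d [Hd W]].
        destruct (line_near p q t d Hd) as [d' [Hd' W']]. set (s := Rmax 0 (t - d' / 2)%R).
        assert (Hst : (0 <= s < t /\ t - d' / 2 <= s)%R). { unfold s. split; [split; [apply Rmax_l|apply Rmax_lub_lt; lra]|apply Rmax_r]. }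
        destruct (W _ (W' s ltac:(apply Rabs_lt_between; lra))) as [W1 W2].
        destruct (near_self _ _ (Hs s (proj1 Hst))) as [P1 P2]. set (x := p + s * (q - p)) in *.
        assert (Hne : phi x - phi z <> 0). { intros H0. apply P1. apply Ceq_minus in H0. rewrite H0. exact Hin. }
        specialize (Hpole (phi x) (conj (proj1 (Cmod_gt_0 _) Hne) W1)). rewrite P2 in Hpole.
        assert (H3 := Cmod_triangle_rev (psi x) (psi z)). lra. }
      (* The whole segment from p to z lies in D', the endpoint by [Hoff] and the rest by the
         induction hypothesis. *)
      assert (Hzero : zero_near (fun z => weierstrass_p w1 w2 (phi z) - psi z) (p + 1%R * (z - p))).
      { apply (identity_segment D' _ p z HO' Hf); [| |lra].
        - intros v Hv. replace (p + v * (z - p)) with (p + (v * t)%R * (q - p)) by (unfold z; rewrite RtoC_mult; ring).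
          destruct (Req_dec v 1) as [->|Hv1].
          + rewrite Rmult_1_l. split; [exact Hz|exact Hoff].
          + assert (Hvt : (0 <= v * t < t)%R) by nra. split; [apply HD; lra|]. apply (near_self _ _ (Hs _ Hvt)).
        - revert Hst0. apply near_imp. intros w [_ Hw]. apply (proj1 (Ceq_minus _ _)), Hw. }
      rewrite line_1 in Hzero. apply near_and.
      + destruct (HO' z (conj Hz Hoff)) as [d [Hd W]]. exists d. split; [exact Hd|]. intros w Hw. apply W, Hw.
      + revert Hzero. apply near_imp. intros w Hw. apply Ceq_minus, Hw. }
  rewrite <- (line_1 p q). apply Hall. lra.
Qed.

Hypothesis Hode : forall z : C, ~ in_lattice w1 w2 z ->
    C_derive (weierstrass_p w1 w2) z ^ 2 = 4 * weierstrass_p w1 w2 z ^ 3 - 4 * weierstrass_p w1 w2 z - 0.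

Lemma one_minus_pow4 (s : C) : (Cmod s < 1)%R -> 1 - s ^ 4 <> 0.
Proof. intros Hs H0. assert (HB := lemn_int'_sq s Hs). rewrite H0 in HB. apply C1_nz. rewrite <- HB. ring. Qed.

(** [near_match] covers only small s. Continuation along the radius from t s0 to s0, inside the
    punctured disc, brings the identity to s0; the centre is excluded as a pole of [wp_lemn]. *)
Lemma wp_lemn_int (s0 : C) : (0 < Cmod s0 < 1)%R ->
  near s0 (fun s => ~ in_lattice w1 w2 (2 * lemn_int s) /\ weierstrass_p w1 w2 (2 * lemn_int s) = wp_lemn s).
Proof.
  intros Hs0. destruct (near_match w1 w2 Him Hode) as [d [Hd Hm]].
  (* At most d/2, so that t s0 falls into the region of the local match. *)
  set (t := Rmin (/ 2) (d / 2)). assert (Ht : (0 < t <= / 2 /\ t <= d / 2)%R).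
  { unfold t. repeat split; [apply Rmin_glb_lt; lra|apply Rmin_l|apply Rmin_r]. }
  assert (Hst0 : (Cmod (t * s0) = t * Cmod s0)%R) by (rewrite Cmod_mult, Cmod_R, Rabs_pos_eq; lra).
  assert (Hp0 : (0 < t * Cmod s0)%R) by (apply Rmult_lt_0_compat; lra).
  apply (wp_continuation (fun s => (0 < Cmod s < 1)%R) (fun s => 2 * lemn_int s) wp_lemn (t * s0) s0).
  - intros z Hz. exists (Rmin (Cmod z) (1 - Cmod z)). split; [apply Rmin_glb_lt; lra|]. intros w Hw.
    assert (H1 := Rlt_le_trans _ _ _ Hw (Rmin_l _ _)). assert (H2 := Rlt_le_trans _ _ _ Hw (Rmin_r _ _)).
    assert (H3 := Cmod_triangle_rev w z). assert (H4 := Cmod_triangle_rev z w). rewrite (Cmod_minus_sym z w) in H4. lra.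
  - intros z Hz. eexists. apply cderiv_scal, lemn_int_cderiv, Hz.
  - intros z Hz. assert (Hz0 : z <> 0) by (apply Cmod_gt_0, Hz). eexists. unfold wp_lemn.
    apply (cderiv_div (fun s => (1 + s ^ 4) ^ 2) (fun s => 4 * s ^ 2 * (1 - s ^ 4))).
    + apply (cderiv_pow (fun s => 1 + s ^ 4)). apply cderiv_plus; [apply cderiv_const|apply (cderiv_pow (fun x => x) z 1 4), cderiv_id].
    + apply (cderiv_mult (fun s => 4 * s ^ 2) (fun s => 1 - s ^ 4)).
      * apply cderiv_scal, (cderiv_pow (fun x => x) z 1 2), cderiv_id.
      * apply cderiv_minus; [apply cderiv_const|apply (cderiv_pow (fun x => x) z 1 4), cderiv_id].
    + apply Cmult_neq_0; [|apply one_minus_pow4, Hz]. apply Cmult_neq_0; [intros H; apply RtoC_inj in H; lra|apply Cpow_nz, Hz0].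
  - intros v Hv. replace (t * s0 + v * (s0 - t * s0)) with ((t + v * (1 - t))%R * s0) by (rewrite RtoC_plus, RtoC_mult, RtoC_minus; ring).
    assert (Hb : (0 < t + v * (1 - t) <= 1)%R) by nra. rewrite Cmod_mult, Cmod_R, Rabs_pos_eq by lra. nra.
  - exists (Rmin (t * Cmod s0) (d - t * Cmod s0)). split; [apply Rmin_glb_lt; [lra|nra]|]. intros w Hw.
    assert (H1 := Rlt_le_trans _ _ _ Hw (Rmin_l _ _)). assert (H2 := Rlt_le_trans _ _ _ Hw (Rmin_r _ _)).
    assert (H3 := Cmod_triangle_rev w (t * s0)). assert (H4 := Cmod_triangle_rev (t * s0) w). rewrite (Cmod_minus_sym (t * s0) w) in H4.
    apply Hm. lra.
Qed.
End Continuation.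

(** * The function u on the upper half-plane *)

Lemma upper_half_plane_open : copen upper_half_plane.
Proof.
  intros z Hz. exists (Im z). split; [exact Hz|]. intros w Hw. assert (H := Im_le_Cmod (w - z)). rewrite Im_minus in H.
  apply Rabs_le_between in H. unfold upper_half_plane in *. lra.
Qed.
Lemma upper_half_plane_rect : rect_closed upper_half_plane.
Proof. intros z w x Hz Hw [_ [Hx _]]. unfold upper_half_plane in *. eapply Rlt_le_trans; [|exact Hx]. apply Rmin_glb_lt; assumption. Qed.
Lemma upper_half_plane_segment (p q : C) (t : R) : upper_half_plane p -> upper_half_plane q -> (0 <= t <= 1)%R -> upper_half_plane (p + t * (q - p)).
Proof.
  intros H1 H2 Ht. unfold upper_half_plane in *. rewrite im_plus, im_scal_l, Im_minus. nra.
Qed.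

Definition theta_ratio (t : C) : C := theta3 t / theta2 t.
Definition theta_product (t : C) : C := theta2 t * theta3 t * theta4 t ^ 2.
(** The sum ell2 + ell3 + 2 ell4, with ell2 and ell3 expressed through [ell4]. *)
Definition log_deriv_product (t : C) : C := 4 * ell4 t + ipi / 4 * (theta3 t ^ 4 + theta2 t ^ 4).
(** [wp_lemn] at the theta quotient; the minus sign comes from 1 - s^4 = - theta4^4 / theta2^4. *)
Definition wp_theta (t : C) : C := - ((theta2 t ^ 4 + theta3 t ^ 4) ^ 2 / (4 * theta2 t ^ 2 * theta3 t ^ 2 * theta4 t ^ 4)).

Lemma u_formula_lemn_int (t : C) : upper t -> u_formula t = lemn_int (theta_ratio t).
Proof.
  intros Ht. destruct (theta_neq_0 t Ht) as [n2 [n3 n4]]. unfold u_formula, lemn_int. rewrite hyp2F1_power_series. unfold theta_ratio.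
  replace ((theta3 t / theta2 t) ^ 4) with (theta3 t ^ 4 / theta2 t ^ 4) by (field; exact n2). reflexivity.
Qed.

Lemma theta_ratio_neq_0 (t : C) : upper t -> theta_ratio t <> 0.
Proof.
  intros Ht H0. destruct (theta_neq_0 t Ht) as [n2 [n3 n4]]. apply n3. replace (theta3 t) with (theta_ratio t * theta2 t) by (unfold theta_ratio; field; exact n2).
  rewrite H0. ring.
Qed.

Lemma theta_ratio_cderiv (t : C) : upper t -> cderiv theta_ratio t (- (ipi / 4) * theta4 t ^ 4 * theta_ratio t).
Proof.
  intros Ht. destruct (theta_neq_0 t Ht) as [n2 [n3 n4]].
  eapply cderiv_eq; [apply (cderiv_div theta3 theta2); [apply cderiv_theta3, Ht|apply cderiv_theta2, Ht|exact n2]|].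
  replace (- (ipi / 4) * theta4 t ^ 4) with (- (ipi / 4 * theta4 t ^ 4)) by ring. rewrite <- (log_deriv_23 t Ht). unfold theta_ratio. field. split; assumption.
Qed.

Lemma wp_lemn_theta_ratio (t : C) : upper t -> wp_lemn (theta_ratio t) = wp_theta t.
Proof.
  intros Ht. destruct (theta_neq_0 t Ht) as [n2 [n3 n4]]. assert (HJ := jacobi_quartic t Ht). unfold wp_lemn, wp_theta, theta_ratio.
  assert (H4 : theta4 t ^ 4 = theta3 t ^ 4 - theta2 t ^ 4) by (rewrite HJ; ring).
  assert (N : theta3 t ^ 4 - theta2 t ^ 4 <> 0) by (rewrite <- H4; apply Cpow_nz, n4).
  rewrite H4. field. repeat split; try assumption.
  intros H0. apply N. replace (theta3 t ^ 4 - theta2 t ^ 4) with (- (theta2 t ^ 4 - theta3 t ^ 4)) by ring. rewrite H0. ring.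
Qed.

Lemma theta_product_neq_0 (t : C) : upper t -> theta_product t <> 0.
Proof. intros Ht. destruct (theta_neq_0 t Ht) as [n2 [n3 n4]]. unfold theta_product. apply Cmult_neq_0; [apply Cmult_neq_0; assumption|apply Cpow_nz, n4]. Qed.

Lemma dtheta4_ell4 (t : C) : upper t -> dtheta4 t = theta4 t * ell4 t.
Proof. intros Ht. destruct (theta_neq_0 t Ht) as [n2 [n3 n4]]. unfold ell4. field. exact n4. Qed.

Lemma theta_product_cderiv (t : C) : upper t -> cderiv theta_product t (theta_product t * log_deriv_product t).
Proof.
  intros Ht. eapply cderiv_eq.
  - apply (cderiv_mult (fun t => theta2 t * theta3 t) (fun t => theta4 t ^ 2)).
    + apply (cderiv_mult theta2 theta3); [apply cderiv_theta2, Ht|apply cderiv_theta3, Ht].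
    + apply (cderiv_pow theta4), cderiv_theta4, Ht.
  - rewrite (dtheta2_ell4 t Ht), (dtheta3_ell4 t Ht), (dtheta4_ell4 t Ht). simpl INR. simpl pred. replace (RtoC (1 + 1)) with (RtoC 2) by (f_equal; ring).
    unfold theta_product, log_deriv_product. field.
Qed.

(** With L = u''/u' the Schwarz expression is (L' - L^2/2) / u'^2, which explains the term L^2/2
    split off here; Halphen's equation evaluates the rest. *)
Lemma log_deriv_product_cderiv (t : C) : upper t -> cderiv log_deriv_product t (/ 2 * (log_deriv_product t * log_deriv_product t) - ipi * ipi / 32 * (theta2 t ^ 4 + theta3 t ^ 4) ^ 2).
Proof.
  intros Ht. eapply cderiv_eq.
  - apply cderiv_plus; [apply cderiv_scal, cderiv_ell4, Ht|]. apply cderiv_scal.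
    apply cderiv_plus; [apply (cderiv_pow theta3), cderiv_theta3, Ht|apply (cderiv_pow theta2), cderiv_theta2, Ht].
  - rewrite (halphen t Ht), (dtheta2_ell4 t Ht), (dtheta3_ell4 t Ht). simpl INR. simpl pred. replace (RtoC (1 + 1 + 1 + 1)) with (RtoC 4) by (f_equal; ring).
    unfold log_deriv_product. field.
Qed.

Lemma zero_deriv_const (f : C -> C) (c : C) (d : R) : (forall w, (Cmod (w - c) < d)%R -> cderiv f w 0) ->
  forall w, (Cmod (w - c) < d)%R -> f w = f c.
Proof.
  intros H w Hw. apply Ceq_minus, Cmod_eq_0. apply Rle_antisym; [|apply Cmod_ge_0].
  eapply Rle_trans; [apply (mean_value_ineq f (fun _ => 0) c w 0)|rewrite Rmult_0_l; lra].
  - intros t Ht. apply H. replace (c + t * (w - c) - c) with (t * (w - c)) by ring. rewrite Cmod_mult, Cmod_R, Rabs_pos_eq by lra.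
    generalize (Cmod_ge_0 (w - c)). nra.
  - intros t Ht. rewrite Cmod_0. lra.
Qed.

(** Near the base point u' = - (pi i / 4) rho theta2 theta3 theta4^2, and rho^2 = -1 by Jacobi's
    quartic identity, so rho is locally constant. Which square root it is remains open, hence the
    conclusion on k * k. *)
Lemma u_derivative (u : C -> C) (tau0 : C) : holo upper_half_plane u -> upper tau0 -> (Cmod (theta_ratio tau0) < 1)%R ->
  near tau0 (fun t => u t = lemn_int (theta_ratio t)) ->
  exists k, k * k = - (ipi * ipi / 16) /\ forall t, upper t -> cderiv u t (k * theta_product t).
Proof.
  intros Hu H0 Hs0 Hloc.
  assert (Hn : near tau0 (fun t => upper_half_plane t /\ ((Cmod (theta_ratio t) < 1)%R /\ near t (fun t => u t = lemn_int (theta_ratio t))))).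
  { apply near_and; [apply upper_half_plane_open, H0|]. apply near_and; [|apply near_open, Hloc].
    apply (near_ccont theta_ratio tau0 (fun s => (Cmod s < 1)%R)); [apply (cderiv_ccont _ _ _ (theta_ratio_cderiv tau0 H0))|].
    exists (1 - Cmod (theta_ratio tau0))%R. split; [lra|]. intros w Hw. assert (H := Cmod_triangle_rev w (theta_ratio tau0)). lra. }
  destruct Hn as [d [Hd Hn]].
  set (rho := fun t => lemn_int' (theta_ratio t) * (theta4 t ^ 2 / theta2 t ^ 2)).
  assert (Hrho2 : forall t, (Cmod (t - tau0) < d)%R -> rho t * rho t = - (1)).
  { intros t Ht. destruct (Hn t Ht) as [Hpt [Hst _]]. destruct (theta_neq_0 t Hpt) as [n2 [n3 n4]]. assert (HB := lemn_int'_sq _ Hst).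
    unfold rho. transitivity (lemn_int' (theta_ratio t) * lemn_int' (theta_ratio t) * (theta4 t ^ 4 / theta2 t ^ 4)); [field; exact n2|].
    assert (H4 : theta4 t ^ 4 = theta3 t ^ 4 - theta2 t ^ 4) by (rewrite (jacobi_quartic t Hpt); ring). rewrite H4.
    replace ((theta3 t ^ 4 - theta2 t ^ 4) / theta2 t ^ 4) with (- (1 - theta_ratio t ^ 4)) by (unfold theta_ratio; field; exact n2).
    replace (lemn_int' (theta_ratio t) * lemn_int' (theta_ratio t) * - (1 - theta_ratio t ^ 4)) with (- (lemn_int' (theta_ratio t) * lemn_int' (theta_ratio t) * (1 - theta_ratio t ^ 4))) by ring. rewrite HB. reflexivity. }
  assert (Hrho : forall t, (Cmod (t - tau0) < d)%R -> cderiv rho t 0).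
  { intros t Ht. destruct (Hn t Ht) as [Hpt [Hst _]]. destruct (theta_neq_0 t Hpt) as [n2 [n3 n4]].
    destruct (lemn_int'_cderiv _ Hst) as [lb Hlb].
    assert (Hex : exists l, cderiv rho t l).
    { eexists. apply (cderiv_mult (fun t => lemn_int' (theta_ratio t)) (fun t => theta4 t ^ 2 / theta2 t ^ 2)).
      - apply (cderiv_comp lemn_int' theta_ratio); [exact Hlb|apply theta_ratio_cderiv, Hpt].
      - apply (cderiv_div (fun t => theta4 t ^ 2) (fun t => theta2 t ^ 2)); [apply (cderiv_pow theta4), cderiv_theta4, Hpt|apply (cderiv_pow theta2), cderiv_theta2, Hpt|apply Cpow_nz, n2]. }
    destruct Hex as [l Hl]. assert (E0 : l * rho t + rho t * l = 0).
    { apply (cderiv_unique (fun t => rho t * rho t) t); [apply (cderiv_mult rho rho); exact Hl|].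
      apply cderiv_ext_loc with (fun _ => - (1)); [|apply cderiv_const]. exists (d - Cmod (t - tau0))%R. split; [lra|]. intros w Hw. symmetry. apply Hrho2.
      eapply Rle_lt_trans; [apply (Cmod_triangle_dist w t tau0)|lra]. }
    (* Since 2 rho rho' = 0 and rho^2 = -1, also rho' = - rho^2 rho' = 0. *)
    replace (RtoC 0) with l; [exact Hl|]. assert (Hr := Hrho2 t Ht).
    replace l with (- (/ 2) * (l * rho t + rho t * l) * rho t + l * (rho t * rho t + 1)) by field. rewrite E0, Hr. ring. }
  set (k := - (ipi / 4) * rho tau0). exists k.
  assert (Hc0 : (Cmod (tau0 - tau0) < d)%R) by (replace (tau0 - tau0) with (RtoC 0) by ring; rewrite Cmod_0; exact Hd).
  split. { unfold k. replace (- (ipi / 4) * rho tau0 * (- (ipi / 4) * rho tau0)) with (ipi * ipi / 16 * (rho tau0 * rho tau0)) by field. rewrite (Hrho2 tau0 Hc0). field. }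
  assert (Hu0 : forall t, (Cmod (t - tau0) < d)%R -> cderiv u t (k * theta_product t)).
  { intros t Ht. destruct (Hn t Ht) as [Hpt [Hst Hnt]]. destruct (theta_neq_0 t Hpt) as [n2 [n3 n4]].
    apply (cderiv_ext_loc (fun t => lemn_int (theta_ratio t))).
    { destruct Hnt as [d' [Hd' W]]. exists d'. split; [exact Hd'|]. intros w Hw. symmetry. apply W, Hw. }
    eapply cderiv_eq; [apply (cderiv_comp lemn_int theta_ratio); [apply lemn_int_cderiv, Hst|apply theta_ratio_cderiv, Hpt]|].
    unfold k. rewrite <- (zero_deriv_const rho tau0 d Hrho t Ht). unfold rho, theta_product, theta_ratio. field. exact n2. }
  (* The identity theorem is applied to u - V, with V a primitive of the expected derivative: u'
     itself is not yet known to be differentiable. *)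
  destruct (holo_primitive upper_half_plane (fun t => k * theta_product t) tau0 upper_half_plane_open upper_half_plane_rect) as [V HV]; [|exact H0|].
  { intros t Ht. eexists. apply cderiv_scal, theta_product_cderiv, Ht. }
  set (f := fun t => u t - V t - (u tau0 - V tau0)).
  assert (Hf : holo upper_half_plane f).
  { intros t Ht. destruct (Hu t Ht) as [l Hl]. eexists. apply cderiv_minus; [apply cderiv_minus; [exact Hl|apply HV, Ht]|apply cderiv_const]. }
  assert (Hfz : zero_near f tau0).
  { exists d. split; [exact Hd|]. intros w Hw.
    rewrite (zero_deriv_const f tau0 d); [unfold f; ring| |exact Hw].
    intros t Ht. destruct (Hn t Ht) as [Hpt _].
    eapply cderiv_eq; [apply cderiv_minus; [apply cderiv_minus; [apply Hu0, Ht|apply HV, Hpt]|apply cderiv_const]|ring]. }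
  intros t Ht.
  assert (Hz := identity_segment upper_half_plane f tau0 t upper_half_plane_open Hf (fun v Hv => upper_half_plane_segment tau0 t v H0 Ht Hv) Hfz 1%R ltac:(lra)). rewrite line_1 in Hz.
  destruct Hz as [d' [Hd' Hz]]. apply (cderiv_ext_loc (fun t => V t + (u tau0 - V tau0))).
  - exists d'. split; [exact Hd'|]. intros w Hw. specialize (Hz w Hw). unfold f in Hz. symmetry. apply Ceq_minus.
    replace (u w - (V w + (u tau0 - V tau0))) with (u w - V w - (u tau0 - V tau0)) by ring. exact Hz.
  - eapply cderiv_eq; [apply cderiv_plus; [apply HV, Ht|apply cderiv_const]|ring].
Qed.

Lemma wp_theta_holo : holo upper_half_plane wp_theta.
Proof.
  intros t Ht. destruct (theta_neq_0 t Ht) as [n2 [n3 n4]].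
  assert (H2 : forall n, exists l, cderiv (fun t => theta2 t ^ n) t l) by (intros n; eexists; apply (cderiv_pow theta2), cderiv_theta2, Ht).
  assert (H3 : forall n, exists l, cderiv (fun t => theta3 t ^ n) t l) by (intros n; eexists; apply (cderiv_pow theta3), cderiv_theta3, Ht).
  assert (H4 : forall n, exists l, cderiv (fun t => theta4 t ^ n) t l) by (intros n; eexists; apply (cderiv_pow theta4), cderiv_theta4, Ht).
  destruct (H2 4%nat) as [a1 A1]. destruct (H3 4%nat) as [a2 A2]. destruct (H2 2%nat) as [a3 A3]. destruct (H3 2%nat) as [a4 A4]. destruct (H4 4%nat) as [a5 A5].
  eexists. apply cderiv_opp. apply (cderiv_div (fun t => (theta2 t ^ 4 + theta3 t ^ 4) ^ 2) (fun t => 4 * theta2 t ^ 2 * theta3 t ^ 2 * theta4 t ^ 4)).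
  - apply (cderiv_pow (fun t => theta2 t ^ 4 + theta3 t ^ 4)). apply cderiv_plus; [exact A1|exact A2].
  - apply (cderiv_mult (fun t => 4 * theta2 t ^ 2 * theta3 t ^ 2) (fun t => theta4 t ^ 4)); [|exact A5].
    apply (cderiv_mult (fun t => 4 * theta2 t ^ 2) (fun t => theta3 t ^ 2)); [|exact A4]. apply cderiv_scal, A3.
  - apply Cmult_neq_0; [|apply Cpow_nz, n4]. apply Cmult_neq_0; [|apply Cpow_nz, n3]. apply Cmult_neq_0; [|apply Cpow_nz, n2].
    intros H; apply RtoC_inj in H; lra.
Qed.

Lemma schwarz_value (u : C -> C) (k : C) : k * k = - (ipi * ipi / 16) -> (forall t, upper t -> cderiv u t (k * theta_product t)) ->
  forall t, upper t -> schwarz u t = - (2) * wp_theta t.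
Proof.
  intros Hk Hu t Ht. destruct (theta_neq_0 t Ht) as [n2 [n3 n4]]. assert (HG := theta_product_neq_0 t Ht).
  assert (Hloc : forall (f g : C -> C) s l, upper s -> (forall t, upper t -> g t = f t) -> cderiv g s l -> cderiv f s l).
  { intros f g s l Hs H. apply cderiv_ext_loc. destruct (upper_half_plane_open s Hs) as [d [Hd W]]. exists d. split; [exact Hd|]. intros w Hw. apply H, W, Hw. }
  (* [C_derive] depends on a whole neighbourhood, so each formula is established on the half-plane
     before the next differentiation. *)
  assert (E1 : forall s, upper s -> k * theta_product s = C_derive u s) by (intros s Hs; symmetry; apply cderiv_C_derive, Hu, Hs).
  assert (E2 : forall s, upper s -> k * (theta_product s * log_deriv_product s) = C_derive (C_derive u) s).
  { intros s Hs. symmetry. apply cderiv_C_derive. apply (Hloc _ (fun t => k * theta_product t)); [exact Hs|exact E1|]. apply cderiv_scal, theta_product_cderiv, Hs. }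
  set (dL := / 2 * (log_deriv_product t * log_deriv_product t) - ipi * ipi / 32 * (theta2 t ^ 4 + theta3 t ^ 4) ^ 2).
  assert (E3 : k * (theta_product t * log_deriv_product t * log_deriv_product t + theta_product t * dL) = C_derive (C_derive (C_derive u)) t).
  { symmetry. apply cderiv_C_derive. apply (Hloc _ (fun t => k * (theta_product t * log_deriv_product t))); [exact Ht|exact E2|].
    apply cderiv_scal, (cderiv_mult theta_product log_deriv_product); [apply theta_product_cderiv, Ht|apply log_deriv_product_cderiv, Ht]. }
  unfold schwarz. rewrite <- E1, <- E2, <- E3 by exact Ht.
  assert (Hk0 : k <> 0).
  { intros H0. assert (Hi := Cmult_neq_0 _ _ ipi_neq_0 ipi_neq_0). apply Hi. replace (ipi * ipi) with (- (16) * - (ipi * ipi / 16)) by field. rewrite <- Hk, H0. ring. }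
  assert (Hi : ipi * ipi = - (16) * (k * k)) by (rewrite Hk; field).
  (* With G the theta product and L its logarithmic derivative, u'' = k G L and u''' = k G (L^2 +
     L'), so the Schwarz expression collapses to (L' - L^2/2) / (k G)^2. *)
  transitivity ((dL - / 2 * (log_deriv_product t * log_deriv_product t)) / (k * k * (theta_product t * theta_product t))); [field; split; assumption|].
  unfold dL. rewrite Hi. unfold theta_product, wp_theta. field. repeat split; assumption.
Qed.

(** The first two conclusions make the third one meaningful: [schwarz] and [weierstrass_p] also
    return values where u' = 0 or where 2u is a lattice point. *)
Theorem mainTheorem1 (u : C -> C) (hu : is_continuation_of_u_formula u)
    (w1 w2 : C) (hw : weierstrass_periods 4 0 w1 w2) :
  forall tau : C, upper_half_plane tau ->
    C_derive u tau <> 0 /\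
    ~ in_lattice w1 w2 (2 * u tau) /\
    schwarz u tau = - 2 * weierstrass_p w1 w2 (2 * u tau).
Proof.
  destruct hu as [Hhol [tau0 [H0 [Hx Hloc]]]]. destruct hw as [Him Hode].
  assert (Hu : holo upper_half_plane u).
  { intros z Hz. destruct (Hhol z Hz) as [l Hl]. exists l. apply cderiv_is_derive, Hl. }
  assert (Hs0 : (0 < Cmod (theta_ratio tau0) < 1)%R).
  { split; [apply Cmod_gt_0, theta_ratio_neq_0, H0|]. apply Rnot_le_lt. intros H1.
    destruct (theta_neq_0 tau0 H0) as [n2 _].
    replace (theta3 tau0 ^ 4 / theta2 tau0 ^ 4) with (theta_ratio tau0 ^ 4) in Hx by (unfold theta_ratio; field; exact n2).
    rewrite Cmod_pow in Hx. assert (H2 := pow_R1_Rle _ 4 H1). lra. }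
  assert (Hloc' : near tau0 (fun t => u t = lemn_int (theta_ratio t))).
  { apply locally_Cmod in Hloc. generalize (near_and _ _ _ Hloc (upper_half_plane_open tau0 H0)). apply near_imp. intros t [Ht1 Ht2].
    rewrite Ht1. apply u_formula_lemn_int, Ht2. }
  destruct (u_derivative u tau0 Hu H0 (proj2 Hs0) Hloc') as [k [Hk Hd]].
  intros tau Ht.
  assert (Hn : near tau (fun t => ~ in_lattice w1 w2 (2 * u t) /\ weierstrass_p w1 w2 (2 * u t) = wp_theta t)).
  { apply (wp_continuation w1 w2 Him upper_half_plane (fun t => 2 * u t) wp_theta tau0 tau upper_half_plane_open).
    - intros t Hpt. eexists. apply cderiv_scal, Hd, Hpt.
    - apply wp_theta_holo.
    - intros t Hpt. apply upper_half_plane_segment; assumption.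
    (* The identity around s0 in the s-disc is pulled back by the continuous theta quotient to a
       neighbourhood of the base point. *)
    - assert (HW := wp_lemn_int w1 w2 Him Hode (theta_ratio tau0) Hs0).
      assert (HW' := near_ccont theta_ratio tau0 _ (cderiv_ccont _ _ _ (theta_ratio_cderiv tau0 H0)) HW).
      generalize (near_and _ _ _ HW' (near_and _ _ _ Hloc' (upper_half_plane_open tau0 H0))). apply near_imp.
      intros t [HWt [Hut Hpt]]. rewrite Hut, <- (wp_lemn_theta_ratio t Hpt). exact HWt. }
  destruct (near_self _ _ Hn) as [N1 N2]. split; [|split; [exact N1|]].
  - rewrite (cderiv_C_derive _ _ _ (Hd tau Ht)). apply Cmult_neq_0; [|apply theta_product_neq_0, Ht].
    intros Hk0. assert (Hi := Cmult_neq_0 _ _ ipi_neq_0 ipi_neq_0). apply Hi. replace (ipi * ipi) with (- (16) * - (ipi * ipi / 16)) by field. rewrite <- Hk, Hk0. ring.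
  - rewrite N2, (schwarz_value u k Hk Hd tau Ht). ring.
Qed.
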